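(* Let $(X,\mu)$ be a standard probability space and let $\mathcal{S}\leq \mathcal{R}$ be discrete, measure-preserving equivalence relations on $(X,\mu)$. If the inclusion $\mathcal{S}\leq \mathcal{R}$ is coamenable and $\mathcal{R}$ is strongly ergodic, then there is an $\mathcal{S}$-invariant measurable set $E\subseteq X$ with $\mu(E)>0$ such that $\mathcal{S}|_{E}$ is strongly ergodic.
   Context: An equivalence relation over a standard probability space $(X,\mu)$ is a Borel subset $\mathcal{R}\subseteq X\times X$ that is an equivalence relation on $X$; $[x]_{\mathcal{R}}$ denotes the class of $x$. It is discrete if $[x]_{\mathcal{R}}$ is countable for almost every $x$. For discrete $\mathcal{R}$ set $\mu_{\mathcal{R}}(E)=\int_X |\{y:(x,y)\in E\}|\,d\mu(x)$ for Borel $E\subseteq\mathcal{R}$ (and its completion); $\mathcal{R}$ is measure-preserving if $(x,y)\mapsto(y,x)$ preserves $\mu_{\mathcal{R}}$. $\mathcal{S}\leq\mathcal{R}$ means $\mathcal{S}\subseteq\mathcal{R}$, both relations over the same $(X,\mu)$. For $E\subseteq X$ with $\mu(E)>0$, $\mathcal{R}|_E=\mathcal{R}\cap(E\times E)$, a measure-preserving relation over the probability space $(E,\mu(E\cap\cdot)/\mu(E))$. The full group $[\mathcal{R}]$ is the group of bimeasurable bijections $\gamma:X\to X$ with $\gamma(x)\in[x]_{\mathcal{R}}$ for almost every $x$, modulo almost everywhere equality. A measurable $E$ is $\mathcal{R}$-invariant if $\mu(\gamma E\Delta E)=0$ for all $\gamma\in[\mathcal{R}]$. $\mathcal{R}$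 is strongly ergodic if whenever $(E_n)_n$ is a sequence of measurable subsets of $X$ with $\mu(\gamma E_n\Delta E_n)\to 0$ for all $\gamma\in[\mathcal{R}]$, then $\mu(E_n)(1-\mu(E_n))\to 0$. Coamenability: for $\mathcal{S}\leq\mathcal{R}$ and $x\in X$ let $[x]_{\mathcal{R}}/\mathcal{S}$ be the set of $\mathcal{S}$-classes contained in $[x]_{\mathcal{R}}$. A family $\xi=(\xi_x)_{x\in X}$ with $\xi_x\in\ell^2([x]_{\mathcal{R}}/\mathcal{S})$ is measurable if $x\mapsto \xi_x([\gamma(x)]_{\mathcal{S}})$ is measurable for all $\gamma\in[\mathcal{R}]$. The inclusion $\mathcal{S}\leq\mathcal{R}$ is coamenable if there is a sequence of measurable families $\xi^{(n)}$ with $\|\xi^{(n)}_x\|_2=1$ for almost every $x$ and $\lim_{n}\|\xi^{(n)}_x-\xi^{(n)}_y\|_2=0$ for almost every $(x,y)\in\mathcal{R}$. This is equivalent to the inclusion of von Neumann algebras $L(\mathcal{S})\subseteq L(\mathcal{R})$ being relatively amenable (coamenable) in the sense of Popa. *)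

(* Defs.v *)
From mathcomp Require Import all_boot all_order all_algebra.
From mathcomp Require Import complex.
From mathcomp Require Import all_classical all_reals all_analysis.
Set Implicit Arguments.
Unset Strict Implicit.
Unset Printing Implicit Defensive.
Import Order.TTheory GRing.Theory Num.Theory.
Import numFieldNormedType.Exports.
Local Open Scope classical_set_scope.
Local Open Scope ring_scope.
Local Open Scope ereal_scope.

(* Polish topology: the pseudometric of [P] is complete, and Hausdorff
   separation makes it a metric. [<<s open >>] is the Borel sigma-algebra. *)
Definition standard_borel (R : realType) (d : measure_display)
    (T : measurableType d) : Prop :=
  exists (P : completePseudoMetricType R) (f : T -> P),
    [/\ hausdorff_space P,
        (exists2 D : set P, countable D & dense D),
        bijective f &
        forall A : set T, measurable A <->
          exists2 B : set P, <<s [set U : set P | open U] >> B & A = f @^-1` B].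

(* A relation on [T] is a subset of [T * T]. *)
Definition rclass (T : Type) (cR : set (T * T)) (x : T) : set T :=
  [set y | cR (x, y)].

Definition borel_equivalence (d : measure_display) (T : measurableType d)
    (cR : set (T * T)) : Prop :=
  [/\ measurable cR,
      (forall x, cR (x, x)),
      (forall x y, cR (x, y) -> cR (y, x)) &
      (forall x y z, cR (x, y) -> cR (y, z) -> cR (x, z))].

Definition discrete_rel (d : measure_display) (T : measurableType d)
    (R : realType) (mu : probability T R) (cR : set (T * T)) : Prop :=
  {ae mu, forall x, countable (rclass cR x)}.

(* Extended from subsets of [cR] to subsets of [T * T] as a set function
   concentrated on [cR]. *)
Definition mu_rel (d : measure_display) (T : measurableType d) (R : realType)
    (mu : probability T R) (cR : set (T * T)) (E : set (T * T)) : \bar R :=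
  \int[mu]_x counting (rclass (E `&` cR) x).

Definition measure_preserving_rel (d : measure_display) (T : measurableType d)
    (R : realType) (mu : probability T R) (cR : set (T * T)) : Prop :=
  forall E : set (T * T), measurable E -> E `<=` cR ->
    mu_rel mu cR [set p | E (p.2, p.1)] = mu_rel mu cR E.

Definition dmp_equivalence (d : measure_display) (T : measurableType d)
    (R : realType) (mu : probability T R) (cR : set (T * T)) : Prop :=
  [/\ borel_equivalence cR, discrete_rel mu cR & measure_preserving_rel mu cR].

(* In [full_group], [invariant_set] and [strongly_ergodic] the underlying
   probability space is the measurable subset [A] of [T] with the probability
   measure [nu] concentrated on [A]: [(setT, mu)] for the space itself,
   [(E, cond_measure mu E)] for a restriction. (A measurableType is pointed, so
   the subset [E] is not made into a measurableType.) *)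

(* The full group is represented by its Borel bijections, without the quotient
   by almost everywhere equality: the notions below only depend on the class. *)
Definition full_group (d : measure_display) (T : measurableType d)
    (R : realType) (A : set T) (nu : set T -> \bar R) (cR : set (T * T)) :
    set (T -> T) :=
  [set g | [/\ set_bij A A g,
               measurable_fun A g,
               (forall B, measurable B -> B `<=` A -> measurable (g @` B)) &
               {ae nu, forall x, A x -> rclass cR x (g x)}]].

Definition invariant_set (d : measure_display) (T : measurableType d)
    (R : realType) (A : set T) (nu : set T -> \bar R) (cR : set (T * T))
    (E : set T) : Prop :=
  forall g, full_group A nu cR g -> nu ((g @` E) `+` E) = 0.

Definition strongly_ergodic (d : measure_display) (T : measurableType d)
    (R : realType) (A : set T) (nu : set T -> \bar R) (cR : set (T * T)) :
    Prop :=
  forall E : nat -> set T,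
    (forall n, measurable (E n)) -> (forall n, E n `<=` A) ->
    (forall g, full_group A nu cR g ->
      (fun n => nu ((g @` E n) `+` E n)) @ \oo --> 0) ->
    (fun n => nu (E n) * (1 - nu (E n))) @ \oo --> 0.

Definition cond_measure (d : measure_display) (T : measurableType d)
    (R : realType) (mu : probability T R) (E : set T) : set T -> \bar R :=
  fun B => mu (E `&` B) * ((fine (mu E))^-1)%:E.

Definition restrict_rel (T : Type) (cR : set (T * T)) (E : set T) :
    set (T * T) :=
  cR `&` (E `*` E).

Definition quotient_classes (T : Type) (cS cR : set (T * T)) (x : T) :
    set (set T) :=
  [set c | (exists y, c = rclass cS y) /\ c `<=` rclass cR x].

Definition l2norm (R : realType) (I : choiceType) (D : set I) (f : I -> R[i]) :
    \bar R :=
  sqrte (\esum_(c in D) ((complex.Re (f c)) ^+ 2 + (complex.Im (f c)) ^+ 2)%:E).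

Definition ae_measurable (d : measure_display) (T : measurableType d)
    (R : realType) (mu : probability T R) (f : T -> R) : Prop :=
  exists2 g : T -> R, measurable_fun setT g & {ae mu, forall x, f x = g x}.

(* An element of l^2([x]_cR / cS) is a function on all subsets of [T] that
   vanishes outside the quotient. Measurability is up to a null set, since
   [g x] may leave the class of [x] on a null set. *)
Definition measurable_l2_family (d : measure_display) (T : measurableType d)
    (R : realType) (mu : probability T R) (cS cR : set (T * T))
    (xi : T -> set T -> R[i]) : Prop :=
  [/\ (forall x c, ~ quotient_classes cS cR x c -> xi x c = 0%R),
      (forall x, l2norm (quotient_classes cS cR x) (xi x) < +oo) &
      (forall g, full_group setT mu cR g ->
         ae_measurable mu (fun x => complex.Re (xi x (rclass cS (g x)))) /\
         ae_measurable mu (fun x => complex.Im (xi x (rclass cS (g x)))))].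

(* For [(x, y)] in [cR] the quotients attached to [x] and [y] coincide. *)
Definition coamenable (d : measure_display) (T : measurableType d)
    (R : realType) (mu : probability T R) (cS cR : set (T * T)) : Prop :=
  exists xi : nat -> T -> set T -> R[i],
    [/\ (forall n, measurable_l2_family mu cS cR (xi n)),
        (forall n, {ae mu, forall x,
           l2norm (quotient_classes cS cR x) (xi n x) = 1}) &
        {ae mu_rel mu cR, forall p, cR p ->
           (fun n => l2norm (quotient_classes cS cR p.1)
                       (fun c => (xi n p.1 c - xi n p.2 c)%R)) @ \oo --> 0}].

(* Main.v *)
Require Import Defs.
From mathcomp Require Import all_boot all_order all_algebra.
From mathcomp Require finmap.
From mathcomp Require Import complex.
From mathcomp Require Import all_classical all_reals all_analysis.
From mathcomp Require Import measurable_realfun ring lra zify.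
Import Order.TTheory GRing.Theory Num.Theory.
Import numFieldNormedType.Exports.

(** The proof plays the coamenability of the inclusion against the expansion that
    comes from the strong ergodicity of [cR].

    Both relations are generated, up to a null set, by countably many measurable
    involutions ([generating_involutions]). This rests on a uniformization theorem
    for measurable sets with countable sections ([countable_sections]), proved up
    to a null set of fibres: the set is written as the set of branches of a scheme
    indexed by finite sequences of naturals; at each node the base points whose
    branch values are already enumerated by measurable maps are removed; the points
    that remain at the root would have uncountably many values, by the Baire
    argument for perfect sets.

    Strong ergodicity of [cR] gives a linear isoperimetric inequality
    [m A * (1 - m A) <= C * (boundary of A)] for finitely many involutions
    ([strongly_ergodic_expansion]). If it failed, sets of small relative boundary
    could be piled up until their mass is bounded away from 0 and 1.

    For [cS] there is a dichotomy ([component_or_coloring]), decided by the infimum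
    of the energy (the sum of the squared masses of the classes) over the finite
    colorings of the space that are almost invariant under the generators of [cS].
    If the infima vanish, there are almost invariant colorings with arbitrarily
    small classes. If they do not, the large classes of nearly optimal colorings
    cannot be cut by almost invariant sets; along a subsequence these almost atoms
    converge to an invariant set, and the restriction of [cS] to it is strongly
    ergodic, which is what is wanted.

    It remains to exclude the colorings with small classes. Coamenability gives unit
    vectors [xi x] in l2 of the [cS]-classes contained in the [cR]-class of [x],
    which hardly change when [x] moves along [cR]. A coloring that is almost
    constant on [cS]-classes colours these classes, and the part [F c x] of the
    squared norm of [xi x] carried by the colour [c] is then almost [cR]-invariant,
    with total 1 over all [c]. It vanishes unless [x] has the colour [c] within
    finitely many moves, so that the level sets of each [F c] are small as soon as
    the classes of the coloring are. Expansion forces small sets to have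
    boundaries comparable to their masses, whereas the boundaries of all the level sets of all the [F c] sum up
    to little by almost invariance: this is the contradiction
    ([coloring_contradiction]). *)

Set Implicit Arguments.
Unset Strict Implicit.
Unset Printing Implicit Defensive.
Local Open Scope classical_set_scope.

(** * Countable quantifiers and Suslin sets *)

Lemma inv_natS_lt (R : realType) (e : R) :
  (0 < e)%R -> exists n : nat, (n.+1%:R^-1 < e)%R.
Proof.
move=> e0; have [n _ H] := near_infty_natSinv_lt (PosNum e0).
by exists n; exact: (H n (leqnn n)).
Qed.

Lemma small_pow (R : realType) (e : R) :
  (0 < e)%R -> exists n, ((2 ^+ n)^-1 < e)%R.
Proof.
move=> e0; have [n _ H] := near_infty_natSinv_expn_lt (PosNum e0).
by exists n; rewrite -div1r; exact: (H n (leqnn n)).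
Qed.

Section countable_measurability.
Context d (X : measurableType d).

Lemma measurable_cexists (I : countType) (F : I -> set X) :
  (forall i, measurable (F i)) -> measurable [set x | exists i, F i x].
Proof.
move=> mF; rewrite (_ : mkset _ = \bigcup_i F i).
  by apply: countable_bigcupT_measurable; [exact: countableP|].
by apply/seteqP; split => x /= [j]; [exists j|move=> _ ?; exists j].
Qed.

Lemma measurable_cforall (I : countType) (F : I -> set X) :
  (forall i, measurable (F i)) -> measurable [set x | forall i, F i x].
Proof.
move=> mF; rewrite (_ : mkset _ = ~` [set x | exists i, (~` F i) x]).
  by apply/measurableC/measurable_cexists => i; exact: measurableC.
apply/seteqP; split => x /= H; first by case=> i nF; apply: nF; exact: H.
by move=> i; apply: contrapT => nF; apply: H; exists i.
Qed.

Lemma measurable_constP (Q : Prop) : measurable [set _ : X | Q].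
Proof.
have [q|nq] := pselect Q.
  rewrite (_ : mkset _ = setT); first exact: measurableT.
  by apply/seteqP; split.
rewrite (_ : mkset _ = set0); first exact: measurable0.
by apply/seteqP; split.
Qed.

Lemma measurable_imp (Q : Prop) (F : set X) :
  (Q -> measurable F) -> measurable [set x | Q -> F x].
Proof.
have [q|nq] := pselect Q => mF.
  rewrite (_ : mkset _ = F); first exact: mF.
  by apply/seteqP; split => x //=; apply.
rewrite (_ : mkset _ = setT); first exact: measurableT.
by apply/seteqP; split => x /=.
Qed.

Lemma measurable_andP (Q : Prop) (F : set X) :
  (Q -> measurable F) -> measurable [set x | Q /\ F x].
Proof.
have [q|nq] := pselect Q => mF.
  rewrite (_ : mkset _ = F); first exact: mF.
  by apply/seteqP; split => x //=; case.
rewrite (_ : mkset _ = set0); first exact: measurable0.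
by apply/seteqP; split => x // -[].
Qed.

End countable_measurability.

(** The Suslin operation applied to rectangles with a measurable and a closed
    side. The base only has a sigma-algebra and the fibre only a topology, so the
    two sides are closed under different operations. *)
Definition suslin d (X : measurableType d) (P : topologicalType)
    (E : set (X * P)) : Prop :=
  exists (A : seq nat -> set X) (V : seq nat -> set P),
    [/\ forall s, measurable (A s), forall s, closed (V s) &
        forall x y, E (x, y) <->
          exists rho : nat -> nat, forall n,
            A (mkseq rho n) x /\ V (mkseq rho n) y].

Section suslin_sets.
Context d (X : measurableType d) (P : topologicalType).
Lemma suslin_rect (A : set X) (V : set P) :
  measurable A -> closed V -> suslin (A `*` V).
Proof.
move=> mA cV; exists (fun=> A), (fun=> V); split => // x y; split.
  by move=> [/= Ax Vy]; exists (fun=> 0).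
by move=> [rho /(_ 0)[]].
Qed.

(** The first entry of a branch selects the set, the rest is a branch of it. *)
Lemma suslin_bigcup (E : nat -> set (X * P)) :
  (forall i, suslin (E i)) -> suslin (\bigcup_i E i).
Proof.
move=> /choice[A] /choice[V HAV].
exists (fun s => if s is i :: s' then A i s' else setT),
       (fun s => if s is i :: s' then V i s' else setT); split.
- by case=> [|i s]; [exact: measurableT|have [+ _ _] := HAV i].
- by case=> [|i s]; [exact: closedT|have [_ + _] := HAV i].
move=> x y; split.
  move=> [i _]; have [_ _ /(_ x y)[+ _]] := HAV i => /[apply] -[rho Hrho].
  exists (fun n => if n is m.+1 then rho m else i) => -[//|n].
  have -> : mkseq (fun n => if n is m.+1 then rho m else i) n.+1 =
            i :: mkseq rho n.
    by rewrite /mkseq /= -[1]/(1 + 0) iotaDl -map_comp.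
  exact: Hrho.
move=> [rho Hrho]; exists (rho 0) => //.
have [_ _ /(_ x y)[_]] := HAV (rho 0); apply.
exists (fun n => rho n.+1) => n; have := Hrho n.+1.
suff -> : mkseq rho n.+1 = rho 0 :: mkseq (fun n => rho n.+1) n by [].
by rewrite /mkseq /= -[1]/(1 + 0) iotaDl -map_comp.
Qed.

(** A branch for an intersection interleaves branches for all the sets: the
    entry [j] of the branch for the set [i] sits at the position [pickle (i, j)]. *)
Definition slice (i j : nat) (s : seq nat) : seq nat :=
  mkseq (fun j' => nth 0 s (pickle (i, j'))) j.

Lemma slice_mkseq (rho : nat -> nat) i j n :
  (forall j', j' < j -> pickle (i, j') < n)%N ->
  slice i j (mkseq rho n) = mkseq (fun j' => rho (pickle (i, j'))) j.
Proof.
move=> H; apply: (@eq_from_nth _ 0); rewrite !size_mkseq// => k kj.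
by rewrite !nth_mkseq// H.
Qed.

Lemma suslin_bigcap (E : nat -> set (X * P)) :
  (forall i, suslin (E i)) -> suslin (\bigcap_i E i).
Proof.
move=> /choice[A] /choice[V HAV].
(* a node only imposes the conditions whose entries it already contains *)
pose ok (s : seq nat) := [set p : nat * nat | forall j', (j' < p.2)%N ->
  (pickle (p.1, j') < size s)%N].
exists (fun s => [set x | forall p, ok s p -> A p.1 (slice p.1 p.2 s) x]),
       (fun s => \bigcap_(p in ok s) V p.1 (slice p.1 p.2 s)); split.
- move=> s; apply: measurable_cforall => p.
  by apply: measurable_imp => _; case: (HAV p.1).
- by move=> s; apply: closed_bigI => p _; case: (HAV p.1).
move=> x y; split.
  move=> H.
  have /choice[r Hr] : forall i, exists rho : nat -> nat, forall n,
      A i (mkseq rho n) x /\ V i (mkseq rho n) y.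
    by move=> i; have [_ _ /(_ x y)[+ _]] := HAV i; apply; exact: H.
  exists (fun n => if unpickle n is Some (i, j) then r i j else 0) => n.
  suff K : forall p, ok (mkseq (fun n => if unpickle n is Some (i, j)
      then r i j else 0) n) p ->
    slice p.1 p.2 (mkseq (fun n => if unpickle n is Some (i, j)
      then r i j else 0) n) = mkseq (r p.1) p.2.
    by split => p /K ->; have [] := Hr p.1 p.2.
  move=> [i j] /= okp; rewrite slice_mkseq.
    by apply: eq_mkseq => j' /=; rewrite pickleK.
  by move=> j' /okp; rewrite size_mkseq.
move=> [rho Hrho] i _; have [_ _ /(_ x y)[_]] := HAV i; apply.
exists (fun j => rho (pickle (i, j))) => j.
pose n := (\max_(j' < j) (pickle (i, val j')).+1)%N.
have Hn j' : (j' < j)%N -> (pickle (i, j') < n)%N.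
  move=> j'j; rewrite /n.
  exact: (@leq_bigmax _ (fun j' : 'I_j => (pickle (i, val j')).+1) (Ordinal j'j)).
have [HA HV] := Hrho n.
have okij : ok (mkseq rho n) (i, j).
  by move=> j' /Hn; rewrite size_mkseq.
by have := HA _ okij; have := HV _ okij; rewrite /= slice_mkseq.
Qed.

End suslin_sets.

(** The closed sets are the points that stay away from the complement by a given
    distance; interiors of balls are used because balls themselves need not be
    open. *)
Lemma open_Fsigma (R : realType) (P : pseudoMetricType R) (U : set P) :
  open U -> exists C : nat -> set P, (forall n, closed (C n)) /\ U = \bigcup_n C n.
Proof.
move=> oU; exists (fun n => [set y | forall z, ~ U z ->
  ~ (ball z (n.+1%:R^-1 : R))° y]); split.
  move=> n; rewrite (_ : mkset _ = \bigcap_(z in ~` U)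
      ~` (ball z (n.+1%:R^-1 : R))°).
    by apply: closed_bigI => z _; apply: open_closedC; exact: open_interior.
  by apply/seteqP; split => y.
apply/seteqP; split => y.
  move=> Uy; have /nbhs_ballP[e /= e0 be] : nbhs y U by exact: open_nbhs_nbhs.
  have [n ne] := inv_natS_lt e0.
  exists n => // z nUz /interior_subset yz; apply: nUz; apply: be.
  by apply: ball_sym; apply: le_ball yz; exact: ltW.
move=> [n _ /= H]; apply: contrapT => nUy; apply: (H y nUy).
by apply: nbhsx_ballx; rewrite invr_gt0 ltr0n.
Qed.

(** The Suslin sets are not stable under complement, but those whose complement
    is also Suslin form a sigma-algebra, which contains the rectangles. *)
Lemma measurable_suslin (R : realType) d (X : measurableType d)
    d' (Y : measurableType d') (P : pseudoMetricType R) (f : Y -> P) (g : P -> Y) :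
  cancel g f ->
  (forall A : set Y, measurable A ->
     exists2 B : set P, <<s [set U : set P | open U] >> B & A = f @^-1` B) ->
  forall E : set (X * Y), measurable E -> suslin [set p | E (p.1, g p.2)].
Proof.
move=> gK fB.
have cU (F : nat -> set (X * P)) :
    (forall n, suslin (F n)) /\ (forall n, suslin (~` F n)) ->
    suslin (\bigcup_n F n) /\ suslin (~` \bigcup_n F n).
  by move=> [? ?]; split; [exact: suslin_bigcup|
     rewrite setC_bigcup; exact: suslin_bigcap].
have sB : <<s [set U : set P | open U] >> `<=`
    [set B | suslin ([set: X] `*` B) /\ suslin ([set: X] `*` ~` B)].
  apply: smallest_sub.
    split.
    - split; rewrite ?setC0; apply: suslin_rect => //.
      exact: closed0.
    - by move=> B /= [s1 s2]; rewrite setTD setCK.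
    - move=> B HB /=.
      have -> : [set: X] `*` ~` (\bigcup_i B i) =
          \bigcap_i ([set: X] `*` ~` B i).
        apply/seteqP; split => p /=.
          by move=> [_ nB] i _; split => // Bp; apply: nB; exists i.
        by move=> H; split => // -[i _ Bp]; have [_] := H i I; apply.
      rewrite setX_bigcupr.
      split; [apply: suslin_bigcup|apply: suslin_bigcap] => i; by case: (HB i).
  move=> U oU /=; split; last first.
    by apply: suslin_rect => //; exact: open_closedC.
  have [C [cC ->]] := open_Fsigma oU.
  rewrite setX_bigcupr; apply: suslin_bigcup => i.
  exact: suslin_rect.
suff : @measurable _ (X * Y)%type `<=`
    [set E : set (X * Y) | suslin [set p | E (p.1, g p.2)] /\
      suslin (~` [set p : X * P | E (p.1, g p.2)])].
  by move=> H E /H[].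
apply: smallest_sub.
  split.
  - change (suslin (@set0 (X * P)) /\ suslin (~` @set0 (X * P))).
    rewrite setC0 (_ : @set0 (X * P) = [set: X] `*` set0) ?setX0//.
    rewrite -setXTT; split; last exact: suslin_rect.
    by rewrite -(@setX0 _ P [set: X]); apply: suslin_rect => //; exact: closed0.
  - move=> E /= [s1 s2]; split.
      by rewrite (_ : mkset _ = ~` [set p | E (p.1, g p.2)]) //;
         apply/seteqP; split => p //= [].
    rewrite (_ : ~` _ = [set p | E (p.1, g p.2)]) //.
    apply/seteqP; split => p //= H; last by move=> [].
    by apply: contrapT => nE; exact: H.
  - move=> F HF.
    change (let G := \bigcup_i [set p : X * P | F i (p.1, g p.2)] in
      suslin G /\ suslin (~` G)).
    by apply: cU; split => n; case: (HF n).
move=> _ [[A mA <-]|[B mB <-]].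
  pose T := [set p : X * P | ([set: X * Y] `&` fst @^-1` A) (p.1, g p.2)].
  have TE : A `*` setT = T by apply/seteqP; split => p // [].
  have CE : (~` A) `*` setT = ~` T.
    apply/seteqP; split => p; first by move=> [nA _] [_ Ap].
    by move=> H; split => // Ap; apply: H.
  have s1 : suslin T by rewrite -TE; apply: suslin_rect => //; exact: closedT.
  have s2 : suslin (~` T).
    by rewrite -CE; apply: suslin_rect; [exact: measurableC|exact: closedT].
  by split.
have [B' sB' BB'] := fB _ mB.
have [s1 s2] := sB _ sB'.
pose T := [set p : X * P | ([set: X * Y] `&` snd @^-1` B) (p.1, g p.2)].
have TE : setT `*` B' = T.
  by rewrite /T BB'; apply/seteqP; split => p /=; rewrite gK // => -[].
have CE : setT `*` (~` B') = ~` T.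
  rewrite -TE; apply/seteqP; split => p; first by move=> [_ nA] [_ Ap].
  by move=> H; split => // Ap; apply: H.
have t1 : suslin T by rewrite -TE.
have t2 : suslin (~` T) by rewrite -CE.
by split.
Qed.

(** * Schemes with vanishing diameters *)

Lemma countable_enum (T : pointedType) (D : set T) :
  countable D -> exists q : nat -> T, D `<=` range q.
Proof.
move=> /countable_injP[f finj].
have /choice[q Hq] : forall n, exists y, (exists2 z, D z & f z = n) -> D y /\ f y = n.
  move=> n; have [[z Dz fz]|nz] := pselect (exists2 z, D z & f z = n).
    by exists z.
  by exists point => /nz.
exists q => y Dy; exists (f y) => //.
have [Dq fq] := Hq (f y) (ex_intro2 _ _ y Dy erefl).
by apply: finj => //; rewrite inE.
Qed.

Lemma ball_closure_split (R : realType) (P : pseudoMetricType R) (q y z : P)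
    (r : R) : (0 < r)%R ->
  closure (ball q r) y -> closure (ball q r) z -> ball y (r *+ 4)%R z.
Proof.
move=> r0.
suff K w : closure (ball q r) w -> ball q (r + r)%R w.
  move=> /K yq /K zq; rewrite (_ : (_ *+ 4 = (r + r) + (r + r))%R); last first.
    by rewrite !mulrS mulr0n; ring.
  exact: ball_triangle (ball_sym yq) zq.
move=> /(_ (ball w r) (nbhsx_ballx _ _ r0)) [v [qv wv]].
exact: ball_triangle qv (ball_sym wv).
Qed.

(** The root is exempt from the bound on diameters because the whole space may
    sit there. *)
Definition shrinking (R : realType) (P : pseudoMetricType R)
    (V : seq nat -> set P) : Prop :=
  [/\ forall s, closed (V s), forall s i, V (rcons s i) `<=` V s &
      forall s y z, V s y -> V s z -> (0 < size s)%N ->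
        ball y ((2 ^+ size s)^-1 : R)%R z].

Lemma shrinking_le (R : realType) (P : pseudoMetricType R)
    (V : seq nat -> set P) (rho : nat -> nat) m n : shrinking V ->
  (m <= n)%N -> V (mkseq rho n) `<=` V (mkseq rho m).
Proof.
move=> [_ dV _] /subnK <-; elim: (n - m)%N => [//|k IH].
by rewrite addSn mkseqS; apply: subset_trans IH; exact: dV.
Qed.

(** Points chosen in the sets along the branch form a Cauchy sequence. *)
Lemma shrinking_point (R : realType) (P : completePseudoMetricType R)
    (V : seq nat -> set P) (rho : nat -> nat) : shrinking V ->
  (forall n, V (mkseq rho n) !=set0) ->
  exists y, forall n, V (mkseq rho n) y.
Proof.
move=> sV /choice[u Hu]; have [cV dV bV] := sV.
have Hle m n : (m <= n)%N -> V (mkseq rho m) (u n).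
  by move=> mn; apply: (shrinking_le sV mn); exact: Hu.
have : cauchy (u @ \oo).
  apply: cauchy_exP => e e0.
  have [N _ HN] := near_infty_natSinv_expn_lt (PosNum e0).
  have He : ((2 ^+ N.+1)^-1 <= e)%R.
    by rewrite -div1r; exact: ltW (HN N.+1 (leqnSn _)).
  exists (u N.+1); exists N.+1 => // n /= Nn.
  apply: (le_ball He).
  have := bV (mkseq rho N.+1) (u N.+1) (u n); rewrite size_mkseq; apply => //.
  exact: Hle.
move=> /cauchy_cvg /cvg_ex[l ul]; exists l => m.
apply: (@closed_cvg _ _ _ _ u (V (mkseq rho m)) (cV _) _ _ ul).
by exists m => // n /= mn; exact: Hle.
Qed.

Definition unpair (n : nat) : nat * nat := odflt (0, 0) (unpickle n).

(** Each entry of a new branch codes an entry of an old one together with the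
    index of a dense point close to the value; the closed ball around that point
    cuts the set of the node down to a small diameter. *)
Lemma suslin_shrinking (R : realType) d (X : measurableType d)
   (P : completePseudoMetricType R) (D : set P) (E : set (X * P)) :
  countable D -> dense D -> suslin E ->
  exists (A : seq nat -> set X) (V : seq nat -> set P),
    [/\ forall s, measurable (A s), shrinking V &
        forall x y, E (x, y) <-> exists rho : nat -> nat, forall n,
            A (mkseq rho n) x /\ V (mkseq rho n) y].
Proof.
move=> /countable_enum[q Dq] dD [A [V [mA cV EAV]]].
(* two points in the closure of a ball of radius [r k] are at distance at most
   [4 * r k], which is the bound required at the nodes of length [k + 1] *)
pose r k : R := ((2 ^+ k)^-1 / 8%:R)%R.
have r0 k : (0 < r k)%R by rewrite divr_gt0// invr_gt0 exprn_gt0.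
pose fs s := map (fun n => (unpair n).1) s.
pose sn s := map (fun n => (unpair n).2) s.
pose V' s := [set y | forall k, (k <= size s)%N -> V (take k (fs s)) y /\
  ((k < size s)%N -> closure (ball (q (nth 0 (sn s) k)) (r k)) y)].
exists (fun s => A (fs s)), V'; split => [s||x y]; first exact: mA.
  split.
  - move=> s; rewrite (_ : V' s = \bigcap_(k in [set k | (k <= size s)%N])
      (V (take k (fs s)) `&` (if (k < size s)%N then
       closure (ball (q (nth 0 (sn s) k)) (r k)) else setT))).
      apply: closed_bigI => k _; apply: closedI; first exact: cV.
      by case: ifP => _; [exact: closed_closure|exact: closedT].
    apply/seteqP; split => y /= H k /H[h1 h2]; split => //.
      by case: ifP.
    by move=> kl; move: h2; rewrite kl.
  - move=> s i y H k ks.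
    have ks' : (k <= size (rcons s i))%N by rewrite size_rcons leqW.
    have [h1 h2] := H k ks'.
    split; first by move: h1; rewrite /fs map_rcons -cats1 takel_cat ?size_map.
    move=> {}ks; have {}ks' : (k < size (rcons s i))%N by rewrite size_rcons ltnS ltnW.
    have := h2 ks'.
    by rewrite /sn map_rcons nth_rcons size_map ks.
  - move=> s y z Hy Hz; case e : (size s) => [//|k] _.
    have kk : (k < size s)%N by rewrite e.
    have [_ /(_ kk) yk] := Hy k (ltnW kk).
    have [_ /(_ kk) zk] := Hz k (ltnW kk).
    have := ball_closure_split (r0 k) yk zk.
    apply: le_ball; rewrite /r exprS invfM -mulr_natr.
    have : (0 < (2 ^+ k : R)^-1)%R by rewrite invr_gt0 exprn_gt0.
    by set t : R := ((2 ^+ k)^-1)%R => t0; lra.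
rewrite EAV; split=> [[rho Hrho]|[rho Hrho]]; last first.
  exists (fun n => (unpair (rho n)).1) => n.
  have -> : mkseq (fun n => (unpair (rho n)).1) n = fs (mkseq rho n).
    by rewrite /fs /mkseq -map_comp.
  have [? /(_ n)] := Hrho n; rewrite size_mkseq leqnn take_oversize.
    by move=> /(_ isT)[].
  by rewrite size_map size_mkseq.
have /choice[t Ht] : forall k, exists n, ball (q n) (r k) y.
  move=> k; have : (ball y (r k))° !=set0 by exists y; exact: nbhsx_ballx.
  move=> /dD /(_ (@open_interior _ _)) [z [/interior_subset yz /Dq[n _ qz]]].
  by exists n; rewrite qz; apply: ball_sym.
exists (fun k => pickle (rho k, t k)) => n.
have fsE m : fs (mkseq (fun k => pickle (rho k, t k)) m) = mkseq rho m.
  rewrite /fs /mkseq -map_comp; apply: eq_map => k /=.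
  by rewrite /unpair pickleK.
have snE m : sn (mkseq (fun k => pickle (rho k, t k)) m) = mkseq t m.
  rewrite /sn /mkseq -map_comp; apply: eq_map => k /=.
  by rewrite /unpair pickleK.
rewrite /V' /= fsE snE; split; first by case: (Hrho n).
move=> k; rewrite size_mkseq => kn; split.
  suff -> : take k (mkseq rho n) = mkseq rho k by case: (Hrho k).
  by rewrite /mkseq -map_take take_iota (minn_idPl kn).
by move=> {}kn; rewrite nth_mkseq//; apply: subset_closure.
Qed.

(** * Real-valued probabilities *)

Local Open Scope ring_scope.

(** Taking the real value makes the masses elements of an ordered field, where
    the inequalities of the proof are linear arithmetic. *)
Definition pm d (X : measurableType d) (R : realType) (mu : set X -> \bar R)
  (A : set X) : R := fine (mu A).

Section real_probability.
Context d (X : measurableType d) (R : realType) (mu : probability X R).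
Local Notation m := (pm mu).
Implicit Types A B : set X.

Lemma pmE A : measurable A -> mu A = (m A)%:E.
Proof. by move=> mA; rewrite /pm fineK// fin_num_measure. Qed.

Lemma pm_ge0 A : 0 <= m A.
Proof. exact: fine_ge0. Qed.

Lemma pmT : m setT = 1.
Proof. by rewrite /pm probability_setT. Qed.

Lemma pm0 : m set0 = 0.
Proof. by rewrite /pm measure0. Qed.

Lemma pm_mono A B : measurable A -> measurable B -> A `<=` B -> m A <= m B.
Proof. by move=> mA mB AB; rewrite -lee_fin -!pmE//; apply: le_measure; rewrite ?inE. Qed.

Lemma pm_le1 A : measurable A -> m A <= 1.
Proof. by move=> mA; rewrite -pmT; apply: pm_mono. Qed.

Lemma pm_disjU A B : measurable A -> measurable B -> A `&` B `<=` set0 ->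
  m (A `|` B) = m A + m B.
Proof.
move=> mA mB AB0; apply: EFin_inj; rewrite EFinD -!pmE//; last exact: measurableU.
by rewrite measureU//; apply/seteqP; split.
Qed.

Lemma pm_split A B : measurable A -> measurable B ->
  m A = m (A `&` B) + m (A `\` B).
Proof.
move=> mA mB; rewrite -pm_disjU.
- by rewrite setUIDK.
- exact: measurableI.
- exact: measurableD.
- by move=> x [[_ Bx] [_]].
Qed.

Lemma pm_U A B : measurable A -> measurable B -> m (A `|` B) <= m A + m B.
Proof.
move=> mA mB; rewrite (pm_split (measurableU _ _ mA mB) mA).
apply: lerD; apply: pm_mono.
- by apply: measurableI => //; exact: measurableU.
- by [].
- by move=> x [].
- by apply: measurableD => //; exact: measurableU.
- by [].
- by move=> x [[]].
Qed.

Lemma pm_subU A B C : measurable A -> measurable B -> measurable C ->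
  A `<=` B `|` C -> m A <= m B + m C.
Proof.
move=> mA mB mC ABC; apply: le_trans (pm_U mB mC).
by apply: pm_mono => //; exact: measurableU.
Qed.

Lemma pm_C A : measurable A -> m (~` A) = 1 - m A.
Proof.
move=> mA; rewrite -pmT (pm_split measurableT mA) setTI setTD.
by rewrite addrAC subrr add0r.
Qed.

Lemma pm_null_sub A B : measurable A -> measurable B -> A `<=` B -> m B = 0 -> m A = 0.
Proof.
move=> mA mB AB B0; apply/eqP; rewrite eq_le pm_ge0 andbT -B0.
exact: pm_mono.
Qed.

Lemma pm_bigcup_null (F : nat -> set X) : (forall n, measurable (F n)) ->
  (forall n, m (F n) = 0) -> m (\bigcup_n F n) = 0.
Proof.
move=> mF F0; suff -> : pm mu (\bigcup_n F n) = fine 0%E by [].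
congr fine; apply/negligibleP; first exact: bigcupT_measurable.
apply: negligible_bigcup => n; apply/negligibleP => //.
by have := pmE (mF n); rewrite F0.
Qed.

Lemma pm_cexists_null (I : countType) (F : I -> set X) :
  (forall i, measurable (F i)) -> (forall i, m (F i) = 0) ->
  m [set x | exists i, F i x] = 0.
Proof.
move=> mF F0.
rewrite (_ : mkset _ = \bigcup_n (if unpickle n is Some i then F i else set0)).
  by apply: pm_bigcup_null => n; case: unpickle => //; exact: pm0.
apply/seteqP; split => x /=.
  by move=> [i Fix]; exists (pickle i) => //; rewrite pickleK.
by move=> [n _]; case: unpickle => // i Fix; exists i.
Qed.

Lemma pm_U_null A B : measurable A -> measurable B -> m A = 0 -> m B = 0 ->
  m (A `|` B) = 0.
Proof.
move=> mA mB A0 B0; apply/eqP; rewrite eq_le pm_ge0 andbT.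
by apply: le_trans (pm_U mA mB) _; rewrite A0 B0 addr0.
Qed.

Lemma pm_cvg_bigcup (F : nat -> set X) : (forall n, measurable (F n)) ->
  (forall n, F n `<=` F n.+1) -> m (F n) @[n --> \oo] --> m (\bigcup_n F n).
Proof.
move=> mF ndF.
have mU : measurable (\bigcup_n F n) by exact: bigcupT_measurable.
have ndF' : nondecreasing_seq F.
  by apply/nondecreasing_seqP => n; apply/subsetPset.
have := nondecreasing_cvg_mu (mu := mu) mF mU ndF'.
rewrite [X in _ --> X](pmE mU) => /fine_cvgP[_].
exact.
Qed.

Lemma pm_up (F : nat -> set X) (e : R) : (forall n, measurable (F n)) ->
  (forall n, F n `<=` F n.+1) -> 0 < e ->
  exists n, m (\bigcup_n F n) - e < m (F n).
Proof.
move=> mF ndF e0; have := pm_cvg_bigcup mF ndF.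
move=> /cvgrPdist_lt/(_ _ e0)[n _ /(_ n (leqnn n))] /= H; exists n.
by move: H; rewrite ltr_norml => /andP[_]; lra.
Qed.

Lemma pm_bigcup_sup (F : nat -> set X) (c : R) : (forall n, measurable (F n)) ->
  (forall n, F n `<=` F n.+1) -> (forall n, m (F n) <= c) -> m (\bigcup_n F n) <= c.
Proof.
move=> mF ndF Fc; rewrite leNgt; apply/negP => cm.
have [n Hn] := pm_up mF ndF (ltac:(lra) : 0 < m (\bigcup_n F n) - c).
by have := Fc n; lra.
Qed.

Lemma pm_down (F : nat -> set X) (e : R) : (forall n, measurable (F n)) ->
  (forall n, F n.+1 `<=` F n) -> 0 < e ->
  exists n, m (F n) < m (\bigcap_n F n) + e.
Proof.
move=> mF niF e0.
have mCF n : measurable (~` F n) by exact: measurableC.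
have mI : measurable (\bigcap_n F n) by exact: bigcapT_measurable.
have [n Hn] := pm_up mCF (fun n => subsetC (niF n)) e0.
exists n; move: Hn; rewrite -setC_bigcap !pm_C//; lra.
Qed.

Lemma ae_null (Q : set X) : {ae mu, forall x, Q x} ->
  exists N, [/\ measurable N, m N = 0 & forall x, ~ N x -> Q x].
Proof.
move=> [N [mN N0 sub]]; exists N; split => //; first by rewrite /pm N0.
by move=> x nN; apply: contrapT => nQ; apply: nN; exact: sub.
Qed.

Lemma null_ae (N Q : set X) : measurable N -> m N = 0 ->
  (forall x, ~ N x -> Q x) -> {ae mu, forall x, Q x}.
Proof.
move=> mN N0 H; exists N; split => //; first by rewrite pmE// N0.
by move=> x /= nQ; apply: contrapT => /H.
Qed.

(** Greedy choice: the step [n] comes within [1 / (n + 1)] of the supremum of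
    the masses available above the current set. *)
Lemma exhaustion (C : set (set X)) : (forall A, C A -> measurable A) ->
  C set0 ->
  (forall F : nat -> set X, (forall n, C (F n)) -> (forall n, F n `<=` F n.+1) ->
     C (\bigcup_n F n)) ->
  exists2 A, C A & forall B, C B -> A `<=` B -> m B = m A.
Proof.
move=> Cm C0 CU.
pose Up A := [set m B | B in [set B | C B /\ A `<=` B]].
have supUp A : C A -> has_sup (Up A).
  move=> CA; split; first by exists (m A); exists A => //; split.
  by exists 1 => _ [B [CB _] <-]; apply: pm_le1; exact: Cm.
have step (p : nat * {A | C A}) : exists B : {A | C A},
    sval p.2 `<=` sval B /\ sup (Up (sval p.2)) - p.1.+1%:R^-1 < m (sval B).
  have p0 : 0 < p.1.+1%:R^-1 :> R by rewrite invr_gt0 ltr0n.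
  have [_ [B [CB AB] <-] HB] := sup_adherent p0 (supUp _ (svalP p.2)).
  by exists (exist _ B CB).
have [nxt Hnxt] := choice step.
pose F := fix F n : {A | C A} := if n is k.+1 then nxt (k, F k)
                                else exist _ set0 C0.
have FS n : sval (F n) `<=` sval (F n.+1) by case: (Hnxt (n, F n)).
have CF n : C (sval (F n)) by exact: svalP.
have CA := CU _ CF FS.
exists (\bigcup_n sval (F n)) => // B CB AB; apply/eqP; rewrite eq_le.
have -> : m (\bigcup_n sval (F n)) <= m B by apply: pm_mono => //; exact: Cm.
rewrite andbT.
rewrite leNgt; apply/negP => lt.
pose e : R := m B - m (\bigcup_n sval (F n)).
have e0 : 0 < e by rewrite subr_gt0.
have [n ne] := inv_natS_lt e0.
have Hn : sup (Up (sval (F n))) - n.+1%:R^-1 < m (sval (F n.+1)).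
  by have [_] := Hnxt (n, F n).
have : m B <= sup (Up (sval (F n))).
  apply: sup_upper_bound; first exact: supUp.
  exists B => //; split => //; apply: subset_trans AB; move=> x Fx; by exists n.
have : m (sval (F n.+1)) <= m (\bigcup_n sval (F n)).
  apply: pm_mono; [exact: Cm|exact: Cm|by move=> x Fx; exists n.+1].
move=> h1 h2; move: Hn; rewrite ltrBlDr => /(le_lt_trans h2).
move=> /lt_le_trans /(_ (lerD h1 (ltW ne))).
by rewrite /e addrC subrK ltxx.
Qed.

End real_probability.

(** * Uniformization of sets with countable sections *)

Local Open Scope nat_scope.

(** The entry [n] may be read off any of the nodes that are long enough. *)
Lemma chain_branch (s : nat -> seq nat) :
  (forall k, prefix (s k) (s k.+1)) -> (forall k, k <= size (s k)) ->
  exists rho, forall k, mkseq rho (size (s k)) = s k.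
Proof.
move=> ps sz.
have pk k l : k <= l -> prefix (s k) (s l).
  move=> /subnK <-; elim: (l - k) => [|i IH]; first exact: prefix_refl.
  exact: prefix_trans IH (ps _).
exists (fun n => nth 0 (s n.+1) n) => k.
apply: (@eq_from_nth _ 0); rewrite size_mkseq// => n nk; rewrite nth_mkseq//.
have [|/ltnW] := leqP k n.+1 => /pk/prefixP[t ->]; rewrite nth_cat ?nk//.
by rewrite (sz n.+1).
Qed.

Lemma mkseq_prefix (rho : nat -> nat) m n : m <= n -> prefix (mkseq rho m) (mkseq rho n).
Proof.
by move=> mn; rewrite prefixE size_mkseq /mkseq -map_take take_iota (minn_idPl mn).
Qed.

Lemma prefix_mkseq (rho : nat -> nat) (s t : seq nat) :
  prefix s t -> mkseq rho (size t) = t -> mkseq rho (size s) = s.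
Proof.
move=> pst rt; have st : size s <= size t by exact: size_prefix.
have := @mkseq_prefix rho _ _ st.
rewrite rt prefixE size_mkseq => /eqP <-.
by move: pst; rewrite prefixE => /eqP.
Qed.

Section branches.
Context (R : realType) (P : completePseudoMetricType R) (V : seq nat -> set P).
Hypothesis hP : hausdorff_space P.
Hypothesis sV : shrinking V.

Lemma shrinking_prefix s t : prefix s t -> V t `<=` V s.
Proof.
have [_ dV _] := sV.
move=> /prefixP[u ->]; elim/last_ind: u => [|u i IH]; first by rewrite cats0.
by rewrite -rcons_cat; apply: subset_trans IH; exact: dV.
Qed.

(** The diameters vanish along both branches, and the space is Hausdorff. *)
Lemma shrinking_separate (rho rho' : nat -> nat) y y' n0 :
  (forall n, V (mkseq rho n) y) -> (forall n, V (mkseq rho' n) y') -> y <> y' ->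
  exists2 n, (n0 <= n)%N & V (mkseq rho n) `&` V (mkseq rho' n) = set0.
Proof.
move=> Vy Vy' yy'; have [cV dV bV] := sV.
apply: contrapT => nH; apply: yy'; apply: hP => A B Ay By.
move: Ay By => /nbhs_ballP[a /= a0 aA] /nbhs_ballP[b /= b0 bB].
have [n1 Hn1] := small_pow a0; have [n2 Hn2] := small_pow b0.
pose n := (n0 + n1 + n2).+1.
have [z [Vz V'z]] : V (mkseq rho n) `&` V (mkseq rho' n) !=set0.
  apply/set0P/eqP => H; apply: nH; exists n => //.
  by rewrite /n -addnA -addnS leq_addr.
have pow_le k : k <= n -> ((2 ^+ n)^-1 <= (2 ^+ k)^-1 :> R)%R.
  by move=> kn; rewrite lef_pV2 ?posrE ?exprn_gt0// ler_eXn2l ?ltr1n.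
exists z; split.
  apply: aA; have := bV _ _ _ (Vy n) Vz; rewrite size_mkseq => /(_ isT).
  apply: le_ball; apply: le_trans (ltW Hn1); apply: pow_le.
  by rewrite /n; lia.
apply: bB; have := bV _ _ _ (Vy' n) V'z; rewrite size_mkseq => /(_ isT).
apply: le_ball; apply: le_trans (ltW Hn2); apply: pow_le.
by rewrite /n; lia.
Qed.

(** The sets of the nodes have vanishing diameters, contain [y] and meet [W],
    so that [y] is a limit of points of [W]. *)
Lemma shrinking_closed y (W : set P) n0 : closed W ->
  (forall n, (n0 <= n)%N -> exists2 t, size t = n & V t y /\ V t `&` W !=set0) ->
  W y.
Proof.
move=> cW H; have [cV dV bV] := sV; apply: cW => A /nbhs_ballP[a /= a0 aA].
have [n1 Hn1] := small_pow a0; pose n := (n0 + n1).+1.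
have [|t st [Vy [w [Vw Ww]]]] := H n; first by rewrite /n; lia.
exists w; split => //; apply: aA; have := bV _ _ _ Vy Vw; rewrite st => /(_ isT).
apply: le_ball; apply: le_trans (ltW Hn1).
by rewrite lef_pV2 ?posrE ?exprn_gt0// ler_eXn2l ?ltr1n// /n; lia.
Qed.

End branches.

(** The fibre only carries a topology; closed sets generate its Borel sets. *)
Definition closed_measurable d (X : measurableType d) (P : topologicalType)
  (phi : X -> P) := forall W, closed W -> measurable (phi @^-1` W).

Section uniformization.
Context d (X : measurableType d) (R : realType) (mu : probability X R).
Context (P : completePseudoMetricType R).
Hypothesis hP : hausdorff_space P.
Context (A : seq nat -> set X) (V : seq nat -> set P).
Hypothesis mA : forall s, measurable (A s).
Hypothesis sV : shrinking V.
Local Notation m := (pm mu).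

Definition through (s : seq nat) (x : X) (y : P) := exists2 rho : nat -> nat,
  mkseq rho (size s) = s &
  forall n, A (mkseq rho n) x /\ V (mkseq rho n) y.

(** Countable unions of such sets [D] have the same property, hence every node
    has a largest one up to null sets; uniformization amounts to covering the
    whole space at the root. *)
Definition covered (s : seq nat) (D : set X) :=
  measurable D /\ exists (phi : nat -> X -> P) (N : set X),
    [/\ forall j, closed_measurable (phi j), measurable N, m N = 0%R &
      forall x, D x -> ~ N x -> forall y, through s x y -> exists j, y = phi j x].

Lemma closed_measurable_cst (p : P) : closed_measurable (fun=> p : P) (X := X).
Proof. by move=> W _; rewrite preimage_cst; case: ifP. Qed.

Lemma covered_empty s D : measurable D ->
  (forall x, D x -> forall y, ~ through s x y) -> covered s D.
Proof.
move=> mD H; split => //; exists (fun _ _ => point), set0; split => //.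
- by move=> j; exact: closed_measurable_cst.
- exact: pm0.
- by move=> x /H nt _ y /nt.
Qed.

Lemma covered_bigcup s (D : nat -> set X) : (forall n, covered s (D n)) ->
  covered s (\bigcup_n D n).
Proof.
move=> sD; split; first by apply: bigcupT_measurable => n; case: (sD n).
have /choice[phi /choice[N H]] : forall n, exists phi N, _ := fun n => (sD n).2.
exists (fun k => let p := odflt (0, 0) (unpickle k) in phi p.1 p.2),
  (\bigcup_n N n); split.
- by move=> j; case: (H (odflt (0, 0) (unpickle j)).1).
- by apply: bigcupT_measurable => n; case: (H n).
- by apply: pm_bigcup_null => n; case: (H n).
move=> x [n _ Dn] nN y yt /=; have [_ _ _ /(_ x Dn) K] := H n.
have [|j ->] := K _ y yt; first by move=> Nn; apply: nN; exists n.
by exists (pickle (n, j)); rewrite pickleK.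
Qed.

Lemma coveredU s D E : covered s D -> covered s E -> covered s (D `|` E).
Proof.
move=> sD sE; rewrite -bigcup2E; apply: covered_bigcup => -[//|[//|i]] /=.
by apply: covered_empty.
Qed.

Lemma max_covered s : exists2 D, covered s D & forall B, covered s B -> m (B `\` D) = 0%R.
Proof.
have [|||D sD maxD] := @exhaustion _ _ _ mu (covered s).
- by move=> B [].
- exact: covered_empty.
- by move=> F sF _; exact: covered_bigcup.
exists D => // B sB.
have [mD _] := sD; have [mB _] := sB.
have := maxD (D `|` B) (coveredU sD sB) (@subsetUl _ _ _).
rewrite -(setDUK (@subsetUl _ D B)) pm_disjU//; last first.
- by move=> x [Dx [_]].
- by apply: measurableD => //; exact: measurableU.
rewrite (_ : (D `|` B) `\` D = B `\` D); last first.
  by apply/seteqP; split => x /= [+ nD]; [case|]; split => //; right.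
by move=> /(congr1 (fun z => z - m D)%R); rewrite subrr addrAC subrr add0r.
Qed.

Lemma through_prefix s t x y : prefix s t -> through t x y -> through s x y.
Proof.
by move=> pst [rho rt H]; exists rho => //; exact: prefix_mkseq rt.
Qed.

Section perfect_kernel.
Context (D : seq nat -> set X) (phi : seq nat -> nat -> X -> P)
  (N : seq nat -> set X).
Hypothesis mD : forall s, measurable (D s).
Hypothesis Dmax : forall s B, covered s B -> m (B `\` D s) = 0%R.
Hypothesis mphi : forall s j, closed_measurable (phi s j).
Hypothesis mN : forall s, measurable (N s).
Hypothesis N0 : forall s, m (N s) = 0%R.
Hypothesis phiP : forall s x, D s x -> ~ N s x ->
  forall y, through s x y -> exists j, y = phi s j x.

Local Notation L s := (~` D s).

(** The nodes [s] with [x] in [L s] play the role of the perfect kernel of the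
    tree over [x]: they form a subtree without dead ends inside the scheme. *)
Definition pruned_at (x : X) : Prop := forall s, L s x ->
  [/\ forall k, A (take k s) x, forall k, L (take k s) x, V s !=set0 &
      exists i, L (rcons s i) x].

(** Where one of the conditions fails at [s], the values through [s] are already
    enumerated: no branch passes there, or a shorter node is covered, or all the
    successors are. The maximality of [D s] makes each such set of points null. *)
Lemma kernel_pruned : exists N1, [/\ measurable N1, m N1 = 0%R &
  forall x, ~ N1 x -> pruned_at x].
Proof.
pose Na (p : seq nat * nat) := (~` A (take p.2 p.1)) `\` D p.1.
pose Nb s := [set x | V s = set0 /\ L s x].
pose Nd (p : seq nat * nat) := D (take p.2 p.1) `\` D p.1.
pose Nc s := [set x | forall i, D (rcons s i) x] `\` D s.
have mNa p : measurable (Na p) by apply: measurableD => //; exact: measurableC.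
have mNd p : measurable (Nd p) by exact: measurableD.
have mNb s : measurable (Nb s) by apply: measurable_andP => _; exact: measurableC.
have mNc s : measurable (Nc s).
  by apply: measurableD => //; exact: measurable_cforall.
have Na0 p : m (Na p) = 0%R.
  apply: Dmax; apply: covered_empty; first exact: measurableC.
  move=> x nAx y [rho rs H]; apply: nAx.
  have [k|k] := leqP p.2 (size p.1); last first.
    by rewrite take_oversize 1?ltnW// -rs; case: (H (size p.1)).
  have := @mkseq_prefix rho _ _ k; rewrite rs prefixE size_mkseq => /eqP ->.
  by case: (H p.2).
have Nd0 p : m (Nd p) = 0%R.
  apply: Dmax; split => //; exists (phi (take p.2 p.1)), (N (take p.2 p.1)).
  split => // x Dx nNx y tr; apply: phiP Dx nNx _ _.
  by apply: through_prefix tr; exact: prefix_take.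
have Nb0 s : m (Nb s) = 0%R.
  rewrite (_ : Nb s = [set x | V s = set0] `\` D s) //.
  apply: Dmax; apply: covered_empty; first exact: measurable_constP.
  by move=> x V0 y [rho rs /(_ (size s))[_]]; rewrite rs V0.
have Nc0 s : m (Nc s) = 0%R.
  apply: Dmax; split; first exact: measurable_cforall.
  exists (fun k => let p := odflt (0, 0) (unpickle k) in phi (rcons s p.1) p.2),
    [set x | exists i, N (rcons s i) x]; split => //.
  - by apply: (@measurable_cexists _ _ nat (fun i => N (rcons s i))).
  - by apply: (@pm_cexists_null _ _ _ mu nat (fun i => N (rcons s i))).
  move=> x Dx nN y [rho rs H].
  have nNx : ~ N (rcons s (rho (size s))) x.
    by move=> Nx; apply: nN; exists (rho (size s)).
  have tr : through (rcons s (rho (size s))) x y.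
    by exists rho => //; rewrite size_rcons mkseqS rs.
  have [j ->] := phiP (Dx _) nNx tr.
  by exists (pickle (rho (size s), j)); rewrite pickleK.
exists (([set x | exists p, Na p x] `|` [set x | exists p, Nd p x]) `|`
  ([set x | exists s, Nb s x] `|` [set x | exists s, Nc s x])).
have mU (I J : countType) (F : I -> set X) (G : J -> set X) :
    (forall i, measurable (F i)) -> (forall i, measurable (G i)) ->
    measurable ([set x | exists i, F i x] `|` [set x | exists i, G i x]).
  by move=> ? ?; apply: measurableU; exact: measurable_cexists.
split.
- by apply: measurableU; exact: mU.
- by apply: pm_U_null; [exact: mU|exact: mU|..]; apply: pm_U_null;
    [exact: measurable_cexists|exact: measurable_cexists|
     exact: pm_cexists_null|exact: pm_cexists_null|
     exact: measurable_cexists|exact: measurable_cexists|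
     exact: pm_cexists_null|exact: pm_cexists_null].
move=> x nx s Lx; split.
- by move=> k; apply: contrapT => nA; apply: nx; left; left; exists (s, k).
- by move=> k Dx; apply: nx; left; right; exists (s, k).
- by apply/set0P/eqP => V0; apply: nx; right; left; exists s.
- apply: contrapT => nL; apply: nx; right; right; exists s; split => //= i.
  by apply: contrapT => nD; apply: nL; exists i.
Qed.

Lemma pruned_chain x (s : nat -> seq nat) : pruned_at x ->
  (forall k, prefix (s k) (s k.+1)) -> (forall k, k <= size (s k)) ->
  (forall k, L (s k) x) ->
  exists rho y, (forall k, mkseq rho (size (s k)) = s k) /\
     (forall n, A (mkseq rho n) x /\ V (mkseq rho n) y).
Proof.
move=> px ps sz Ls; have [rho Hrho] := chain_branch ps sz.
have Hn n : exists2 k, n <= size (s k) & mkseq rho n = take n (s k).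
  exists n => //; rewrite -(Hrho n).
  by rewrite /mkseq -map_take take_iota (minn_idPl (sz n)).
have [|y Hy] := @shrinking_point _ _ _ rho sV.
  move=> n; have [k nk ->] := Hn n; have [_ _ [z Vz] _] := px _ (Ls k).
  exists z; apply: (shrinking_prefix sV _ Vz).
  by rewrite prefixE size_takel.
exists rho, y; split => // n; split; last exact: Hy.
by have [k nk ->] := Hn n; have [+ _ _ _] := px _ (Ls k); exact.
Qed.

(** A node of a tree without dead ends extends forever, and completeness yields
    the value. *)
Lemma pruned_branch x s : pruned_at x -> L s x ->
  exists rho y, [/\ mkseq rho (size s) = s,
     forall n, A (mkseq rho n) x /\ V (mkseq rho n) y &
     forall n, size s <= n -> L (mkseq rho n) x].
Proof.
move=> px Lx.
have /choice[c Hc] : forall t, exists i, L t x -> L (rcons t i) x.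
  move=> t; have [Lt|nLt] := pselect (L t x); last by exists 0.
  by have [_ _ _ [i Li]] := px t Lt; exists i.
pose t := fix t k := if k is k'.+1 then rcons (t k') (c (t k')) else s.
have tS k : t k.+1 = rcons (t k) (c (t k)) by [].
have Lt k : L (t k) x by elim: k => [//|k IH]; rewrite tS; exact: Hc.
have st k : size (t k) = size s + k.
  by elim: k => [|k IH]; rewrite ?addn0// tS size_rcons IH addnS.
have [|||rho [y [Hrho Hy]]] := @pruned_chain x t px.
- by move=> k; rewrite tS prefix_rcons.
- by move=> k; rewrite st leq_addl.
- exact: Lt.
exists rho, y; split => //; first exact: (Hrho 0).
by move=> n /subnKC <-; rewrite -st Hrho.
Qed.

(** Where the kernel nodes below [s] do not split, they determine a single value.
    It depends measurably on the point, so together with the sections of the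
    covered nodes it covers [s] there, against the maximality of [D s]. *)
Lemma kernel_splits s : exists N2, [/\ measurable N2, m N2 = 0%R &
  forall x, ~ N2 x -> L s x -> exists t t',
    [/\ prefix s t, prefix s t', L t x, L t' x & V t `&` V t' = set0]].
Proof.
have [N1 [mN1 N10 N1p]] := kernel_pruned.
pose sp (p : seq nat * seq nat) :=
  [/\ prefix s p.1, prefix s p.2 & V p.1 `&` V p.2 = set0].
pose Z := [set x | forall p, sp p -> ~ (L p.1 x /\ L p.2 x)].
have mZ : measurable Z.
  apply: measurable_cforall => p; apply: measurable_imp => _.
  rewrite (_ : (fun x => _) = ~` (L p.1 `&` L p.2)) //.
  by apply/measurableC/measurableI; exact: measurableC.
have mLs : measurable (L s) by exact: measurableC.
pose val x y := exists2 rho : nat -> nat, mkseq rho (size s) = s &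
  forall n, size s <= n -> L (mkseq rho n) x /\ V (mkseq rho n) y.
have valU x y y' : Z x -> val x y -> val x y' -> y = y'.
  move=> Zx [rho rs H] [rho' rs' H']; apply: contrapT => yy'.
  have Hy n : V (mkseq rho n) y.
    have [sn|/ltnW ns] := leqP (size s) n; first by case: (H n sn).
    by have [_] := H _ (leqnn _); apply: (shrinking_le sV).
  have Hy' n : V (mkseq rho' n) y'.
    have [sn|/ltnW ns] := leqP (size s) n; first by case: (H' n sn).
    by have [_] := H' _ (leqnn _); apply: (shrinking_le sV).
  have [n sn V0] := shrinking_separate hP sV (size s) Hy Hy' yy'.
  apply: (Zx (mkseq rho n, mkseq rho' n)) => /=; last first.
    by split; [case: (H n sn)|case: (H' n sn)].
  split => //=.
    by rewrite -[X in prefix X]rs mkseq_prefix.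
  by rewrite -[X in prefix X]rs' mkseq_prefix.
have valE x : pruned_at x -> L s x -> exists y, val x y.
  move=> px Lx; have [rho [y [rs Hy HL]]] := pruned_branch px Lx.
  by exists y, rho => // n sn; split; [exact: HL|case: (Hy n)].
pose G := (Z `&` L s) `\` N1.
have mG : measurable G by apply: measurableD => //; exact: measurableI.
have /choice[psi Hpsi] : forall x, exists y, (G x -> val x y) /\ (~ G x -> y = point).
  move=> x; have [Gx|nGx] := pselect (G x); last by exists point.
  have [[_ Lx] nN1] := Gx; have [y Hy] := valE x (N1p _ nN1) Lx.
  by exists y.
have mpsi : closed_measurable psi.
  move=> W cW.
  (* the value lies in [W] when at each length some kernel node over [x] meets
     [W], which is a countable condition *)
  pose T n := [set t : seq nat | [/\ size t = n, prefix s t & V t `&` W !=set0]].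
  rewrite (_ : _ @^-1` _ = (G `&` [set x | forall n, size s <= n ->
      exists t, T n t /\ L t x]) `|` [set x | W point /\ (~` G) x]).
    apply: measurableU; last first.
      by apply: measurable_andP => _; exact: measurableC.
    apply: measurableI => //; apply: measurable_cforall => n.
    apply: measurable_imp => _; apply: measurable_cexists => t.
    by apply: measurable_andP => _; exact: measurableC.
  apply/seteqP; split => x /=.
    move=> Wx; have [Gx|nGx] := pselect (G x); last first.
      by right; rewrite (Hpsi x).2 in Wx.
    left; split => // n sn; have [rho rs H] := (Hpsi x).1 Gx.
    exists (mkseq rho n); have [Ln Vn] := H n sn; split => //; split.
    - by rewrite size_mkseq.
    - by rewrite -[X in prefix X]rs mkseq_prefix.
    - by exists (psi x).
  move=> [[Gx H]|[Wp nGx]]; last by rewrite (Hpsi x).2.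
  apply: (shrinking_closed (R := R) sV (n0 := size s) cW) => n sn.
  have [t [[st pst VW] Lt]] := H n sn.
  have [[Zx Lx] nN1] := Gx.
  exists t => //; split => //.
  have [rho [y [rt Hy HL]]] := pruned_branch (N1p _ nN1) Lt.
  have <- : y = psi x.
    apply: (valU x _ _ Zx) ((Hpsi x).1 Gx).
    exists rho; first exact: prefix_mkseq rt.
    move=> n' sn'; split; last by case: (Hy n').
    have [tn|/ltnW nt] := leqP (size t) n'; first exact: HL.
    have [_ /(_ n') + _ _] := N1p _ nN1 t Lt.
    by rewrite -rt /mkseq -map_take take_iota (minn_idPl nt).
  by have [_] := Hy (size t); rewrite rt.
have sZ : covered s G.
  split => //.
  exists (fun k => if k is k'.+1 then let p := odflt ([::], 0) (unpickle k') in
    phi p.1 p.2 else psi), (N1 `|` [set x | exists t, N t x]); split.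
  - by case=> // k; exact: mphi.
  - by apply: measurableU => //; exact: measurable_cexists.
  - by apply: pm_U_null => //; [exact: measurable_cexists|exact: pm_cexists_null].
  move=> x Gx nN y [rho rs H].
  have [[n Dn]|nD] := pselect (exists n, D (mkseq rho n) x).
    have nNx : ~ N (mkseq rho n) x by move=> Nx; apply: nN; right; exists (mkseq rho n).
    have [|j ->] := phiP Dn nNx (y := y); first by exists rho; rewrite ?size_mkseq.
    by exists (pickle (mkseq rho n, j)).+1; rewrite pickleK.
  exists 0; have [[Zx Lx] nN1] := Gx; apply: (valU x) ((Hpsi x).1 Gx) => //.
  exists rho => // n sn; split; last by case: (H n).
  by move=> Dn; apply: nD; exists n.
have := Dmax sZ; rewrite (_ : G `\` D s = G); last first.
  by apply/seteqP; split => x [] // [Zx Lx] nN.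
move=> G0; exists (N1 `|` G); split.
- exact: measurableU.
- exact: pm_U_null.
move=> x nx Lx; apply: contrapT => nH; apply: nx.
have [?|nN] := pselect (N1 x); [by left|right; split => //; split => //].
by move=> [t t'] [/= pt pt' V0] [Lt Lt']; apply: nH; exists t, t'.
Qed.

(** Given a list of values, Baire's argument builds a branch inside the kernel
    that leaves the value number [k] at the step [k]: of two disjoint
    descendants one misses it. *)
Lemma kernel_uncountable x :
  pruned_at x ->
  (forall s, L s x -> exists t t',
     [/\ prefix s t, prefix s t', L t x, L t' x & V t `&` V t' = set0]) ->
  L [::] x -> ~ countable [set y | through [::] x y].
Proof.
move=> px spx Lx /countable_enum[q Hq].
have Vne t : L t x -> V t !=set0 by move=> /px[].
have /choice[nxt Hnxt] : forall p : {s | L s x} * nat, exists s' : {s | L s x},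
   [/\ prefix (sval p.1) (sval s'), size (sval p.1) < size (sval s') &
       ~ V (sval s') (q p.2)].
  move=> [[s Ls] k] /=.
  have [t [t' [pt pt' Lt Lt' V0]]] := spx s Ls.
  have [t1 [pt1 Lt1 nV]] : exists t1, [/\ prefix s t1, L t1 x & ~ V t1 (q k)].
    have [Vt|nVt] := pselect (V t (q k)); last by exists t.
    exists t'; split => // Vt'.
    by have : (V t `&` V t') (q k) by []; rewrite V0.
  have [_ _ _ [i Li]] := px _ Lt1.
  exists (exist _ (rcons t1 i) Li) => /=; split.
  - exact: prefix_trans pt1 (prefix_rcons _ _).
  - by rewrite size_rcons ltnS size_prefix.
  - by move=> Vi; apply: nV; apply: (shrinking_prefix sV _ Vi); exact: prefix_rcons.
pose s := fix s k := if k is k'.+1 then nxt (s k', k') else exist _ [::] Lx.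
have sS k : s k.+1 = nxt (s k, k) by [].
have [||| rho [y [Hrho Hy]]] := @pruned_chain x (fun k => sval (s k)) px.
- by move=> k; rewrite sS; case: (Hnxt (s k, k)).
- elim=> [//|k IH]; rewrite sS; case: (Hnxt (s k, k)) => _ /= lt _.
  exact: leq_ltn_trans IH lt.
- by move=> k; exact: (svalP (s k)).
have [k _ qk] : range q y by apply: Hq; exists rho.
have [_ _] := Hnxt (s k, k); rewrite -sS /= qk; apply.
by have := (Hy (size (sval (s k.+1)))).2; rewrite (Hrho k.+1).
Qed.

End perfect_kernel.

Lemma countable_covered (N0 : set X) : measurable N0 -> m N0 = 0%R ->
  (forall x, ~ N0 x -> countable [set y | through [::] x y]) ->
  covered [::] setT.
Proof.
move=> mN0 N00 cN0.
have /choice[D HD] : forall s, exists D, covered s D /\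
    forall B, covered s B -> m (B `\` D) = 0%R.
  by move=> s; have [D sD maxD] := max_covered s; exists D.
have mD s : measurable (D s) by case: (HD s) => -[].
have /choice[phi /choice[N HN]] : forall s, exists phi N, _ := fun s => (HD s).1.2.
have mphi s j : closed_measurable (phi s j) by case: (HN s).
have mN s : measurable (N s) by case: (HN s).
have Nz s : m (N s) = 0%R by case: (HN s).
have phiP s x : D s x -> ~ N s x -> forall y, through s x y -> exists j, y = phi s j x.
  by case: (HN s) => _ _ _; exact.
have Dmax s B : covered s B -> m (B `\` D s) = 0%R by case: (HD s) => _; exact.
have [N1 [mN1 N10 N1P]] := kernel_pruned mD Dmax mphi mN Nz phiP.
have /choice[N2 HN2] := kernel_splits mD Dmax mphi mN Nz phiP.
pose M := (N0 `|` N1) `|` [set x | exists s, N2 s x].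
have mN2 : measurable [set x | exists s, N2 s x].
  by apply: measurable_cexists => s; case: (HN2 s).
have mM : measurable M by apply: measurableU => //; exact: measurableU.
have M0 : m M = 0%R.
  apply: pm_U_null => //; [exact: measurableU|exact: pm_U_null|].
  by apply: pm_cexists_null => s; case: (HN2 s).
split => //; exists (phi [::]), (M `|` N [::]); split => //.
- exact: measurableU.
- exact: pm_U_null.
move=> x _ nM; apply: phiP; last by move=> Nx; apply: nM; right.
apply: contrapT => Lx; apply: (@kernel_uncountable D x) Lx (cN0 x _) => [|s Ls|N0x].
- by apply: N1P => N1x; apply: nM; left; left; right.
- have [_ _] := HN2 s; apply => // N2x.
  by apply: nM; left; right; exists s.
- by apply: nM; left; left; left.
Qed.

End uniformization.

(** The Lusin-Novikov theorem, up to a null set of fibres. *)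
Lemma countable_sections (R : realType) d (X : measurableType d)
    d' (Y : measurableType d') (mu : probability X R) (E : set (X * Y)) :
  standard_borel R Y -> measurable E ->
  {ae mu, forall x, countable [set y | E (x, y)]} ->
  exists phi : nat -> X -> Y, (forall j, measurable_fun setT (phi j)) /\
    {ae mu, forall x, forall y, E (x, y) -> exists j, y = phi j x}.
Proof.
move=> [P [f [hP [D cD dD] bijf Bf]]] mE /ae_null[N0 [mN0 N00 cN0]].
have [g fK gK] := bijf.
have sE : suslin [set p | E (p.1, g p.2)].
  apply: (measurable_suslin gK) mE => A /Bf[B sB AB]; first by exists B.
have [A [V [mA sV EAV]]] := suslin_shrinking cD dD sE.
have [_ [phi [N [mphi mN NN0 phiP]]]] : covered mu A V [::] setT.
  apply: (countable_covered hP mA sV mN0 N00) => x /cN0 cx.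
  apply: (sub_countable _ cx); apply: card_le_trans (card_image_le f _).
  apply: subset_card_le => y [rho _ H]; exists (g y) => //=.
  by apply/(EAV x y); exists rho.
exists (fun j => g \o phi j); split.
  move=> j _ B mB; rewrite setTI.
  have [B' sB' BB'] := (Bf B).1 mB.
  rewrite (_ : _ @^-1` B = phi j @^-1` B'); last first.
    by rewrite BB'; apply/seteqP; split => x /=; rewrite gK.
  suff: <<s [set U : set P | open U] >> `<=` [set B | measurable (phi j @^-1` B)].
    exact.
  apply: smallest_sub.
    split => /=.
    - by rewrite preimage_set0.
    - by move=> C mC; rewrite setTD preimage_setC; exact: measurableC.
    - by move=> C mC; rewrite preimage_bigcup; exact: bigcupT_measurable.
  move=> U oU /=; rewrite -[U]setCK preimage_setC; apply: measurableC.
  by apply: (mphi j _ (open_closedC oU)).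
apply: (null_ae mN NN0) => x nN y Exy.
have tr : through A V [::] x (f y).
  have [rho Hrho] : exists rho, forall n, A (mkseq rho n) x /\ V (mkseq rho n) (f y).
    by apply/(EAV x (f y)); rewrite /= fK.
  by exists rho.
have [j fj] := phiP x I nN _ tr.
by exists j => /=; rewrite -fj fK.
Qed.

(** * Involutions generating a relation *)

Local Open Scope ring_scope.

(** The separating sequence is what makes the coincidence set of two measurable
    maps measurable, in [measurable_eq]. *)
Lemma standard_borel_separating (R : realType) d (X : measurableType d) :
  standard_borel R X -> exists U : nat -> set X, (forall i, measurable (U i)) /\
    forall x y, x <> y -> exists i, U i x /\ ~ U i y.
Proof.
move=> [P [f [hP [D cD dD] bijf Bf]]]; have [q Hq] := countable_enum cD.
pose W (p : nat * nat) := (ball (q p.1) ((2 ^+ p.2)^-1 + (2 ^+ p.2)^-1 : R))°.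
exists (fun n => f @^-1` W (unpair n)); split.
  move=> n; apply/Bf; exists (W (unpair n)) => //.
  by apply: sub_sigma_algebra; exact: open_interior.
move=> x y xy; have fxy : f x <> f y by move=> /(bij_inj bijf).
have [e e0 He] : exists2 e : R, 0 < e & ~ ball (f x) e (f y).
  apply: contrapT => H; apply: fxy; apply: hP => A B.
  move=> /nbhs_ballP[a /= a0 aA] By; exists (f y); split; last exact: nbhs_singleton.
  by apply: aA; apply: contrapT => nb; apply: H; exists a.
have e4 : 0 < e / 4%:R by rewrite divr_gt0.
have [k Hk] := small_pow e4.
pose r : R := (2 ^+ k)^-1; have r0 : 0 < r by rewrite invr_gt0 exprn_gt0.
have : (ball (f x) r)° !=set0 by exists (f x); exact: nbhsx_ballx.
move=> /dD /(_ (@open_interior _ _)) [z [/interior_subset xz /Hq[n _ qz]]].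
exists (pickle (n, k)); rewrite /unpair pickleK /= /W /= qz -/r; split.
  apply/nbhs_ballP; exists r => //= w xw.
  exact: ball_triangle (ball_sym xz) xw.
move=> /interior_subset zy; apply: He.
apply: (@le_ball _ _ _ (r + (r + r))); last exact: ball_triangle xz zy.
have : r < e / 4%:R by [].
by move: r {zy xz Hk} r0 => t; lra.
Qed.

Section measurable_maps.
Context d (X : measurableType d) d' (Y : measurableType d').

Definition choose_map (D : set X) (f g : X -> Y) (x : X) : Y :=
  if `[< D x >] then f x else g x.

Lemma choose_mapT (D : set X) (f g : X -> Y) x : D x -> choose_map D f g x = f x.
Proof. by move=> Dx; rewrite /choose_map asboolT. Qed.

Lemma choose_mapF (D : set X) (f g : X -> Y) x : ~ D x -> choose_map D f g x = g x.
Proof. by move=> Dx; rewrite /choose_map asboolF. Qed.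

Lemma measurable_preim (f : X -> Y) B : measurable_fun setT f -> measurable B ->
  measurable (f @^-1` B).
Proof. by move=> mf mB; rewrite -[_ @^-1` _]setTI; exact: mf. Qed.

Lemma measurable_choose_map D f g : measurable D -> measurable_fun setT f ->
  measurable_fun setT g -> measurable_fun setT (choose_map D f g).
Proof.
move=> mD mf mg _ B mB; rewrite setTI.
rewrite (_ : _ @^-1` _ = (D `&` f @^-1` B) `|` (~` D `&` g @^-1` B)).
  by apply: measurableU; apply: measurableI; try exact: measurable_preim;
    try exact: measurableC.
apply/seteqP; split => x /=.
  by have [Dx|nDx] := pselect (D x); rewrite ?(choose_mapT _ _ Dx) ?(choose_mapF _ _ nDx); [left|right].
by move=> [[Dx]|[Dx]]; rewrite ?(choose_mapT _ _ Dx) ?(choose_mapF _ _ Dx).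
Qed.

Lemma measurable_rel (E : set (Y * Y)) (f g : X -> Y) : measurable E ->
  measurable_fun setT f -> measurable_fun setT g ->
  measurable [set x | E (f x, g x)].
Proof.
move=> mE mf mg.
have := @measurable_fun_pair _ _ _ _ _ _ _ _ mf mg measurableT E mE.
by rewrite setTI.
Qed.

Lemma measurable_eq (U : nat -> set Y) (f g : X -> Y) :
  (forall i, measurable (U i)) ->
  (forall x y, x <> y -> exists i, U i x /\ ~ U i y) ->
  measurable_fun setT f -> measurable_fun setT g ->
  measurable [set x | f x = g x].
Proof.
move=> mU sU mf mg.
rewrite (_ : mkset _ = ~` [set x | exists i, (f @^-1` U i `&` ~` (g @^-1` U i)) x]).
  apply/measurableC/measurable_cexists => i; apply: measurableI.
    exact: measurable_preim.
  by apply/measurableC; exact: measurable_preim.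
apply/seteqP; split => x /= H; first by case=> i []; rewrite H.
by apply: contrapT => /sU[i Hi]; apply: H; exists i.
Qed.

End measurable_maps.

(** Integrals of nonnegative functions are suprema over simple functions, which
    gives monotonicity for functions that are not known to be measurable, as the
    cardinalities of sections. *)
Lemma le_integral_nonneg d (X : measurableType d) (R : realType)
    (mu : {measure set X -> \bar R}) (f g : X -> \bar R) :
  (forall x, (0 <= f x)%E) -> (forall x, (f x <= g x)%E) ->
  (\int[mu]_x f x <= \int[mu]_x g x)%E.
Proof.
move=> f0 fg; have g0 x : (0 <= g x)%E := le_trans (f0 x) (fg x).
rewrite !ge0_integralTE//; apply: ereal_sup_le => _ [h /= hf <-].
by exists h => //= x; exact: le_trans (hf x) (fg x).
Qed.

Lemma counting1 (T : choiceType) (R : realType) (x : T) :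
  counting [set x] = 1%E :> \bar R.
Proof. by rewrite /counting asboolT// fset_set1 finmap.cardfs1. Qed.

Lemma counting_ge1 (T : choiceType) (R : realType) (A : set T) : A !=set0 ->
  (1 <= counting A :> \bar R)%E.
Proof.
move=> [x Ax]; rewrite /counting; case: asboolP => [fA|_]; last by rewrite leey.
rewrite lee_fin ler1n finmap.cardfs_gt0; apply/finmap.fset0Pn; exists x.
by rewrite in_fset_set// inE.
Qed.

Lemma counting_ge0' (T : choiceType) (R : realType) (A : set T) :
  (0 <= counting A :> \bar R)%E.
Proof. by rewrite /counting; case: ifPn; rewrite ?lee_fin// lee_pinfty. Qed.

Section relations.
Context d (X : measurableType d) (R : realType) (mu : probability X R).
Local Notation m := (pm mu).
Hypothesis hX : standard_borel R X.
Context (cR : set (X * X)).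
Hypothesis hR : dmp_equivalence mu cR.

(** The conditions hold everywhere and not only almost everywhere: a map can be
    replaced by the identity where it fails to be an involution of the relation. *)
Definition rel_involution (cR : set (X * X)) (g : X -> X) :=
  [/\ measurable_fun setT g, forall x, g (g x) = x & forall x, cR (x, g x)].

Lemma rel_measurable : measurable cR. Proof. by case: hR => -[]. Qed.
Lemma rel_refl x : cR (x, x). Proof. by case: hR => -[]. Qed.
Lemma rel_sym x y : cR (x, y) -> cR (y, x).
Proof. by case: hR => -[_ _ + _ _ _]; apply. Qed.
Lemma rel_trans x y z : cR (x, y) -> cR (y, z) -> cR (x, z).
Proof. by case: hR => -[_ _ _ + _ _]; apply. Qed.

Lemma mu_rel_ge1 (E : set (X * X)) (A : set X) : measurable A ->
  (forall x, A x -> exists y, E (x, y) /\ cR (x, y)) ->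
  (mu A <= mu_rel mu cR E)%E.
Proof.
move=> mA HA; have -> : mu A = (\int[mu]_x (\1_A x)%:E)%E by rewrite integral_indic// setIT.
apply: le_integral_nonneg => x; first by rewrite lee_fin.
rewrite indicE; have [Ax|nAx] := pselect (A x); last first.
  by rewrite memNset//=; exact: counting_ge0'.
rewrite mem_set//=.
by apply: counting_ge1; have [y [Exy Rxy]] := HA _ Ax; exists y; split.
Qed.

Lemma mu_rel_graph (E : set (X * X)) (A : set X) (g : X -> X) : measurable A ->
  (forall x y, (E (x, y) /\ cR (x, y)) <-> (A x /\ y = g x)) ->
  mu_rel mu cR E = mu A.
Proof.
move=> mA HA; have -> : mu A = (\int[mu]_x (\1_A x)%:E)%E by rewrite integral_indic// setIT.
apply: eq_integral => x _; rewrite indicE.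
have [Ax|nAx] := pselect (A x).
  rewrite mem_set//=.
  rewrite (_ : rclass _ _ = [set g x]) ?counting1//.
  by apply/seteqP; split => y /=; [case/HA|move=> ->; apply/HA].
rewrite memNset//= (_ : rclass _ _ = set0).
  by rewrite /counting asboolT// fset_set0.
by apply/seteqP; split => y //= /HA[].
Qed.

Lemma mu_rel_null (E : set (X * X)) (N : set X) : measurable N -> m N = 0 ->
  (forall x y, E (x, y) -> N x) -> mu_rel mu cR E = 0%E.
Proof.
move=> mN N0 EN; apply/eqP; rewrite eq_le; apply/andP; split; last first.
  by apply: integral_ge0 => x _; exact: counting_ge0'.
apply: (@le_trans _ _ (\int[mu]_x (+oo * (\1_N x)%:E))%E).
  apply: le_integral_nonneg => x; first exact: counting_ge0'.
  rewrite indicE; have [Nx|nNx] := pselect (N x).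
    by rewrite mem_set//= mule1 leey.
  rewrite memNset//= mule0 (_ : rclass _ _ = set0); first by rewrite /counting asboolT// fset_set0.
  by apply/seteqP; split => y //= -[/EN].
rewrite ge0_integralZl//; last 1 first.
- by apply/measurable_EFinP; exact: measurable_indic.
have e := pmE mu mN; rewrite N0 in e.
by rewrite integral_indic// setIT; rewrite [X in (_ * X)%E]e mule0.
Qed.

(** Transposing the graph of [g] over [A] gives the graph of [g] over the
    preimage of [A], since [g] is its own inverse. *)
Lemma involution_pm g A : rel_involution cR g -> measurable A ->
  m (g @^-1` A) = m A.
Proof.
move=> [mg gg Rg] mA; congr fine.
have [U [mU sU]] := standard_borel_separating hX.
pose E := [set p : X * X | A p.1] `&` [set p | p.2 = g p.1].
have mE : measurable E.
  apply: measurableI.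
    by rewrite -[X in measurable X](_ : fst @^-1` A = _) //; exact: measurable_preim.
  by apply: (measurable_eq mU sU) => //; exact: measurableT_comp.
have ER : E `<=` cR by move=> [x y] [/= _ ->].
have [_ _ /(_ E mE ER)] := hR.
rewrite (mu_rel_graph (E := E) (A := A) (g := g))//; last first.
  by move=> x y; split; [case=> -[/= Ax ->] _|case=> Ax ->; split].
rewrite (mu_rel_graph (A := g @^-1` A) (g := g))//; first exact: measurable_preim.
move=> x y; split => [[[/= Ay xy] _]|[/= Ax ->]]; last first.
  by rewrite /E /= gg.
by rewrite xy gg.
Qed.

(** The transposed graph of [phi] lies over [N], and a null base carries no mass
    even below infinite fibres. *)
Lemma section_null (phi : X -> X) N : measurable_fun setT phi ->
  (forall x, cR (x, phi x)) -> measurable N -> m N = 0 -> m (phi @^-1` N) = 0.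
Proof.
move=> mphi Rphi mN N0.
have [U [mU sU]] := standard_borel_separating hX.
pose E := [set p : X * X | N p.1] `&` [set p | p.1 = phi p.2].
have mE : measurable E.
  apply: measurableI.
    by rewrite -[X in measurable X](_ : fst @^-1` N = _) //; exact: measurable_preim.
  by apply: (measurable_eq mU sU) => //; exact: measurableT_comp.
have ER : E `<=` cR by move=> [x y] [/= _ ->]; exact: rel_sym.
have [_ _ /(_ E mE ER)] := hR.
rewrite (mu_rel_null (E := E) (N := N))//; last by move=> x y [].
rewrite (mu_rel_graph (A := phi @^-1` N) (g := phi))//.
- by rewrite /pm => ->.
- exact: measurable_preim.
move=> x y; split => [[[/= Nphi yx] _]|[/= Nphi ->]]; last by split.
by rewrite -yx.
Qed.

(** The Feldman-Moore theorem, up to a null set. Sections [phi k] of the relation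
    are given by uniformization; where [phi l] inverts [phi k] and a separating
    set [U i] contains [x] but not [phi k x], exchanging [x] with [phi k x] is an
    involution, because the two places it exchanges are disjoint. *)
Lemma generating_involutions : exists g : nat -> X -> X,
  (forall j, rel_involution cR (g j)) /\
  {ae mu, forall x, forall y, cR (x, y) -> exists j, y = g j x}.
Proof.
have [_ dR _] := hR; have mR := rel_measurable.
have [U [mU sU]] := standard_borel_separating hX.
have [psi [mpsi /ae_null[N [mN N0 psiP]]]] := countable_sections hX mR dR.
pose phi k := choose_map [set x | cR (x, psi k x)] (psi k) id.
have mphi k : measurable_fun setT (phi k).
  by apply: measurable_choose_map => //; exact: measurable_rel.
have Rphi k x : cR (x, phi k x).
  rewrite /phi /choose_map; case: asboolP => //= _; exact: rel_refl.
have phiP x : ~ N x -> forall y, cR (x, y) -> exists k, y = phi k x.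
  move=> Nx y Rxy; have [k yk] := psiP x Nx y Rxy.
  by exists k; rewrite /phi choose_mapT//= -yk.
pose D (p : nat * nat * nat) := [set x | phi p.1.2 (phi p.1.1 x) = x] `&`
  (U p.2 `&` ~` (phi p.1.1 @^-1` U p.2)).
have mD p : measurable (D p).
  apply: measurableI.
    by apply: (measurable_eq mU sU) => //; exact: measurableT_comp.
  by apply: measurableI => //; apply: measurableC; exact: measurable_preim.
pose D' (p : nat * nat * nat) := phi p.1.2 @^-1` D p `&`
  [set x | phi p.1.1 (phi p.1.2 x) = x].
have mD' p : measurable (D' p).
  apply: measurableI; first exact: measurable_preim.
  by apply: (measurable_eq mU sU) => //; exact: measurableT_comp.
pose g p := choose_map (D p) (phi p.1.1) (choose_map (D' p) (phi p.1.2) id).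
have gI p : rel_involution cR (g p).
  split.
  - by apply: measurable_choose_map => //; exact: measurable_choose_map.
  - move=> x; rewrite /g; have [Dx|nDx] := pselect (D p x).
      have [px [Ux nU]] := Dx.
      rewrite (choose_mapT _ _ Dx) choose_mapF ?choose_mapT//; last by case=> _ [].
      by split => /=; rewrite px.
    rewrite (choose_mapF _ _ nDx); have [D'x|nD'x] := pselect (D' p x).
      by have [Dpx px] := D'x; rewrite (choose_mapT _ _ D'x) choose_mapT.
    by rewrite !(choose_mapF _ _ nD'x) /= (choose_mapF _ _ nDx) (choose_mapF _ _ nD'x).
  - move=> x; rewrite /g /choose_map; case: asboolP => // _; case: asboolP => // _.
    exact: rel_refl.
have idI : rel_involution cR id by split => //; exact: rel_refl.
exists (fun j => if j is j'.+1 then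
  (if unpickle j' is Some p then g p else id) else id); split.
  by case=> // j; case: unpickle.
apply: (@null_ae _ _ _ _ (N `|` [set x | exists k, (phi k @^-1` N) x])).
- apply: measurableU => //; apply: measurable_cexists => k.
  exact: (measurable_preim (mphi k) mN).
- apply: pm_U_null => //.
  + by apply: measurable_cexists => k; exact: (measurable_preim (mphi k) mN).
  + apply: pm_cexists_null => k; first exact: (measurable_preim (mphi k) mN).
    exact: (section_null (mphi k) (Rphi k) mN N0).
move=> x nN y Rxy.
have [<-|xy] := pselect (x = y).
  by exists 0%N.
have [k yk] : exists k, y = phi k x by apply: phiP => // Nx; apply: nN; left.
have [l xl] : exists l, x = phi l y.
  apply: phiP; last exact: rel_sym.
  by move=> Ny; apply: nN; right; exists k => /=; rewrite -yk.
have [i [Uix nUiy]] := sU _ _ xy.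
exists (pickle (k, l, i)).+1; rewrite pickleK /g choose_mapT //.
by split => /=; rewrite -yk.
Qed.

End relations.

(** * Boundaries and the action of the full group *)

Lemma cvg0P (R : realType) (u : nat -> R) : (forall n, 0 <= u n) ->
  (u n @[n --> \oo] --> (0 : R)) <->
  (forall e, 0 < e -> exists n0, forall n, (n0 <= n)%N -> u n < e).
Proof.
move=> u0; split.
  move=> /cvgrPdist_lt H e /H[n0 _ Hn0]; exists n0 => n /Hn0 /=.
  by rewrite sub0r normrN ger0_norm.
move=> H; apply/cvgrPdist_lt => e /H[n0 Hn0]; exists n0 => // n /Hn0 /=.
by rewrite sub0r normrN ger0_norm.
Qed.

Lemma eventually_all_lt (Q : nat -> nat -> Prop) :
  (forall j, exists n0, forall n, (n0 <= n)%N -> Q j n) ->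
  forall J, exists n0, forall n, (n0 <= n)%N -> forall j, (j < J)%N -> Q j n.
Proof.
move=> /choice[f Hf]; elim=> [|J [n0 IH]]; first by exists 0%N.
exists (maxn n0 (f J)) => n; rewrite geq_max => /andP[n0n fn] j.
rewrite ltnS leq_eqVlt => /predU1P[->|jJ]; [exact: Hf|exact: IH].
Qed.

Section involutions.
Context d (X : measurableType d) (R : realType) (mu : probability X R).
Local Notation m := (pm mu).
Implicit Types (A B : set X) (g : X -> X).

Lemma mu_cvg0P (F : nat -> set X) : (forall n, measurable (F n)) ->
  (fun n => mu (F n)) @ \oo --> 0%E <->
  (forall e, 0 < e -> exists n0, forall n, (n0 <= n)%N -> m (F n) < e).
Proof.
move=> mF; rewrite (_ : (fun n => mu (F n)) = (fun n => (m (F n))%:E)); last first.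
  by apply/funext => n; rewrite pmE.
rewrite -(cvg0P (fun n => pm_ge0 mu (F n))); split => [/fine_cvgP[_]//|H].
by apply: cvg_EFin => //; exact: nearW.
Qed.

Lemma pm_exists_lt (F : nat -> set X) J c : (forall j, measurable (F j)) ->
  (forall j, (j < J)%N -> m (F j) <= c) ->
  m [set x | exists j, (j < J)%N /\ F j x] <= J%:R * c.
Proof.
move=> mF; elim: J => [|J IH] Fc.
  rewrite mul0r (_ : mkset _ = set0) ?pm0//.
  by apply/seteqP; split => x // [j []].
rewrite -natr1 mulrDl mul1r; apply: le_trans (lerD (IH _) (Fc J (ltnSn _))).
  apply: pm_subU => //.
  - by apply: measurable_cexists => j; apply: measurable_andP => _.
  - by apply: measurable_cexists => j; apply: measurable_andP => _.
  - move=> x [j []]; rewrite ltnS leq_eqVlt => /predU1P[->|jJ]; first by right.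
    by left; exists j.
by move=> j jJ; apply: Fc; exact: ltnW.
Qed.

Definition escape g A := [set x | A x /\ ~ A (g x)].
(** For a measure preserving [g] this is half the mass of the symmetric
    difference of [A] and its preimage. *)
Definition escape_mass g A := m (escape g A).
Local Notation bd := escape_mass.

Lemma measurable_escape g A : measurable_fun setT g -> measurable A ->
  measurable (escape g A).
Proof.
move=> mg mA; rewrite (_ : escape g A = A `&` ~` (g @^-1` A)) //.
by apply: measurableI => //; apply: measurableC; exact: measurable_preim.
Qed.

Lemma bd_ge0 g A : 0 <= bd g A. Proof. exact: pm_ge0. Qed.

Lemma bdU g A B : measurable_fun setT g -> measurable A -> measurable B ->
  bd g (A `|` B) <= bd g A + bd g B.
Proof.
move=> mg mA mB; apply: pm_subU; try exact: measurable_escape.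
  by apply: measurable_escape => //; exact: measurableU.
move=> x [[Ax|Bx] nAB]; [left|right]; split => // ?; apply: nAB; [left|right]; done.
Qed.

Section relation.
Hypothesis hX : standard_borel R X.
Context (cR : set (X * X)).
Hypothesis hR : dmp_equivalence mu cR.

Lemma bdC g A : rel_involution cR g -> measurable A -> bd g (~` A) = bd g A.
Proof.
move=> gI mA; have [mg gg _] := gI.
rewrite /escape_mass -(involution_pm hX hR gI (measurable_escape mg mA)).
congr m; apply/seteqP; split => x; rewrite /escape /= gg => -[].
  by move=> nA /contrapT.
by move=> Agx nAx; split => // /(_ Agx).
Qed.

(** Countably many involutions combine into one as soon as their pieces are
    disjoint and each of them preserves its piece. *)
Lemma patch_involutions (g : nat -> X -> X) (c : nat -> set X) :
  (forall j, rel_involution cR (g j)) -> (forall j, measurable (c j)) ->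
  (forall i j x, c i x -> c j x -> i = j) ->
  (forall j x, c j x -> c j (g j x)) ->
  exists2 h, rel_involution cR h & forall j x, c j x -> h x = g j x.
Proof.
move=> gI mc dc ic.
have /choice[h Hh] : forall x, exists y, (forall j, c j x -> y = g j x) /\
    ((forall j, ~ c j x) -> y = x).
  move=> x; have [[j cj]|nc] := pselect (exists j, c j x).
    exists (g j x); split => [i ci|/(_ j)//]; by rewrite (dc _ _ _ ci cj).
  by exists x; split => // j cj; exfalso; apply: nc; exists j.
exists h; last by move=> j x; exact: (Hh x).1.
split.
- move=> _ B mB; rewrite setTI.
  rewrite (_ : h @^-1` B = [set x | exists j, (c j `&` g j @^-1` B) x] `|`
     ([set x | forall j, (~` c j) x] `&` B)).
    apply: measurableU.
      apply: measurable_cexists => j; apply: measurableI => //.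
      by apply: measurable_preim => //; case: (gI j).
    by apply: measurableI => //; apply: measurable_cforall => j; exact: measurableC.
  apply/seteqP; split => x /=.
    have [[j cj]|nc] := pselect (exists j, c j x).
      by rewrite ((Hh x).1 _ cj) => Bx; left; exists j.
    rewrite (Hh x).2 => [Bx|j cj]; last by apply: nc; exists j.
    by right; split => // j cj; apply: nc; exists j.
  by case=> [[j [cj Bj]]|[nc Bx]]; [rewrite ((Hh x).1 _ cj)|rewrite (Hh x).2].
- move=> x; have [[j cj]|nc] := pselect (exists j, c j x).
    by rewrite ((Hh x).1 _ cj) ((Hh _).1 _ (ic _ _ cj)); case: (gI j).
  have {}nc j : ~ c j x by move=> cj; apply: nc; exists j.
  by rewrite !(Hh x).2.
- move=> x; have [[j cj]|nc] := pselect (exists j, c j x).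
    by rewrite ((Hh x).1 _ cj); case: (gI j).
  rewrite (Hh x).2; first exact: (rel_refl hR).
  by move=> j cj; apply: nc; exists j.
Qed.

Context (g : nat -> X -> X).
Hypothesis gI : forall j, rel_involution cR (g j).
Hypothesis gP : {ae mu, forall x, forall y, cR (x, y) -> exists j, y = g j x}.

(** The graph argument of [involution_pm] works where [h] respects the relation;
    the remaining null set has a null image because the rest already has an image
    of full measure. *)
Lemma full_group_pm h B : full_group setT mu cR h -> measurable B ->
  m (h @` B) = m B.
Proof.
move=> [[_ injh surjh] mh imh aeh] mB.
have {}imh C : measurable C -> measurable (h @` C) by move=> mC; exact: imh.
have {}injh x y : h x = h y -> x = y by move=> xy; apply: injh => //; rewrite inE.
pose G := [set x | cR (x, h x)].
have mG : measurable G.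
  by apply: measurable_rel => //; exact: (rel_measurable hR).
have G1 : m (~` G) = 0.
  have [N [mN N0 NG]] := ae_null aeh.
  apply: (pm_null_sub _ mN) N0 => //; first exact: measurableC.
  by move=> x nG; apply: contrapT => /NG /(_ I).
have [U [mU sU]] := standard_borel_separating hX.
have /choice[k hk] : forall y, exists x, h x = y.
  by move=> y; have [x _ <-] := surjh y I; exists x.
have pG C : measurable C -> C `<=` G -> m (h @` C) = m C.
  move=> mC CG; congr fine.
  pose E := [set p : X * X | C p.1] `&` [set p | p.2 = h p.1].
  have mE : measurable E.
    apply: measurableI.
      by rewrite -[X in measurable X](_ : fst @^-1` C = _) //; exact: measurable_preim.
    by apply: (measurable_eq mU sU) => //; exact: measurableT_comp.
  have ER : E `<=` cR by move=> [x y] [/= /CG ? ->].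
  have [_ _ /(_ E mE ER)] := hR.
  rewrite (mu_rel_graph mu (E := E) (A := C) (g := h))//; last first.
    move=> x y; split; first by case=> -[/= Cx ->] _.
    by case=> /= Cx ->; split => //; exact: CG.
  rewrite (mu_rel_graph mu (A := h @` C) (g := k))//; first exact: imh.
  move=> x y; split.
    by move=> [[/= Cy xy] _]; rewrite xy; split; [exists y|apply: injh; rewrite hk].
  move=> [[z Cz zx] /= yk]; rewrite /E /=.
  have yz : y = z by apply: injh; rewrite yk hk zx.
  rewrite yz; split; first by split.
  by rewrite -zx; apply: (rel_sym hR); exact: CG.
have mCG C : measurable C -> measurable (C `&` G) /\ measurable (C `\` G).
  by move=> mC; split; [exact: measurableI|exact: measurableD].
have hG0 : m (h @` (~` G)) = 0.
  have mCi : measurable (~` G) by exact: measurableC.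
  apply: (@pm_null_sub _ _ _ _ _ (~` (h @` G))).
  - exact: imh.
  - by apply: measurableC; exact: imh.
  - by move=> _ [x nGx <-] [y Gy /injh yx]; apply: nGx; rewrite -yx.
  - rewrite pm_C; last exact: imh.
    by rewrite pG// -pm_C.
rewrite (pm_split mu (imh _ mB) (imh _ mG)) [RHS](pm_split mu mB mG); congr (_ + _).
  rewrite -(pG (B `&` G) (measurableI _ _ mB mG) (@subIsetr _ _ _)).
  congr m; apply/seteqP; split => y.
    by move=> [[x Bx <-] [z Gz /injh zx]]; exists x => //; split => //; rewrite -zx.
  by move=> [x [Bx Gx] <-]; split; exists x.
transitivity (0 : R); [|symmetry].
  apply: pm_null_sub _ _ _ hG0.
  - by apply: measurableD; exact: imh.
  - by apply: imh; exact: measurableC.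
  - by move=> y [[x Bx <-] nG]; exists x => // Gx; apply: nG; exists x.
apply: pm_null_sub _ _ _ G1; [exact: measurableD|exact: measurableC|by move=> x []].
Qed.

(** Off a set of small mass, [h] agrees at each point with one of finitely many
    of the generating involutions. *)
Lemma full_group_escape h (E : nat -> set X) : full_group setT mu cR h ->
  (forall n, measurable (E n)) ->
  (forall j e, 0 < e -> exists n0, forall n, (n0 <= n)%N -> bd (g j) (E n) < e) ->
  (fun n => mu ((h @` E n) `+` E n)) @ \oo --> 0%E.
Proof.
move=> hh mE Hg; have [[_ injh surjh] mh imh aeh] := hh.
have {}imh C : measurable C -> measurable (h @` C) by move=> mC; exact: imh.
have mg j : measurable_fun setT (g j) by case: (gI j).
apply/mu_cvg0P => [n|e e0].
  by apply: measurableU; apply: measurableD => //; exact: imh.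
have [U [mU sU]] := standard_borel_separating hX.
pose T J := [set x | forall j, (j < J)%N -> h x <> g j x].
have mT J : measurable (T J).
  apply: measurable_cforall => j; apply: measurable_imp => _.
  rewrite (_ : (fun x => _) = ~` [set x | h x = g j x]) //.
  by apply: measurableC; exact: (measurable_eq mU sU).
have [J HJ] : exists J, m (T J) < e / 4%:R.
  have e4 : 0 < e / 4%:R by rewrite divr_gt0.
  have [J HJ] := @pm_down _ _ _ mu T _ mT
    (fun n x H j jn => H j (ltnW jn)) e4.
  exists J; move: HJ; suff -> : m (\bigcap_n T n) = 0 by rewrite add0r.
  have [N [mN N0 NP]] := ae_null gP; have [N' [mN' N'0 N'P]] := ae_null aeh.
  apply: (pm_null_sub _ _ _ (pm_U_null mN mN' N0 N'0)).
  - exact: bigcapT_measurable.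
  - exact: measurableU.
  - move=> x Tx; apply: contrapT => nN.
    have [j hj] : exists j, h x = g j x.
      apply: NP; first by move=> Nx; apply: nN; left.
      by apply: N'P => // Nx; apply: nN; right.
    by have := Tx j.+1 I j (ltnSn _).
pose e' := e / (4%:R * J.+1%:R); have e'0 : 0 < e' by rewrite divr_gt0// mulr_gt0.
have [n0 Hn0] := eventually_all_lt (fun j => Hg j e' e'0) J.
exists n0 => n /Hn0 Hn.
have mesc := measurable_escape mh (mE n).
have bdh : bd h (E n) < e / 2%:R.
  pose C := [set x | exists j, (j < J)%N /\ escape (g j) (E n) x].
  have mC : measurable C.
    apply: measurable_cexists => j; apply: measurable_andP => _.
    exact: measurable_escape.
  have mCle : m C <= J%:R * e'.
    apply: pm_exists_lt => [j|j jJ]; first exact: measurable_escape.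
    exact/ltW/Hn.
  have : bd h (E n) <= m (T J) + m C.
    apply: pm_subU => // x [Ex nEh].
    have [[j [jJ hj]]|nj] := pselect (exists j, (j < J)%N /\ h x = g j x).
      by right; exists j; split => //; split => //; rewrite -hj.
    by left => j jJ hj; apply: nj; exists j.
  have : J%:R * e' <= e / 4%:R.
    rewrite /e' invfM mulrCA -[leRHS]mulr1 -mulrA ler_wpM2l ?(ltW e0)//.
    rewrite mulrCA ler_wpM2l// ?invr_ge0// ler_pdivrMr// mul1r ler_nat.
    exact: leqnSn.
  move: mCle HJ; move: (J%:R * e') => t; lra.
have hE : (h @` E n) `\` E n = h @` escape h (E n).
  apply/seteqP; split => y; first by move=> [[x Ex <-] nE]; exists x.
  by move=> [x [Ex nE] <-]; split => //; exists x.
have m1 : m ((h @` E n) `\` E n) = bd h (E n).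
  by rewrite hE (full_group_pm hh mesc).
have m2 : m (E n `\` (h @` E n)) = bd h (E n).
  have := pm_split mu (mE n) (imh _ (mE n)).
  have := pm_split mu (imh _ (mE n)) (mE n).
  rewrite (full_group_pm hh (mE n)) m1 (setIC (h @` E n)).
  by move=> -> /addrI.
apply: (@le_lt_trans _ _ (bd h (E n) + bd h (E n))); last by lra.
rewrite -[X in X + _]m1 -[X in _ + X]m2; apply: pm_U.
  by apply: measurableD => //; exact: imh.
by apply: measurableD => //; exact: imh.
Qed.

End relation.
End involutions.

(** * Expansion from strong ergodicity *)

Lemma cvg_sum_seq (R : realType) (I : Type) (r : seq I) (u : I -> nat -> R)
    (l : I -> R) : (forall i, u i k @[k --> \oo] --> l i) ->
  (\sum_(i <- r) u i k) @[k --> \oo] --> \sum_(i <- r) l i.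
Proof.
move=> ul; elim: r => [|i r IH].
  rewrite big_nil (_ : (fun k => _) = (fun=> 0 : R)); first exact: cvg_cst.
  by apply/funext => k; rewrite big_nil.
rewrite big_cons (_ : (fun k => _) = (fun k => u i k + \sum_(j <- r) u j k)).
  exact: cvgD.
by apply/funext => k; rewrite big_cons.
Qed.

Lemma cvg_le_bound (R : realType) (u : nat -> R) (l c : R) :
  u k @[k --> \oo] --> l -> (forall k, u k <= c) -> l <= c.
Proof.
move=> /cvgrPdist_lt ul uc; rewrite leNgt; apply/negP => cl.
have [|n _ /(_ n (leqnn n))] := ul (l - c); first by rewrite subr_gt0.
rewrite /= ltr_norml => /andP[_]; have := uc n; lra.
Qed.

Section expansion.
Context d (X : measurableType d) (R : realType) (mu : probability X R).
Local Notation m := (pm mu).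
Local Notation bd := (escape_mass mu).
Hypothesis hX : standard_borel R X.
Context (cR : set (X * X)).
Hypothesis hR : dmp_equivalence mu cR.
Context (g : nat -> X -> X).
Hypothesis gI : forall j, rel_involution cR (g j).
Hypothesis gP : {ae mu, forall x, forall y, cR (x, y) -> exists j, y = g j x}.

Let mg j : measurable_fun setT (g j). Proof. by case: (gI j). Qed.
Let gg j x : g j (g j x) = x. Proof. by case: (gI j). Qed.
Let gR j x : cR (x, g j x). Proof. by case: (gI j). Qed.

(** Greedy matching: [g 0], [g 1], and so on successively exchange what they can
    of the unmatched parts of [A] and of its complement. The parts left unmatched
    in the end are not related to each other, so by ergodicity one of them is null;
    it is the one in [A] because [A] is the smaller side. *)
Lemma disjoint_involution A :
  (forall B, measurable B -> (forall j, bd (g j) B = 0) -> m B * (1 - m B) = 0) ->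
  measurable A -> m A < 2%:R^-1 ->
  exists2 h, rel_involution cR h & m (A `&` h @^-1` A) = 0.
Proof.
move=> erg mA A2.
pose AB := fix AB n : set X * set X := if n is k.+1 then
  let a := (AB k).1 `&` g k @^-1` (AB k).2 in
  ((AB k).1 `\` a, (AB k).2 `\` g k @^-1` a) else (A, ~` A).
pose a k := (AB k).1 `&` g k @^-1` (AB k).2.
pose b k := g k @^-1` a k.
have ABS k : AB k.+1 = ((AB k).1 `\` a k, (AB k).2 `\` b k) by [].
have mAB k : measurable (AB k).1 /\ measurable (AB k).2.
  elim: k => [|k [m1 m2]]; first by split => //=; exact: measurableC.
  have ma : measurable (a k) by apply: measurableI => //; exact: measurable_preim.
  by rewrite ABS; split; apply: measurableD => //; exact: measurable_preim.
have ma k : measurable (a k).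
  by apply: measurableI; [case: (mAB k)|apply: measurable_preim => //; case: (mAB k)].
have mb k : measurable (b k) by exact: measurable_preim.
have AB_le i k : (i <= k)%N -> (AB k).1 `<=` (AB i).1 /\ (AB k).2 `<=` (AB i).2.
  move=> /subnK <-; elim: (k - i)%N => [|n [IH1 IH2]]; first by rewrite add0n; split.
  by rewrite addSn ABS /=; split; [apply: subset_trans IH1|apply: subset_trans IH2];
    move=> x [].
have bB k : b k `<=` (AB k).2 by move=> x [_ /=]; rewrite gg.
have aA k : a k `<=` A by move=> x [/(AB_le 0%N k (leq0n k)).1].
have bA k : b k `<=` ~` A by move=> x /bB /(AB_le 0%N k (leq0n k)).2.
have adisj i k x : a i x -> a k x -> i = k.
  wlog ik : i k / (i < k)%N.
    move=> H ai ak; have [ik|ki|//] := ltngtP i k; first exact: H.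
    by apply/esym; exact: H.
  by move=> ai [/(AB_le i.+1 k ik).1]; rewrite ABS => -[].
have bdisj i k x : b i x -> b k x -> i = k.
  wlog ik : i k / (i < k)%N.
    move=> H ai ak; have [ik|ki|//] := ltngtP i k; first exact: H.
    by apply/esym; exact: H.
  by move=> bi /bB /(AB_le i.+1 k ik).2; rewrite ABS => -[].
have [||h hI hP] := patch_involutions (g := g) (c := fun k => a k `|` b k) hR gI
    (fun k => measurableU _ _ (ma k) (mb k)).
- move=> i j x [ai|bi] [aj|bj]; [exact: adisj ai aj| | |exact: bdisj bi bj].
    by have := bA _ _ bj; move/(_ (aA _ _ ai)).
  by have := bA _ _ bi; move/(_ (aA _ _ aj)).
- by move=> j x [ax|bx]; [right; rewrite /b /= gg|left].
exists h => //.
pose Ainf := [set x | forall k, (AB k).1 x].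
pose Binf := [set x | forall k, (AB k).2 x].
have mAinf : measurable Ainf by apply: measurable_cforall => k; case: (mAB k).
have mBinf : measurable Binf by apply: measurable_cforall => k; case: (mAB k).
pose aU := [set x | exists k, a k x].
pose bU := [set x | exists k, b k x].
have maU : measurable aU by exact: measurable_cexists.
have mbU : measurable bU by exact: measurable_cexists.
have A_split x : A x -> ~ aU x -> Ainf x.
  move=> Ax nax k; elim: k => [//|k IH]; rewrite ABS; split => // ak.
  by apply: nax; exists k.
have B_split x : ~ A x -> ~ bU x -> Binf x.
  move=> Ax nax k; elim: k => [//|k IH]; rewrite ABS; split => // ak.
  by apply: nax; exists k.
(* the saturation of the unmatched part of [A] *)
pose W := [set x | exists j, (g j @^-1` Ainf) x].
have mW : measurable W.
  by apply: measurable_cexists => j; exact: (measurable_preim (mg j) mAinf).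
have [N [mN N0 NP]] := ae_null gP.
have Winv j : bd (g j) W = 0.
  apply: (pm_null_sub (B := g j @^-1` N)).
  - exact: measurable_escape.
  - exact: (measurable_preim (mg j) mN).
  - move=> x [[i Ai] nW]; apply: contrapT => nN; apply: nW.
    have Rij : cR (g j x, g i x).
      by apply: (rel_trans hR) (gR i x); apply: (rel_sym hR); exact: gR.
    have [k Hk] := NP _ nN _ Rij.
    by exists k; rewrite /= -Hk.
  - by rewrite (involution_pm hX hR (gI j)).
have AW : m Ainf <= m W.
  rewrite -[leRHS]addr0 -N0; apply: pm_subU => // x Ax.
  have [Nx|nN] := pselect (N x); [by right|left].
  have [k Hk] := NP _ nN _ (rel_refl hR x).
  by exists k; rewrite /= -Hk.
have WB : W `<=` ~` Binf.
  move=> x [j Aj] Bx; have [_] := Aj j.+1; apply; split; first exact: Aj.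
  by rewrite /= gg.
have hab : m aU = m bU.
  rewrite -(involution_pm hX hR hI maU); congr m.
  apply/seteqP; split => x /=.
    move=> [k ak]; exists k; have [_ hh _] := hI.
    have : h (h x) = g k (h x) by apply: hP; left.
    by rewrite hh => ->; rewrite /b /= gg.
  by move=> [k bk]; exists k; rewrite (hP k); [exact: bk|right].
have mW0 : m W = 0.
  have /eqP := erg W mW Winv; rewrite mulf_eq0 => /orP[/eqP //|/eqP W1].
  have Bi0 : m Binf = 0.
    apply: (pm_null_sub (B := ~` W)) => //; first exact: measurableC.
      by move=> x Bx /WB.
    by rewrite pm_C.
  have : m (~` A) <= m bU + m Binf.
    apply: pm_subU => //; first exact: measurableC.
    move=> x nAx; have [bx|nbx] := pselect (bU x); [by left|right].
    exact: B_split.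
  have : m aU <= m A by apply: pm_mono => // x [k /aA].
  by move: A2; rewrite -hab Bi0 (pm_C mu mA); lra.
apply: (pm_null_sub (B := Ainf)) => //.
- apply: measurableI => //; apply: measurable_preim => //; by case: hI.
- move=> x [Ax Ahx]; apply: A_split => // -[k ak].
  have /bA : b k (h x) by rewrite (hP k x); [rewrite /b /= gg|left].
  exact.
by apply/eqP; rewrite eq_le pm_ge0 -[X in _ <= X]mW0 AW.
Qed.

Definition bdsum n (ga : nat -> X -> X) A := \sum_(i < n) bd (ga i) A.

(** A maximal set [A] of mass at most 1/4 and of small relative boundary can be
    enlarged by a set [A'] that is also almost invariant under an involution moving
    [A] off itself: that involution carries the overlap of [A'] with [A] outside
    [A], hence [A'] brings enough new mass. *)
Lemma large_almost_invariant :
  (forall B, measurable B -> (forall j, bd (g j) B = 0) -> m B * (1 - m B) = 0) ->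
  (forall n (ga : nat -> X -> X) e, (forall i, rel_involution cR (ga i)) -> 0 < e ->
     exists A, [/\ measurable A, 0 < m A, m A <= 2%:R^-1 & bdsum n ga A <= e * m A]) ->
  forall n (ga : nat -> X -> X) e, (forall i, rel_involution cR (ga i)) -> 0 < e ->
     exists A, [/\ measurable A, 4%:R^-1 <= m A, m A <= 3%:R / 4%:R & bdsum n ga A <= e].
Proof.
move=> erg small n ga e gaI e0; apply: contrapT => nlarge.
have mga i : measurable_fun setT (ga i) by case: (gaI i).
pose C := [set A : set X | [/\ measurable A, m A <= 4%:R^-1 & bdsum n ga A <= e * m A]].
have bds0 A : 0 <= bdsum n ga A by apply: sumr_ge0 => i _; exact: bd_ge0.
have [|||A [mA A4 bdA] maxA] := @exhaustion _ _ _ mu C.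
- by move=> A [].
- split; rewrite ?pm0 ?mulr0 ?invr_ge0// /bdsum big1// => i _.
  by rewrite -(pm0 mu); congr m; apply/seteqP; split => x // [].
- move=> F CF ndF.
  have mF k : measurable (F k) by case: (CF k).
  have mU : measurable (\bigcup_k F k) by exact: bigcupT_measurable.
  have mFU k : m (F k) <= m (\bigcup_k F k).
    by apply: pm_mono => // x Fx; exists k.
  split => //; first by apply: pm_bigcup_sup => // k; case: (CF k).
  pose G i k := F k `&` ~` (ga i @^-1` (\bigcup_k F k)).
  have mC i : measurable (~` (ga i @^-1` (\bigcup_k F k))).
    by apply: measurableC; exact: measurable_preim.
  have mG i k : measurable (G i k) by exact: measurableI.
  have cG i : m (G i k) @[k --> \oo] --> bd (ga i) (\bigcup_k F k).
    rewrite /escape_mass (_ : escape _ _ = \bigcup_k G i k).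
      by apply: pm_cvg_bigcup => // k x [Fx nx]; split => //; exact: ndF.
    apply/seteqP; split => x.
      by move=> [[k _ Fx] nx]; exists k.
    by move=> [k _ [Fx nx]]; split => //; exists k.
  have cS : (\sum_(i < n) m (G i k)) @[k --> \oo] --> bdsum n ga (\bigcup_k F k).
    exact: cvg_sum_seq.
  apply: (cvg_le_bound cS) => k; apply: le_trans (_ : e * m (F k) <= _); last by rewrite ler_pM2l.
  have [_ _] := CF k; apply: le_trans; apply: ler_sum => i _.
  apply: pm_mono => //; first exact: measurable_escape.
  by move=> x [Fx nx]; split => // Fgx; apply: nx; exists k.
have A4' : m A < 4%:R^-1.
  rewrite lt_neqAle A4 andbT; apply/eqP => mA4; apply: nlarge; exists A.
  split => //; rewrite ?mA4//; [lra|].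
  by apply: le_trans bdA _; rewrite mA4; lra.
have [h hI hA] := disjoint_involution erg mA (ltac:(lra) : m A < 2%:R^-1).
pose ga' i := if i is j.+1 then ga j else h.
have [||A' [mA' A'0 A'2 bdA']] := small n.+1 ga' (Num.min (4%:R^-1) (e / 4%:R)).
- by case.
- by rewrite lt_min; apply/andP; split; lra.
set e' := Num.min _ _ in bdA'.
have e'4 : e' <= 4%:R^-1 by rewrite /e' ge_min lexx.
have e'e : e' <= e / 4%:R by rewrite /e' ge_min lexx orbT.
have mh : measurable_fun setT h by case: hI.
have bdsE : bdsum n.+1 ga' A' = bd h A' + bdsum n ga A'.
  by rewrite /bdsum big_ord_recl.
have e'A1 : e' * m A' <= 4%:R^-1 * m A' by rewrite ler_pM2r.
have e'A2 : e' * m A' <= e / 4%:R * m A' by rewrite ler_pM2r.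
have bdh0 := bd_ge0 mu h A'.
have bdn0 := bds0 A'.
have eA' : e / 4%:R * m A' <= e / 4%:R * 2%:R^-1 by rewrite ler_pM2l//; lra.
have A'4 : m A' < 4%:R^-1.
  rewrite ltNge; apply/negP => A'4; apply: nlarge; exists A'; split => //; first lra.
  by lra.
have mD : measurable (A' `\` A) by exact: measurableD.
have mI : measurable (A' `&` A) by exact: measurableI.
(* [h] moves [A] off itself, so it carries the overlap outside [A] or out of
   [A'] *)
have grow : m (A' `&` A) <= m (A' `\` A) + bd h A'.
  have mE : measurable (A `&` h @^-1` A) by apply: measurableI => //; exact: measurable_preim.
  rewrite -(involution_pm hX hR hI mD).
  have mD' : measurable (h @^-1` (A' `\` A)) by exact: measurable_preim.
  have : m (A' `&` A) <= m (h @^-1` (A' `\` A) `|` escape h A') + m (A `&` h @^-1` A).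
    apply: pm_subU => //; first by apply: measurableU => //; exact: measurable_escape.
    move=> x [A'x Ax]; have [Ahx|nAhx] := pselect (A (h x)); first by right.
    left; have [A'hx|nA'hx] := pselect (A' (h x)); first by left.
    by right.
  rewrite hA addr0 => /le_trans; apply; apply: pm_U => //.
  exact: measurable_escape.
have split' := pm_split mu mA' mA.
have mAA' : measurable (A `|` A') by exact: measurableU.
have mUE : m (A `|` A') = m A + m (A' `\` A).
  rewrite -pm_disjU//; last by move=> x [Ax []].
  congr m; apply/seteqP; split => x; last by case=> [|[]]; [left|right].
  by have [?|?] := pselect (A x); [left|case=> // ?; right].
have bdU' : bdsum n ga (A `|` A') <= bdsum n ga A + bdsum n ga A'.
  by rewrite -big_split; apply: ler_sum => i _; exact: bdU.
have step1 : m A' / 4%:R <= m (A' `\` A) by lra.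
have bdfinal : bdsum n ga (A `|` A') <= e * m (A `|` A').
  rewrite mUE mulrDr; have : e * (m A' / 4%:R) <= e * m (A' `\` A) by rewrite ler_pM2l.
  by lra.
have CU : C (A `|` A').
  split => //; rewrite leNgt; apply/negP => U4; apply: nlarge; exists (A `|` A').
  have U34 : m (A `|` A') <= 3%:R / 4%:R by have := pm_ge0 mu (A' `&` A); lra.
  split => //; first exact: ltW.
  apply: le_trans bdfinal _; rewrite -[leRHS]mulr1 ler_pM2l//; exact: pm_le1.
by have := maxA _ CU (@subsetUl _ _ _); lra.
Qed.

(** Without expansion, [large_almost_invariant] provides sets that are more and
    more invariant under the generators, with masses in [[1/4, 3/4]]. *)
Lemma strongly_ergodic_expansion : strongly_ergodic setT mu cR ->
  exists n (ga : nat -> X -> X) (C : R), [/\ forall i, rel_involution cR (ga i), 0 < C &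
    forall A, measurable A -> m A * (1 - m A) <= C * bdsum n ga A].
Proof.
move=> serg.
have muE0 A : measurable A -> (mu A * (1 - mu A))%E = (m A * (1 - m A))%:E.
  by move=> mA; rewrite pmE// -EFinB -EFinM.
have sergE (E : nat -> set X) : (forall n, measurable (E n)) ->
    (forall j e, 0 < e -> exists n0, forall n, (n0 <= n)%N -> bd (g j) (E n) < e) ->
    forall e, 0 < e -> exists n0, forall n, (n0 <= n)%N -> m (E n) * (1 - m (E n)) < e.
  move=> mE HE; have := serg E mE (fun _ _ _ => I).
  have Hh h : full_group setT mu cR h -> (fun n => mu ((h @` E n) `+` E n)) @ \oo --> 0%E.
    by move=> hh; exact: (full_group_escape hX hR gI gP hh mE HE).
  move=> /(_ Hh); rewrite (_ : (fun n => _) = (fun n => (m (E n) * (1 - m (E n)))%:E)).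
    move=> /fine_cvgP[_] /= /cvg0P; apply => n; rewrite mulr_ge0 ?pm_ge0// subr_ge0.
    exact: pm_le1.
  by apply/funext => n; rewrite muE0.
apply: contrapT => nexp.
have erg B : measurable B -> (forall j, bd (g j) B = 0) -> m B * (1 - m B) = 0.
  move=> mB B0; apply/eqP; rewrite eq_le; apply/andP; split; last first.
    by rewrite mulr_ge0 ?pm_ge0// subr_ge0 pm_le1.
  rewrite leNgt; apply/negP => B1.
  have [|n0 /(_ n0 (leqnn _))] := sergE (fun=> B) (fun=> mB) _ _ B1.
    by move=> j e e0; exists 0%N => n _; rewrite B0.
  by rewrite ltxx.
have small n (ga : nat -> X -> X) e : (forall i, rel_involution cR (ga i)) -> 0 < e ->
     exists A, [/\ measurable A, 0 < m A, m A <= 2%:R^-1 & bdsum n ga A <= e * m A].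
  move=> gaI e0; apply: contrapT => nA; apply: nexp; exists n, ga, e^-1; split => //.
    by rewrite invr_gt0.
  move=> A mA; rewrite leNgt; apply/negP; rewrite -(ltr_pM2l e0) mulrA divff ?gt_eqF// mul1r.
  move=> HA.
  have bds0 : 0 <= bdsum n ga A by apply: sumr_ge0 => i _; exact: bd_ge0.
  have A0 := pm_ge0 mu A; have A1 := pm_le1 mu mA.
  have p0 : 0 < m A * (1 - m A) by rewrite -(ltr_pM2l e0) mulr0; exact: le_lt_trans HA.
  have mA0 : 0 < m A.
    by rewrite lt_neqAle A0 andbT; apply/eqP => A00; rewrite -A00 mul0r ltxx in p0.
  have mA1 : 0 < 1 - m A.
    by rewrite lt_neqAle subr_ge0 A1 andbT; apply/eqP => A00; rewrite -A00 mulr0 ltxx in p0.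
  apply: nA; have [A2|A2] := leP (m A) 2%:R^-1.
    exists A; split => //; apply: le_trans (ltW HA) _; rewrite ler_pM2l//.
    by rewrite -[leRHS]mulr1 ler_pM2l//; lra.
  exists (~` A); rewrite pm_C//; split => //; first exact: measurableC.
    by lra.
  rewrite (_ : bdsum n ga (~` A) = bdsum n ga A).
    apply: le_trans (ltW HA) _; rewrite ler_pM2l//.
    by rewrite -[leRHS]mul1r ler_pM2r//.
  by apply: eq_bigr => i _; exact: (bdC hX hR).
have large := large_almost_invariant erg small.
have /choice[E HE] : forall n, exists A, [/\ measurable A, 4%:R^-1 <= m A,
    m A <= 3%:R / 4%:R & bdsum n g A <= n.+1%:R^-1].
  by move=> n; apply: large => //; rewrite invr_gt0.
have [|||n0 /(_ n0 (leqnn _))] := sergE E _ _ (8%:R^-1).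
- by move=> n; case: (HE n).
- move=> j e e0.
  have [n ne] := inv_natS_lt e0.
  exists (maxn n j.+1) => k; rewrite geq_max => /andP[nk jk].
  have [_ _ _ bdE] := HE k.
  apply: le_lt_trans ne; apply: (@le_trans _ _ (k.+1%:R^-1)); last first.
    by rewrite lef_pV2 ?posrE// ler_nat.
  apply: le_trans bdE; rewrite /bdsum (bigD1 (Ordinal jk))//=.
  by rewrite lerDl sumr_ge0// => i _; exact: bd_ge0.
- by rewrite invr_gt0.
have [_ h1 h2 _] := HE n0; apply/negP; rewrite -leNgt.
by move: (m (E n0)) h1 h2 => t; nra.
Qed.

End expansion.

(** * Almost invariant colorings and their energy *)

Section colorings.
Context d (X : measurableType d) (R : realType) (mu : probability X R).
Local Notation m := (pm mu).
Local Notation bd := (escape_mass mu).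
Hypothesis hX : standard_borel R X.
Context (cS : set (X * X)).
Hypothesis hS : dmp_equivalence mu cS.
Context (s : nat -> X -> X).
Hypothesis sI : forall j, rel_involution cS (s j).

Let ms j : measurable_fun setT (s j). Proof. by case: (sI j). Qed.

Definition color_class (f : X -> nat) i := [set x | f x = i].
Definition color_change (g : X -> X) (f : X -> nat) := [set x | f (g x) <> f x].

(** One parameter bounds both the number of involutions considered and the
    boundaries, so that the conditions get stronger with [k]. *)
Definition almost_inv k B := forall j, (j <= k)%N -> bd (s j) B <= k.+1%:R^-1.

Definition coloring k N (f : X -> nat) :=
  [/\ forall i, measurable (color_class f i), forall x, (f x < N)%N &
      forall j, (j <= k)%N -> m (color_change (s j) f) <= k.+1%:R^-1].

(** Small exactly when all the classes are small, by [class_le_energy] and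
    [energy_le_max]; and strictly decreased by cutting a class. *)
Definition energy N f := \sum_(i < N) m (color_class f i) ^+ 2.

Lemma measurable_color_change g f : measurable_fun setT g ->
  (forall i, measurable (color_class f i)) -> measurable (color_change g f).
Proof.
move=> mg mf.
rewrite (_ : color_change g f = [set x | exists i,
   (color_class f i `&` ~` (g @^-1` color_class f i)) x]).
  apply: measurable_cexists => i; apply: measurableI => //.
  by apply: measurableC; exact: measurable_preim.
apply/seteqP; split => x /=.
  by move=> H; exists (f x); split.
by move=> [i [<- H]].
Qed.

Lemma inv_natS_le (k l : nat) : (k <= l)%N -> (l.+1%:R^-1 : R) <= k.+1%:R^-1.
Proof. by move=> kl; rewrite lef_pV2 ?posrE ?ltr0n// ler_nat ltnS. Qed.

Lemma almost_inv_le k l B : (k <= l)%N -> almost_inv l B -> almost_inv k B.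
Proof.
move=> kl H j jk; apply: le_trans (H _ (leq_trans jk kl)) _.
exact: inv_natS_le.
Qed.

Lemma coloring_le k l N f : (k <= l)%N -> coloring l N f -> coloring k N f.
Proof.
move=> kl [mf fN cf]; split => // j jk.
apply: le_trans (cf _ (leq_trans jk kl)) _; exact: inv_natS_le.
Qed.

Lemma class_almost_inv k N f i : coloring k N f -> almost_inv k (color_class f i).
Proof.
move=> [mf fN cf] j jk; apply: le_trans (cf j jk); apply: pm_mono.
- exact: measurable_escape.
- exact: measurable_color_change.
- by move=> x [fx fsx]; rewrite /color_change /= fx.
Qed.

Lemma sum_classes N f : (forall i, measurable (color_class f i)) ->
  (forall x, (f x < N)%N) -> \sum_(i < N) m (color_class f i) = 1.
Proof.
move=> mf fN.
have H k : measurable [set x | (f x < k)%N] /\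
    \sum_(i < k) m (color_class f i) = m [set x | (f x < k)%N].
  elim: k => [|k [mk IH]].
    have -> : [set x | (f x < 0)%N] = set0 by apply/seteqP; split => x.
    by rewrite big_ord0 pm0; split.
  have E : [set x | (f x < k.+1)%N] = [set x | (f x < k)%N] `|` color_class f k.
    apply/seteqP; split => x /=.
      by rewrite ltnS leq_eqVlt => /predU1P[fx|fx]; [right|left].
    by case=> [/leqW|fx] //; rewrite [f x]fx.
  rewrite E; split; first exact: measurableU.
  rewrite pm_disjU// ?big_ord_recr /= ?IH// => x [/= + fk].
  by rewrite fk ltnn.
have [_ ->] := H N; rewrite (_ : mkset _ = setT) ?pmT//.
by apply/seteqP; split => x // _; exact: fN.
Qed.

Lemma energy_ge0 N f : 0 <= energy N f.
Proof. by apply: sumr_ge0 => i _; exact: sqr_ge0. Qed.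

Lemma energy_le_max N f c : (forall i, measurable (color_class f i)) ->
  (forall x, (f x < N)%N) -> (forall i, m (color_class f i) <= c) -> energy N f <= c.
Proof.
move=> mf fN fc; rewrite -[c]mulr1 -(sum_classes mf fN) mulr_sumr.
by apply: ler_sum => i _; rewrite expr2 ler_wpM2r ?pm_ge0.
Qed.

Lemma class_le_energy N f i : (forall x, (f x < N)%N) ->
  m (color_class f i) ^+ 2 <= energy N f.
Proof.
move=> fN; have [iN|Ni] := ltnP i N.
  rewrite /energy (bigD1 (Ordinal iN))//= lerDl sumr_ge0// => j _.
  exact: sqr_ge0.
rewrite (_ : color_class f i = set0) ?pm0 ?expr0n ?energy_ge0//.
apply/seteqP; split => x //= fi; have := fN x.
by rewrite fi ltnNge Ni.
Qed.

(** The part of each class that lies in [B] gets a new colour of its own. *)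
Definition recolor N (f : X -> nat) (B : set X) (x : X) : nat :=
  (f x + N * `[< B x >])%N.

Lemma recolor_classE N f B i : (forall x, (f x < N)%N) -> (i < N)%N ->
  color_class (recolor N f B) i = color_class f i `\` B /\
  color_class (recolor N f B) (N + i) = color_class f i `&` B.
Proof.
move=> fN iN; rewrite /recolor /color_class; split; apply/seteqP; split => x /=.
- case: asboolP => Bx /=; last by rewrite muln0 addn0.
  by rewrite muln1 => fi; move: iN; rewrite -fi; lia.
- by move=> [fi nB]; rewrite asboolF// muln0 addn0.
- case: asboolP => Bx /=; first by rewrite muln1; split => //; lia.
  by rewrite muln0 addn0 => fi; have := fN x; rewrite fi; lia.
- by move=> [fi Bx]; rewrite asboolT// muln1 fi addnC.
Qed.

Lemma measurable_recolor N f B j : (forall i, measurable (color_class f i)) ->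
  measurable B -> measurable (color_class (recolor N f B) j).
Proof.
move=> mf mB; rewrite (_ : color_class _ j =
      (B `&` [set x | f x + N = j]%N) `|` (~` B `&` color_class f j)).
      apply: measurableU; apply: measurableI => //; last exact: measurableC.
      have [Nj|jN] := leqP N j.
        rewrite (_ : mkset _ = color_class f (j - N)) //.
        by apply/seteqP; split => x /=; rewrite /color_class /=; lia.
      rewrite (_ : mkset _ = set0) //.
      by apply/seteqP; split => x //=; lia.
    apply/seteqP; split => x; rewrite /color_class /recolor /=.
      case: asboolP => Bx /=; first by rewrite muln1; left.
      by rewrite muln0 addn0; right.
    by case=> -[Bx fx]; rewrite ?(asboolT Bx) ?(asboolF Bx) ?muln1 ?muln0 ?addn0.
Qed.

(** The squares of two masses [p] and [q] sum up to [(p + q) ^+ 2 - 2 p q]. The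
    level [4 k + 3] is such that its tolerance is a quarter of that of [k], and the
    color changes of the new coloring are bounded by three terms: those of [f] and
    the boundaries of [B] and of its complement. *)
Lemma energy_recolor k N f B i : coloring (4 * k + 3) N f -> measurable B ->
  almost_inv (4 * k + 3) B ->
  coloring k (N + N) (recolor N f B) /\
  energy (N + N) (recolor N f B) + 2%:R * (m (color_class f i `&` B) * m (color_class f i `\` B))
    <= energy N f.
Proof.
move=> [mf fN cf] mB iB; split.
  split.
  - by move=> j; exact: measurable_recolor.
  - move=> x; rewrite /recolor; have := fN x; case: asboolP => _ /=; lia.
  - move=> j jk; have jk' : (j <= 4 * k + 3)%N by lia.
    have mBc : measurable (~` B) by exact: measurableC.
    have mU : measurable (escape (s j) B `|` escape (s j) (~` B)).
      by apply: measurableU; exact: measurable_escape.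
    have : m (color_change (s j) (recolor N f B)) <=
        m (color_change (s j) f) + m (escape (s j) B `|` escape (s j) (~` B)).
      apply: pm_subU => //.
      + apply: measurable_color_change => // i0; exact: measurable_recolor.
      + exact: measurable_color_change.
      + move=> x; rewrite /color_change /recolor /= => H.
        have [fe|fe] := eqVneq (f (s j x)) (f x); last by left; apply/eqP.
        right; move: H; rewrite fe.
        case: asboolP => Bsx; case: asboolP => Bx // _; last by left.
        by right; split => // /(_ Bsx).
    have : m (escape (s j) B `|` escape (s j) (~` B)) <= bd (s j) B + bd (s j) (~` B).
      by apply: pm_U; exact: measurable_escape.
    rewrite (bdC hX hS (sI j) mB).
    have := iB j jk'; have := cf j jk'.
    have -> : ((4 * k + 3).+1%:R = 4%:R * k.+1%:R :> R).
      by rewrite -natrM; congr (_%:R); lia.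
    rewrite invfM; have : 0 < k.+1%:R^-1 :> R by rewrite invr_gt0.
    by move: (k.+1%:R^-1) => t; lra.
rewrite /energy big_split_ord /= -big_split /=.
pose c (j : nat) := m (color_class f j `&` B) * m (color_class f j `\` B).
have c0 j : 0 <= c j by rewrite mulr_ge0 ?pm_ge0.
have HE (j : 'I_N) : m (color_class (recolor N f B) j) ^+ 2 +
    m (color_class (recolor N f B) (N + j)) ^+ 2 + 2%:R * c j = m (color_class f j) ^+ 2.
  have [-> ->] := recolor_classE B fN (ltn_ord j).
  rewrite (pm_split mu (mf j) mB) /c; ring.
have [iN|Ni] := ltnP i N.
  rewrite (eq_bigr (fun j : 'I_N => m (color_class (recolor N f B) j) ^+ 2 +
    m (color_class (recolor N f B) (N + j)) ^+ 2 + 2%:R * c j - 2%:R * c j)).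
    rewrite sumrB (eq_bigr _ (fun j _ => HE j)) -addrA gerDl addrC subr_le0.
    rewrite (bigD1 (Ordinal iN))//= lerDl sumr_ge0// => j _.
    by rewrite mulr_ge0.
  by move=> j _; rewrite addrK.
rewrite (_ : color_class f i = set0).
  rewrite set0I pm0 mul0r mulr0 addr0; apply: ler_sum => j _.
  by rewrite -HE lerDl mulr_ge0.
apply/seteqP; split => x //= fi; have := fN x.
by rewrite fi ltnNge Ni.
Qed.

End colorings.

(** * Almost atoms and their limits *)

Section atoms.
Context d (X : measurableType d) (R : realType) (mu : probability X R).
Local Notation m := (pm mu).
Hypothesis hX : standard_borel R X.
Context (cS : set (X * X)).
Hypothesis hS : dmp_equivalence mu cS.
Context (s : nat -> X -> X).
Hypothesis sI : forall j, rel_involution cS (s j).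
Local Notation coloring := (coloring mu s).
Local Notation almost_inv := (almost_inv mu s).
Local Notation energy := (energy mu).

Definition energies k := [set q | exists N f, coloring k N f /\ q = energy N f].

(** Nondecreasing and bounded by 1, hence almost constant for large [k]: this is
    the compactness behind the almost atoms. *)
Definition min_energy k := inf (energies k).

Lemma has_inf_energies k : has_inf (energies k).
Proof.
split; last by exists 0 => _ [N [f [_ ->]]]; exact: energy_ge0.
exists (energy 1 (fun=> 0%N)), 1%N, (fun=> 0%N); split => //; split => //.
- by move=> i; apply: measurable_constP.
- move=> j _; rewrite (_ : color_change _ _ = set0) ?pm0 ?invr_ge0//.
  by apply/seteqP; split => x // [].
Qed.

Lemma min_energy_le k N f : coloring k N f -> min_energy k <= energy N f.
Proof.
by move=> kf; apply: ge_inf; [case: (has_inf_energies k)|exists N, f].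
Qed.

Lemma min_energy_ge0 k : 0 <= min_energy k.
Proof.
apply: lb_le_inf; first by case: (has_inf_energies k).
by move=> _ [N [f [_ ->]]]; exact: energy_ge0.
Qed.

Lemma min_energy_le1 k : min_energy k <= 1.
Proof.
have [[_ [N [f [kf _]]]] _] := has_inf_energies k.
apply: le_trans (min_energy_le kf) _; have [mf fN _] := kf.
by apply: energy_le_max => // i; exact: pm_le1.
Qed.

Lemma min_energy_mono k l : (k <= l)%N -> min_energy k <= min_energy l.
Proof.
move=> kl; apply: lb_le_inf; first by case: (has_inf_energies l).
by move=> _ [N [f [lf ->]]]; apply: min_energy_le; exact: coloring_le lf.
Qed.

Lemma min_energy_attained k e : 0 < e -> exists N f,
  coloring k N f /\ energy N f < min_energy k + e.
Proof.
move=> e0; have [_ [N [f [kf ->]]] fe] := inf_adherent e0 (has_inf_energies k).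
by exists N, f.
Qed.

Lemma small_coloring : (forall k, min_energy k = 0) ->
  forall k e, 0 < e -> exists N f, coloring k N f /\
    forall i, m (color_class f i) <= e.
Proof.
move=> E0 k e e0; have e20 : 0 < e ^+ 2 by rewrite exprn_gt0.
have [N [f [kf fe]]] := min_energy_attained k e20.
exists N, f; split => // i; rewrite -ler_sqr ?nnegrE ?pm_ge0 ?(ltW e0)//.
have [_ fN _] := kf; apply: le_trans (class_le_energy _ _ fN) _.
by rewrite E0 add0r in fe; exact: ltW.
Qed.

(** At a level where [min_energy] is within [1 / (n + 1)] of its supremum, cutting
    a large class of a nearly optimal coloring by an almost invariant set would
    lower the energy below the minimum of a slightly weaker level, unless one of
    the two parts is almost null. *)
Lemma almost_atoms k1 : 0 < min_energy k1 ->
  forall n, exists k A, [/\ measurable A, min_energy k1 / 2%:R <= m A, almost_inv n A &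
    forall B, measurable B -> almost_inv k B -> m (A `&` B) * m (A `\` B) <= n.+1%:R^-1].
Proof.
move=> k10 n; set a := min_energy k1.
have e0 : 0 < n.+1%:R^-1 :> R by rewrite invr_gt0.
pose E := [set min_energy k | k in setT].
have supE : has_sup E.
  split; first by exists a; exists k1.
  by exists 1 => _ [k _ <-]; exact: min_energy_le1.
have [_ [k2 _ <-] Hk2] := sup_adherent e0 supE.
pose k := (n + k1 + k2)%N; pose l := (4 * k + 3)%N.
have kE : sup E - n.+1%:R^-1 < min_energy k.
  by apply: lt_le_trans Hk2 _; apply: min_energy_mono; rewrite /k leq_addl.
have lE : min_energy l <= sup E.
  by apply: sup_upper_bound => //; exists l.
have [N [f [lf fe]]] := min_energy_attained l e0.
have [mf fN _] := lf.
have [i Hi] : exists i, a / 2%:R <= m (color_class f i).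
  apply: contrapT => nH.
  have : energy N f <= a / 2%:R.
    apply: energy_le_max => // i; rewrite leNgt; apply/negP => Hi; apply: nH.
    by exists i; exact: ltW.
  have : a <= energy N f.
    apply: le_trans (min_energy_le lf); apply: min_energy_mono.
    by rewrite /l /k; lia.
  by move: k10; rewrite -/a; lra.
exists l, (color_class f i); split => //.
  apply: (@almost_inv_le _ _ _ _ _ _ l); first by rewrite /l /k; lia.
  exact: (class_almost_inv sI _ lf).
move=> B mB lB; have [kf' fe'] := energy_recolor hX hS sI i lf mB lB.
have := min_energy_le kf'.
by move: kE lE fe fe'; move: (n.+1%:R^-1) => t; lra.
Qed.

End atoms.

Section atom_limit.
Context d (X : measurableType d) (R : realType) (mu : probability X R).
Local Notation m := (pm mu).

(** Each set is almost contained in, or almost disjoint from, every much later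
    one. There is no room for many almost disjoint sets of mass [a], so most sets
    along an ultrafilter are almost contained in most others, and a sequence that
    increases up to summable errors can be extracted. *)
Lemma atoms_converge (a : R) (A : nat -> set X) (K : nat -> nat) : 0 < a ->
  (forall n, measurable (A n)) -> (forall n, a <= m (A n)) ->
  (forall n l, (K n <= l)%N -> m (A n `&` A l) * m (A n `\` A l) <= n.+1%:R^-1) ->
  exists E, measurable E /\ forall e n0, 0 < e -> exists n,
    [/\ (n0 <= n)%N, m (A n `\` E) <= e & m (E `\` A n) <= e].
Proof.
move=> a0 mA aA atom.
have PF : ProperFilter (\oo : set_system nat) by exact: _.
have [U [UU inftyU]] := ultraFilterLemma PF.
have Utail k : U [set l | (k <= l)%N] by apply: inftyU; exists k.
(* Otherwise most sets are almost disjoint from most others. Starting from the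
   empty set, [M] of them are collected, each being chosen almost disjoint from
   the previous ones; their union would have mass more than 1. *)
have claim e : 0 < e -> U [set n | U [set l | m (A n `\` A l) <= e]].
  move=> e0.
  have [//|T] := in_ultra_setVsetC [set n | U [set l | m (A n `\` A l) <= e]] UU.
  exfalso.
  have [M HM] : exists M : nat, 1 < M%:R * (a / 2%:R).
    have a2 : 0 < a / 2%:R by rewrite divr_gt0.
    exists (Num.bound (a / 2%:R)^-1).
    rewrite -ltr_pdivrMr// mul1r; apply: le_lt_trans (archi_boundP _) => //.
    by rewrite invr_ge0 ltW.
  pose c := a / (2%:R * M.+1%:R).
  have c0 : 0 < c by rewrite divr_gt0// mulr_gt0.
  have Mc i : (i <= M)%N -> i%:R * c <= a / 2%:R.
    move=> iM; rewrite /c mulrA ler_pdivrMr ?mulr_gt0//.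
    have -> : a / 2%:R * (2%:R * M.+1%:R) = M.+1%:R * a by field.
    by rewrite ler_pM2r// ler_nat leqW.
  have ec0 : 0 < e * c by rewrite mulr_gt0.
  have [n0 Hn0] := inv_natS_lt ec0.
  have step n : (n0 <= n)%N -> ~ U [set l | m (A n `\` A l) <= e] ->
      U [set l | m (A n `&` A l) <= c].
    move=> n0n nU.
    have [//|Ue] := in_ultra_setVsetC [set l | m (A n `\` A l) <= e] UU.
    apply: filterS (filterI Ue (Utail (K n))) => l [/= /negP].
    rewrite -ltNge => el /atom Hl.
    rewrite leNgt; apply/negP => cl.
    have : e * c < m (A n `&` A l) * m (A n `\` A l).
      rewrite mulrC; apply: ltr_pM => //; exact: ltW.
    apply/negP; rewrite -leNgt; apply: le_trans Hl _; apply: le_trans (ltW Hn0).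
    by rewrite lef_pV2 ?posrE ?ltr0n// ler_nat ltnS.
  have H i : (i <= M)%N -> exists C, [/\ measurable C, i%:R * (a / 2%:R) <= m C &
      U [set l | m (C `&` A l) <= i%:R * c]].
    elim: i => [|i IH] iM.
      exists set0; split => //; rewrite ?mul0r ?pm0//.
      by apply: filterS (Utail 0%N) => l _ /=; rewrite set0I pm0 ?mul0r.
    have [C [mC Ca CU]] := IH (ltnW iM).
    have [n [[/= nT nC] n0n]] := filter_ex (filterI (filterI T CU) (Utail n0)).
    exists (C `|` A n); split; first exact: measurableU.
      have : m (C `|` A n) + m (C `&` A n) = m C + m (A n).
        rewrite (pm_split mu (mA n) mC) (setIC (A n)).
        rewrite (_ : C `|` A n = C `|` (A n `\` C)); last first.
          apply/seteqP; split => x; last by case=> [|[]]; [left|right].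
          by have [?|?] := pselect (C x); [left|case=> // ?; right].
        rewrite pm_disjU//; [by rewrite -addrA (addrC (m (A n `\` C)))|exact: measurableD|].
        by move=> x [Cx []].
      have := Mc _ (ltnW iM); have := aA n; rewrite -[i.+1%:R]natr1 mulrDl mul1r.
      by move: nC Ca; move: (i%:R * c) (i%:R * (a / 2%:R)) => u v; lra.
    apply: filterS (filterI CU (step n n0n nT)) => l [/= h1 h2].
    rewrite setIUl -[i.+1%:R]natr1 mulrDl mul1r; apply: le_trans (lerD h1 h2).
    by apply: pm_U; exact: measurableI.
  have [C [mC Ca _]] := H M (leqnn M).
  by have := lt_le_trans HM Ca; rewrite ltNge pm_le1.
pose r j : R := (2 ^+ j)^-1.
have r0 j : 0 < r j by rewrite invr_gt0 exprn_gt0.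
have rS j : r j = r j.+1 + r j.+1.
  by rewrite /r exprS invfM; set t : R := (2 ^+ j)^-1; lra.
pose good j n := U [set l | m (A n `\` A l) <= r j].
have /choice[nxt Hnxt] : forall p : nat * nat, exists n', good p.1 p.2 ->
    [/\ (p.2 < n')%N, good p.1.+1 n' & m (A p.2 `\` A n') <= r p.1].
  move=> [j n] /=; have [g|ng] := pselect (good j n); last by exists 0%N.
  have [n' [[/= g' h] nn']] := filter_ex (filterI (filterI (claim _ (r0 j.+1)) g) (Utail n.+1)).
  by exists n'.
have [n00 g0] := filter_ex (claim _ (r0 0%N)).
pose N := fix N j := if j is i.+1 then nxt (i, N i) else n00.
have NS j : N j.+1 = nxt (j, N j) by [].
have gN j : good j (N j).
  elim: j => [//|j IH]; rewrite NS; by have [] := Hnxt (j, N j) IH.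
have N_lt j : (N j < N j.+1)%N by rewrite NS; have [] := Hnxt (j, N j) (gN j).
have N_ge j : (j <= N j)%N.
  elim: j => [//|j IH]; exact: leq_ltn_trans IH (N_lt j).
have N_close j : m (A (N j) `\` A (N j.+1)) <= r j.
  by rewrite NS; have [] := Hnxt (j, N j) (gN j).
pose G j := A (N j).
(* the limit is the lower limit of the extracted subsequence *)
pose Ej j := [set x | forall i, (j <= i)%N -> G i x].
have mEj j : measurable (Ej j).
  by apply: measurable_cforall => i; apply: measurable_imp => _; exact: mA.
have EjS j : Ej j `<=` Ej j.+1 by move=> x H i ji; apply: H; exact: ltnW.
pose E := \bigcup_j Ej j.
have mE : measurable E by exact: bigcupT_measurable.
have GE j : m (G j `\` Ej j) <= r j + r j.
  pose H p := [set x | G j x /\ exists i, (i <= p)%N /\ (~` G (j + i)%N) x].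
  have mH p : measurable (H p).
    apply: (@measurableI _ _ (G j) [set x | exists i, (i <= p)%N /\ (~` G (j + i)%N) x]).
      exact: mA.
    apply: measurable_cexists => i; apply: measurable_andP => _.
    by apply: measurableC; exact: mA.
  have Hr p : m (H p) <= r j + r j - (r (j + p)%N + r (j + p)%N).
    elim: p => [|p IH].
      rewrite addn0 subrr (_ : H 0%N = set0) ?pm0//.
      apply/seteqP; split => x // -[Gx [i [+ nG]]].
      by rewrite leqn0 => /eqP i0; move: nG; rewrite i0 addn0.
    have : m (H p.+1) <= m (H p) + m (G (j + p)%N `\` G (j + p).+1).
      apply: pm_subU => //; first by apply: measurableD; exact: mA.
      move=> x [Gx [i [ip nG]]].
      have [ip'|pi] := leqP i p; first by left; split => //; exists i.
      have {}pi : i = p.+1 by apply/eqP; rewrite eqn_leq ip.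
      have [Gp|nGp] := pselect (G (j + p)%N x).
        by right; split => //; rewrite -addnS -pi.
      by left; split => //; exists p.
    have := N_close (j + p)%N; rewrite -/(G _) -/(G _) addnS -rS.
    by move: (m (_ `\` _)) (m (H p.+1)) IH => u v; move: (m (H p)) => w; lra.
  apply: (@le_trans _ _ (m (\bigcup_p H p))).
    apply: pm_mono; [by apply: measurableD => //; exact: mA|exact: bigcupT_measurable|].
    move=> x [Gx nE]; apply: contrapT => nH; apply: nE => i /subnKC <-.
    apply: contrapT => nG; apply: nH; exists (i - j)%N => //; split => //.
    by exists (i - j)%N.
  apply: pm_bigcup_sup => //.
    move=> p x [Gx [i [ip nG]]]; split => //; exists i; split => //; exact: leqW.
  by move=> p; apply: le_trans (Hr p) _; rewrite gerBl addr_ge0// ltW.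
exists E; split => // e n0 e0.
have [j1 Hj1] := pm_up mu mEj EjS e0.
have [j2 Hj2] := small_pow (ltac:(lra) : 0 < e / 2%:R).
pose j := (j1 + j2 + n0)%N.
exists (N j); split.
- by apply: leq_trans (N_ge j); rewrite /j leq_addl.
- apply: le_trans (_ : m (G j `\` Ej j) <= _).
    apply: pm_mono; try by apply: measurableD => //; exact: mA.
    by move=> x [Gx nE]; split => // Ex; apply: nE; exists j.
  apply: le_trans (GE j) _.
  have : r j <= r j2.
    by rewrite lef_pV2 ?posrE ?exprn_gt0// ler_eXn2l ?ltr1n// /j; lia.
  by have : r j2 < e / 2%:R by []; lra.
- have EjG : Ej j `<=` G j by move=> x; apply.
  have Ej_le : Ej j1 `<=` Ej j.
    by move=> x H i ji; apply: H; apply: leq_trans ji; rewrite /j -addnA leq_addr.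
  apply: le_trans (_ : m (E `\` Ej j1) <= _).
    apply: pm_mono; try by apply: measurableD => //; exact: mA.
    by move=> x [Ex nG]; split => // /Ej_le /EjG.
  have := pm_split mu mE (mEj j1).
  rewrite setIC (setIidl (_ : Ej j1 `<=` E)); last by move=> x; exists j1.
  by move: Hj1; rewrite -/E; lra.
Qed.

End atom_limit.

(** * The strongly ergodic component *)

Section component.
Context d (X : measurableType d) (R : realType) (mu : probability X R).
Local Notation m := (pm mu).
Local Notation bd := (escape_mass mu).
Hypothesis hX : standard_borel R X.
Context (cS : set (X * X)).
Hypothesis hS : dmp_equivalence mu cS.
Context (s : nat -> X -> X).
Hypothesis sI : forall j, rel_involution cS (s j).
Hypothesis sP : {ae mu, forall x, forall y, cS (x, y) -> exists j, y = s j x}.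
Local Notation almost_inv := (almost_inv mu s).

Let ms j : measurable_fun setT (s j). Proof. by case: (sI j). Qed.
Let ss j x : s j (s j x) = x. Proof. by case: (sI j). Qed.

Lemma invariant_bd0 E : measurable E -> (forall j, bd (s j) E = 0) ->
  invariant_set setT mu cS E.
Proof.
move=> mE E0 h hh.
have mh : measurable (h @` E) by case: hh => _ _ imh _; exact: imh.
have mD : measurable ((h @` E) `+` E) by apply: measurableU; exact: measurableD.
have := full_group_escape hX hS sI sP hh (E := fun=> E) (fun=> mE).
have H j e : 0 < e -> exists n0 : nat, forall n, (n0 <= n)%N -> bd (s j) E < e.
  by move=> e0; exists 0%N => n _; rewrite E0.
move=> /(_ H) /(mu_cvg0P mu (fun=> mD)) K.
rewrite pmE//; congr (_%:E); apply/eqP; rewrite eq_le pm_ge0 andbT leNgt.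
by apply/negP => /K[n0 /(_ n0 (leqnn _))]; rewrite ltxx.
Qed.

(** These elements of the full group of the restriction test the invariance of
    subsets of [E] under the generators of [cS]. *)
Lemma restricted_involution E j : measurable E ->
  full_group E (cond_measure mu E) (restrict_rel cS E)
    (choose_map (E `&` s j @^-1` E) (s j) id).
Proof.
move=> mE; set D := E `&` _; set g := choose_map _ _ _.
have mD : measurable D by apply: measurableI => //; exact: measurable_preim.
have gD x : D x -> g x = s j x by exact: choose_mapT.
have gnD x : ~ D x -> g x = x by exact: choose_mapF.
have Ds x : D x -> D (s j x) by move=> [Ex Esx]; split => //=; rewrite ss.
have gg x : g (g x) = x.
  have [Dx|nDx] := pselect (D x); last by rewrite !gnD.
  by rewrite gD// gD ?ss//; exact: Ds.
have gE x : E x -> E (g x).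
  move=> Ex; have [Dx|nDx] := pselect (D x); last by rewrite gnD.
  by rewrite gD//; case: Dx.
have mg : measurable_fun setT g by exact: measurable_choose_map.
split.
- split => //.
  + by move=> x y _ _ /(congr1 g); rewrite !gg.
  + by move=> y Ey; exists (g y); [exact: gE|rewrite gg].
- exact: measurable_funS mg.
- move=> B mB _; rewrite (_ : g @` B = g @^-1` B); first exact: measurable_preim.
  apply/seteqP; split => y; first by move=> [x Bx <-] /=; rewrite gg.
  by move=> By; exists (g y).
- exists set0; split => //; first by rewrite /cond_measure setI0 measure0 mul0e.
  move=> x /= H; apply: H => Ex; split; last by split => //; exact: gE.
  have [Dx|nDx] := pselect (D x); last by rewrite /= gnD//; exact: (rel_refl hS).
  by rewrite /= gD//; case: (sI j).
Qed.

(** The subsets of [E] that occur in the definition of strong ergodicity are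
    eventually almost invariant under the generators of [cS] in the whole space,
    because [E] is invariant and the restricted involutions only differ from the
    generators where these leave [E]. *)
Lemma strongly_ergodic_component E : measurable E -> 0 < m E ->
  (forall j, bd (s j) E = 0) ->
  (forall e, 0 < e -> exists k, forall B, measurable B -> B `<=` E -> almost_inv k B ->
     m B * (m E - m B) <= e) ->
  strongly_ergodic E (cond_measure mu E) (restrict_rel cS E).
Proof.
move=> mE E0 sE atomE B mB BE HB.
have muE0 : fine (mu E) = m E by [].
have cE C : measurable C -> C `<=` E ->
    cond_measure mu E C = (m C / m E)%:E.
  by move=> mC CE; rewrite /cond_measure setIidr// pmE// muE0 -EFinM.
have Bbd j e : 0 < e -> exists n0, forall n, (n0 <= n)%N -> bd (s j) (B n) < e.
  move=> e0; have hg := restricted_involution j mE.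
  set g := choose_map _ _ _ in hg; have [[gE _ _] _ img _] := hg.
  have mgB n : measurable (g @` B n) by exact: img.
  have mD n : measurable ((g @` B n) `+` B n).
    by apply: measurableU; exact: measurableD.
  have gBE n : g @` B n `<=` E by move=> _ [x /BE Ex <-]; exact: gE.
  have := HB g hg; rewrite (_ : (fun n => _) =
      (fun n => (m ((g @` B n) `+` B n) / m E)%:E)); last first.
    by apply/funext => n; rewrite cE// => x [[+ _]|[+ _]]; [exact: gBE|exact: BE].
  move=> /fine_cvgP[_] /= cv.
  have pos n : 0 <= m ((g @` B n) `+` B n) / m E by rewrite divr_ge0 ?pm_ge0.
  have [n0 Hn0] := (cvg0P pos).1 cv _ (divr_gt0 e0 E0).
  exists n0 => n /Hn0; rewrite ltr_pM2r ?invr_gt0//.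
  apply: le_lt_trans; rewrite -[leRHS]addr0 -(sE j).
  apply: pm_subU => //; try exact: measurable_escape.
  move=> x [Bx nBx]; have [Esx|nEsx] := pselect (E (s j x)); last first.
    by right; split; [exact: BE Bx|].
  left; right; split => // -[y By gy].
  have Dx : (E `&` s j @^-1` E) x by split; [exact: BE Bx|].
  have [Dy|nDy] := pselect ((E `&` s j @^-1` E) y).
    by apply: nBx; rewrite -gy /g choose_mapT// ss.
  move: gy; rewrite /g choose_mapF// => yx; apply: nDy; by rewrite yx.
rewrite (_ : (fun n => _) = (fun n => (m (B n) / m E * (1 - m (B n) / m E))%:E)); last first.
  by apply/funext => n; rewrite cE// -EFinB -EFinM.
have mBE n : m (B n) <= m E by exact: pm_mono.
apply: cvg_EFin; first exact: nearW.
apply/cvg0P => [n|e e0].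
  by rewrite /= mulr_ge0 ?divr_ge0 ?pm_ge0// subr_ge0 ler_pdivrMr// mul1r.
have e'0 : 0 < e / 2%:R * m E ^+ 2 by rewrite mulr_gt0 ?exprn_gt0// divr_gt0.
have [k Hk] := atomE _ e'0.
have k0 : 0 < k.+1%:R^-1 :> R by rewrite invr_gt0.
have [n0 Hn0] := eventually_all_lt (fun j => Bbd j _ k0) k.+1.
exists n0 => n /Hn0 Hn.
have /Hk : almost_inv k (B n) by move=> j jk; apply/ltW/Hn.
move=> /(_ (mB n) (BE n)) H /=.
have -> : m (B n) / m E * (1 - m (B n) / m E) =
    (m (B n) * (m E - m (B n))) / m E ^+ 2.
  by field; rewrite gt_eqF.
rewrite ltr_pdivrMr ?exprn_gt0//; apply: le_lt_trans H _.
by rewrite ltr_pM2r ?exprn_gt0//; lra.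
Qed.

(** The limit of the almost atoms is invariant because they are almost invariant
    to a higher and higher degree, and it cannot be cut by almost invariant sets
    because they cannot. *)
Lemma component_or_coloring :
  (exists E, [/\ measurable E, invariant_set setT mu cS E, (0 < mu E)%E &
     strongly_ergodic E (cond_measure mu E) (restrict_rel cS E)]) \/
  (forall k e, 0 < e -> exists N f, coloring mu s k N f /\
    forall i, m (color_class f i) <= e).
Proof.
have [E0|] := pselect (forall k, min_energy mu s k = 0).
  by right; exact: small_coloring.
move=> nE0; left.
have [k1 k10] : exists k1, 0 < min_energy mu s k1.
  apply: contrapT => H; apply: nE0 => k; apply/eqP.
  rewrite eq_le (min_energy_ge0 mu s) andbT leNgt; apply/negP => k0.
  by apply: H; exists k.
have /choice[K /choice[A HA]] := almost_atoms hX hS sI k10.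
set a := min_energy mu s k1 / 2%:R in HA.
have a0 : 0 < a by rewrite divr_gt0.
have mA n : measurable (A n) by case: (HA n).
have aA n : a <= m (A n) by case: (HA n).
have iA n : almost_inv n (A n) by case: (HA n).
have [n l nl|E [mE HE]] := atoms_converge a0 mA aA (K := K).
  by have [_ _ _] := HA n; apply => //; exact: almost_inv_le nl (iA l).
have mAE n : measurable (A n `\` E) by exact: measurableD.
have mEA n : measurable (E `\` A n) by exact: measurableD.
have sE j : bd (s j) E = 0.
  apply/eqP; rewrite eq_le bd_ge0 andbT leNgt; apply/negP => j0.
  pose e := bd (s j) E / 4%:R; have e0 : 0 < e by rewrite divr_gt0.
  have [n1 Hn1] := inv_natS_lt e0.
  have [n [n0n AE EA]] := HE e (n1 + j)%N e0.
  have iAj : bd (s j) (A n) <= e.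
    apply: le_trans (iA n j _) _; first by apply: leq_trans n0n; rewrite leq_addl.
    apply: le_trans (ltW Hn1); apply: inv_natS_le.
    by apply: leq_trans n0n; rewrite leq_addr.
  have mp : measurable (s j @^-1` (A n `\` E)) by exact: measurable_preim.
  have me : measurable (escape (s j) (A n)) by exact: measurable_escape.
  have : bd (s j) E <= m (escape (s j) (A n)) + m (E `\` A n `|` s j @^-1` (A n `\` E)).
    apply: pm_subU => //; [exact: measurable_escape|exact: measurableU|].
    move=> x [Ex nE]; have [Ax|nA] := pselect (A n x); last by right; left.
    have [As|nAs] := pselect (A n (s j x)); last by left.
    by right; right.
  have : m (E `\` A n `|` s j @^-1` (A n `\` E)) <= m (E `\` A n) + m (s j @^-1` (A n `\` E)).
    exact: pm_U.
  rewrite (involution_pm hX hS (sI j) (mAE n)).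
  have : bd (s j) E = 4%:R * e by rewrite /e; field.
  by move: iAj AE EA; rewrite /escape_mass; lra.
have mE0 : 0 < m E.
  have a2 : 0 < a / 2%:R by lra.
  have [n [_ AE _]] := HE _ 0%N a2.
  have := pm_split mu (mA n) mE; have := aA n.
  have : m (A n `&` E) <= m E.
    by apply: (pm_mono mu (measurableI _ _ (mA n) mE) mE) => x [].
  by lra.
exists E; split => //.
- exact: invariant_bd0.
- by rewrite pmE// lte_fin.
apply: strongly_ergodic_component => // e e0.
have e4 : 0 < e / 4%:R by lra.
have [n1 Hn1] := inv_natS_lt e4.
have [n [n1n AE EA]] := HE _ n1 e4.
exists (K n) => B mB BE kB.
have [_ _ _ /(_ B mB kB) H] := HA n.
have H' : m (A n `&` B) * m (A n `\` B) <= e / 4%:R.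
  by apply: le_trans H _; apply: le_trans (ltW Hn1); exact: inv_natS_le.
have mI := measurableI _ _ (mA n) mB.
have mD := measurableD (mA n) mB.
have h1 : m B <= m (A n `&` B) + m (E `\` A n).
  apply: pm_subU => // x Bx; have [Ax|nA] := pselect (A n x); first by left.
  by right; split => //; exact: BE.
have h2 : m E - m B <= m (A n `\` B) + m (E `\` A n).
  have := pm_split mu mE mB; rewrite (setIidr BE) => ->.
  rewrite addrAC subrr add0r; apply: pm_subU => //; first exact: measurableD.
  move=> x [Ex nB]; have [Ax|nA] := pselect (A n x); first by left.
  by right.
have h3 : 0 <= m E - m B by rewrite subr_ge0 pm_mono.
have h4 := pm_ge0 mu B; have h5 := pm_le1 mu mI; have h6 := pm_le1 mu mD.
have h7 : m E - m B <= 1 by have := pm_le1 mu mE; lra.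
have h8 := pm_ge0 mu (A n `\` B); have h9 := pm_ge0 mu (A n `&` B).
have h10 := pm_ge0 mu (E `\` A n).
move: (m (A n `&` B)) (m (A n `\` B)) (m (E `\` A n)) (m B) (m E - m B) h1 h2 h3 h4 h5 h6 h7 h8 h9 h10 H' EA => p q u b c.
move=> h1 h2 h3 h4 h5 h6 h7 h8 h9 h10 H' EA.
apply: (@le_trans _ _ ((p + u) * c)); first by rewrite ler_wpM2r.
rewrite mulrDl; apply: (@le_trans _ _ (p * (q + u) + u * 1)).
  by apply: lerD; [rewrite ler_wpM2l|rewrite ler_wpM2l].
have : p * u <= 1 * u by rewrite ler_wpM2r.
by rewrite mulrDr; lra.
Qed.

End component.

(** * Integrated estimates, overlaps and levels *)

Section integration.
Context d (X : measurableType d) (R : realType) (mu : probability X R).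
Local Notation m := (pm mu).

Lemma integral_sum_indic (I : finType) (a : I -> R) (A : I -> set X) :
  (forall i, 0 <= a i) -> (forall i, measurable (A i)) ->
  (\int[mu]_x (\sum_i a i * \1_(A i) x)%:E)%E = (\sum_i a i * m (A i))%:E.
Proof.
move=> a0 mA.
under eq_integral do rewrite -sumEFin.
rewrite ge0_integral_sum//.
- rewrite -sumEFin; apply: eq_bigr => i _.
  under eq_integral do rewrite EFinM.
  rewrite ge0_integralZl_EFin//.
    rewrite integral_indic// setIT EFinM; congr (_ * _)%E.
    exact: pmE.
  by apply/measurable_EFinP; exact: measurable_indic.
- by move=> i; apply/measurable_EFinP; apply: measurable_funM => //;
    apply: measurable_indic.
- by move=> i x _; rewrite lee_fin mulr_ge0.
Qed.

Lemma sum_indic_le (I J : finType) (a : I -> R) (A : I -> set X)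
    (b : J -> R) (B : J -> set X) :
  (forall i, 0 <= a i) -> (forall i, measurable (A i)) ->
  (forall i, 0 <= b i) -> (forall i, measurable (B i)) ->
  (forall x, \sum_i a i * \1_(A i) x <= \sum_i b i * \1_(B i) x) ->
  \sum_i a i * m (A i) <= \sum_i b i * m (B i).
Proof.
move=> a0 mA b0 mB H; rewrite -lee_fin -!integral_sum_indic//.
apply: ge0_le_integral => //.
- by move=> x _; rewrite lee_fin sumr_ge0// => i _; rewrite mulr_ge0.
- apply/measurable_EFinP; apply: measurable_sum => i.
  by apply: measurable_funM => //; exact: measurable_indic.
- apply/measurable_EFinP; apply: measurable_sum => i.
  by apply: measurable_funM => //; exact: measurable_indic.
- by move=> x _; rewrite lee_fin.
Qed.

Lemma indic_in (A : set X) x : A x -> \1_A x = 1 :> R.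
Proof. by move=> Ax; rewrite indicE mem_set. Qed.

Lemma indic_notin (A : set X) x : ~ A x -> \1_A x = 0 :> R.
Proof. by move=> Ax; rewrite indicE memNset. Qed.

(** Integrates a count of sets that is bounded below on [G]. *)
Lemma sum_pm_ge (I : finType) (A : I -> set X) (G : set X) c : 0 <= c ->
  (forall i, measurable (A i)) -> measurable G ->
  (forall x, G x -> c <= \sum_i \1_(A i) x) -> c * m G <= \sum_i m (A i).
Proof.
move=> c0 mA mG H.
rewrite (eq_bigr (fun i => 1 * m (A i))); last by move=> i _; rewrite mul1r.
have -> : c * m G = \sum_(i < 1) c * m G by rewrite big_ord1.
apply: (@sum_indic_le 'I_1 I (fun=> c) (fun=> G) (fun=> 1) A) => // x.
rewrite big_ord1; under [leRHS]eq_bigr do rewrite mul1r.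
have [Gx|nGx] := pselect (G x); first by rewrite indic_in// mulr1; exact: H.
by rewrite indic_notin// mulr0 sumr_ge0.
Qed.

(** Integrates a count of sets with a good bound [c] on [G] and a crude bound [b]
    elsewhere. *)
Lemma sum_pm_le (I : finType) (A : I -> set X) (G N : set X) c b :
  0 <= c -> 0 <= b ->
  (forall i, measurable (A i)) -> measurable G -> measurable N -> m N = 0 ->
  (forall x, ~ N x -> G x -> \sum_i \1_(A i) x <= c) ->
  (forall x, ~ N x -> \sum_i \1_(A i) x <= b) ->
  \sum_i m (A i) <= c + b * m (~` G).
Proof.
move=> c0 b0 mA mG mN N0 Hc Hb.
have mAN i : measurable (A i `\` N) by exact: measurableD.
have AN i : m (A i `\` N) = m (A i).
  rewrite [RHS](pm_split mu (mA i) mN) (_ : m (A i `&` N) = 0) ?add0r//.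
  by apply: (pm_null_sub (measurableI _ _ (mA i) mN) mN _ N0) => x [].
rewrite (eq_bigr (fun i => 1 * m (A i `\` N))); last first.
  by move=> i _; rewrite mul1r AN.
have -> : c + b * m (~` G) = \sum_(t : bool) (if t then c else b) *
    m (if t then setT else ~` G) by rewrite big_bool /= pmT mulr1.
apply: (@sum_indic_le I bool (fun=> 1) (fun i => A i `\` N)
  (fun t => if t then c else b) (fun t => if t then setT else ~` G)) => //.
- by case.
- by case=> //; exact: measurableC.
move=> x; rewrite big_bool /= indic_in// mulr1.
under eq_bigr do rewrite mul1r.
have [Nx|nN] := pselect (N x).
  rewrite big1; last by move=> i _; rewrite indic_notin// => -[].
  by rewrite addr_ge0// mulr_ge0.
have -> : \sum_i \1_(A i `\` N) x = \sum_i \1_(A i) x :> R.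
  apply: eq_bigr => i _; have [Ax|nA] := pselect (A i x).
    by rewrite !indic_in//; split.
  by rewrite !indic_notin// => -[].
have [Gx|nG] := pselect (G x).
  by rewrite indic_notin ?mulr0 ?addr0; [exact: Hc|apply].
by rewrite indic_in// mulr1; apply: le_trans (Hb x nN) _; rewrite lerDr.
Qed.

End integration.

Section overlap.
Context (R : realType).

(** An item of [sx] that is also listed in [sy] has the same colour on both sides
    and contributes at most the difference of its weights; for an item that is
    missing from [sy], [p c] is bounded by [`|p c - q c| + q c]. *)
Lemma overlap_estimate (T : eqType) (sx sy : seq T) (p q : T -> R)
    (colx coly : T -> nat) N :
  uniq sx -> uniq sy -> (forall c, 0 <= p c) -> (forall c, 0 <= q c) ->
  (forall c, c \in sx -> c \in sy -> colx c = coly c) ->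
  \sum_(i < N) Num.max 0 (\sum_(c <- sx | colx c == i) p c -
                          \sum_(c <- sy | coly c == i) q c) <=
  \sum_(c <- sx) `|p c - q c| + \sum_(c <- sx | c \notin sy) q c.
Proof.
move=> ux uy p0 q0 col.
pose r c := `|p c - q c| + (if c \notin sy then q c else 0).
have r0 c : 0 <= r c by rewrite addr_ge0//; case: ifP.
have Hi (i : 'I_N) : Num.max 0 (\sum_(c <- sx | colx c == i) p c -
    \sum_(c <- sy | coly c == i) q c) <= \sum_(c <- sx | colx c == i) r c.
  rewrite ge_max sumr_ge0//= lerBlDr.
  have : \sum_(c <- sx | (colx c == i) && (c \in sy)) q c <=
         \sum_(c <- sy | coly c == i) q c.
    rewrite [leRHS](bigID (fun c => c \in sx))/= -[leLHS]addr0.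
    apply: lerD; last exact: sumr_ge0.
    rewrite -big_filter -[leRHS]big_filter; rewrite le_eqVlt; apply/orP; left; apply/eqP; apply: perm_big.
    apply: uniq_perm; rewrite ?filter_uniq// => c; rewrite !mem_filter.
    have [cx|] := boolP (c \in sx); have [cy|] := boolP (c \in sy); rewrite ?andbF//.
    by rewrite (col c cx cy).
  move=> H; apply: le_trans (lerD (lexx _) H).
  rewrite [X in _ + X]big_mkcondr -big_split /=; apply: ler_sum => c _.
  rewrite /r -addrA; have : p c <= `|p c - q c| + q c.
    by rewrite -lerBlDr ler_norm.
  by case: (c \in sy); rewrite /= ?add0r ?addr0.
apply: le_trans (ler_sum _ (fun i _ => Hi i)) _.
rewrite (exchange_big_dep xpredT)//= [X in _ + X]big_mkcond -big_split /=.
apply: ler_sum => c _; have [cN|Nc] := ltnP (colx c) N.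
  rewrite (bigD1 (Ordinal cN))//= big1 ?addr0// => i /andP[/eqP ci /eqP ni].
  by exfalso; apply/ni/val_inj.
rewrite big1; first exact: r0.
by move=> i /eqP ci; move: (ltn_ord i); rewrite -ci ltnNge Nc.
Qed.

(** Counting the levels below a number is a discrete substitute for the coarea
    formula: it turns estimates on a function into estimates on its level sets, at
    the cost of an error 1. *)
Definition levels (Q : nat) (u : R) : R := \sum_(q < Q) (q.+1%:R <= u :> R)%:R.

Lemma levels_full Q u : Q%:R <= u -> levels Q u = Q%:R.
Proof.
move=> Qu; rewrite /levels (eq_bigr (fun=> 1)); last first.
  by move=> q _; rewrite (le_trans _ Qu)// ler_nat.
by rewrite sumr_const card_ord.
Qed.

Lemma levels_le Q u : 0 <= u -> levels Q u <= u.
Proof.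
move=> u0; elim: Q => [|Q IH]; first by rewrite /levels big_ord0.
have [Qu|uQ] := leP Q.+1%:R u; first by rewrite levels_full.
by rewrite /levels big_ord_recr /= (lt_geF uQ) addr0.
Qed.

Lemma levels_ge Q u : u <= Q%:R -> u - 1 <= levels Q u.
Proof.
elim: Q => [|Q IH] uQ; first by rewrite /levels big_ord0; lra.
have [Qu|] := leP Q.+1%:R u; first by rewrite levels_full//; lra.
move=> uQ'; rewrite /levels big_ord_recr /= (lt_geF uQ') addr0.
have [uQ2|Qu] := leP u Q%:R; first exact: IH.
rewrite -/(levels Q u) levels_full; last exact: ltW.
by move: uQ; rewrite -[Q.+1%:R]natr1; lra.
Qed.

Lemma levels_diff Q u v : 0 <= u -> u <= Q%:R -> v <= Q%:R ->
  \sum_(q < Q) ((q.+1%:R <= u :> R) && ~~ (q.+1%:R <= v :> R))%:R <= Num.max 0 (u - v) + 1 :> R.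
Proof.
move=> u0 uQ vQ; have [uv|vu] := leP u v.
  rewrite big1; first by rewrite addr_ge0// le_max lexx.
  move=> q _; case: (leP _ u) => // qu; by rewrite (le_trans qu uv).
apply: (@le_trans _ _ (u - v + 1)); last by rewrite lerD2r le_max lexx orbT.
have -> : \sum_(q < Q) ((q.+1%:R <= u :> R) && ~~ (q.+1%:R <= v :> R))%:R = levels Q u - levels Q v.
  rewrite /levels -sumrB; apply: eq_bigr => q _.
  case: (leP q.+1%:R v) => qv; last by rewrite subr0 andbT.
  by rewrite (le_trans qv (ltW vu)) subrr.
by have := levels_le Q u0; have := levels_ge vQ; lra.
Qed.

Definition sqC (z : R[i]) : R := complex.Re z ^+ 2 + complex.Im z ^+ 2.

Lemma sqC_ge0 z : 0 <= sqC z. Proof. by rewrite addr_ge0 ?sqr_ge0. Qed.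

(** The difference of two squares is a product of the difference and the sum, and
    [e] balances the two factors in the inequality of the means. *)
Lemma sqC_diff z w e : 0 < e ->
  `|sqC z - sqC w| <= sqC (z - w) / e + e * (sqC z + sqC w).
Proof.
move=> e0; case: z => a b; case: w => a' b'; rewrite /sqC /=.
have He x y : `|x ^+ 2 - y ^+ 2| <= (x - y) ^+ 2 / e + e * (x ^+ 2 + y ^+ 2).
  have -> : (x - y) ^+ 2 / e + e * (x ^+ 2 + y ^+ 2) =
    ((x - y) ^+ 2 + e ^+ 2 * (x ^+ 2 + y ^+ 2)) / e by field; rewrite gt_eqF.
  rewrite ler_pdivlMr// -[X in _ * X](gtr0_norm e0) -normrM ler_norml.
  apply/andP; split; last first.
    have := sqr_ge0 (x - y - e * (x + y) / 2%:R).
    have := sqr_ge0 (e * (x - y)).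
    rewrite -subr_ge0 => h1; rewrite -subr_ge0 => h2; nra.
  have := sqr_ge0 (x - y + e * (x + y) / 2%:R).
  have := sqr_ge0 (e * (x - y)); nra.
have := He a a'; have := He b b'.
have : `|a ^+ 2 + b ^+ 2 - (a' ^+ 2 + b' ^+ 2)| <= `|a ^+ 2 - a' ^+ 2| + `|b ^+ 2 - b' ^+ 2|.
  apply: le_trans (ler_normD _ _); rewrite le_eqVlt; apply/orP; left; apply/eqP.
  by congr `|_|; ring.
rewrite mulrDl !mulrDr; lra.
Qed.

End overlap.

Section l2.
Context (R : realType) (I : choiceType) (D : set I) (f : I -> R[i]).

Lemma l2norm_sum_le (e : R) (s : seq I) : 0 <= e -> (l2norm D f <= e%:E)%E ->
  uniq s -> (forall c, c \in s -> D c) -> \sum_(c <- s) sqC (f c) <= e ^+ 2.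
Proof.
move=> e0 fe us sD; rewrite -lee_fin.
set S := (\esum_(c in D) (sqC (f c))%:E)%E.
have S0 : (0 <= S)%E by apply: esum_ge0 => c _; rewrite lee_fin sqC_ge0.
have : (l2norm D f ^+ 2 <= e%:E ^+ 2)%E.
  by rewrite !expe2; apply: lee_pmul => //; exact: sqrte_ge0.
rewrite /l2norm sqr_sqrte// -EFin_expe; apply: le_trans.
apply: esum_ge; exists [set` s].
  by split => // c /= /sD.
by rewrite -fsbig_seq// sumEFin.
Qed.

Lemma l2norm1_sum_gt (e : R) : l2norm D f = 1%E -> 0 < e ->
  exists s, [/\ uniq s, forall c, c \in s -> D c & 1 - e < \sum_(c <- s) sqC (f c)].
Proof.
move=> f1 e0.
set S := (\esum_(c in D) (sqC (f c))%:E)%E.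
have S0 : (0 <= S)%E by apply: esum_ge0 => c _; rewrite lee_fin sqC_ge0.
have S1 : S = 1%E.
  have : (l2norm D f ^+ 2 = 1 ^+ 2)%E by rewrite f1.
  by rewrite /l2norm sqr_sqrte// expe2 mule1.
have [_ [A [fA AD] <-] HA] : exists2 y, [set (\sum_(x \in A) (sqC (f x))%:E)%E | A in fsets D] y
    & ((1 - e)%:E < y)%E.
  by apply: ereal_sup_gt; rewrite -/(esum _ _) -/S S1 lte_fin; lra.
exists (finmap.enum_fset (fset_set A)); split.
- exact: finmap.fset_uniq.
- by move=> c; rewrite in_fset_set// inE => /AD.
- by move: HA; rewrite fsbig_finite//= sumEFin lte_fin.
Qed.

End l2.

(** * Colour masses of square-summable vectors on classes *)

Section class_functions.
Context d (X : measurableType d) (R : realType) (mu : probability X R).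
Context (cS cR : set (X * X)).
Hypothesis hS : dmp_equivalence mu cS.
Hypothesis hR : dmp_equivalence mu cR.
Hypothesis hSR : cS `<=` cR.
Context (g : nat -> X -> X).
Hypothesis gI : forall j, rel_involution cR (g j).

Let mg j : measurable_fun setT (g j). Proof. by case: (gI j). Qed.

Lemma rclass_eq x y : cS (x, y) -> rclass cS x = rclass cS y.
Proof.
move=> xy; apply/seteqP; split => z; rewrite /rclass /=.
  by apply: (rel_trans hS); exact: (rel_sym hS).
exact: (rel_trans hS).
Qed.

Lemma rclass_eqP x y : rclass cS x = rclass cS y -> cS (x, y).
Proof.
move=> xy; have : rclass cS y y by exact: (rel_refl hS).
by rewrite -xy.
Qed.

Lemma quotient_rclass x z : cR (x, z) -> quotient_classes cS cR x (rclass cS z).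
Proof.
by move=> xz; split; [exists z|move=> w /hSR; exact: (rel_trans hR)].
Qed.

Lemma quotient_rep x c : quotient_classes cS cR x c -> exists2 z, cR (x, z) & c = rclass cS z.
Proof.
by move=> [[z ->] cx]; exists z => //; apply: cx; exact: (rel_refl hS).
Qed.

Definition nth_class k x := rclass cS (g k x).

Lemma quotient_nth_class y x k : cR (y, x) -> quotient_classes cS cR y (nth_class k x).
Proof. by move=> yx; apply/quotient_rclass/(rel_trans hR yx); case: (gI k). Qed.

(** Each [cS]-class in the [cR]-class of [x] is counted at the first index that
    reaches it. *)
Definition new k := [set x | forall j, (j < k)%N -> ~ cS (g j x, g k x)].

Lemma measurable_new k : measurable (new k).
Proof.
apply: measurable_cforall => j; apply: measurable_imp => _; apply: measurableC.
exact: (measurable_rel (rel_measurable hS)).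
Qed.

Lemma new_inj x k l : new k x -> new l x -> nth_class k x = nth_class l x -> k = l.
Proof.
wlog kl : k l / (k < l)%N.
  move=> H nk nl kl; have [kl'|lk|//] := ltngtP k l; first exact: H.
  by apply/esym; apply: H.
by move=> _ nl /rclass_eqP kl'; case: (nl k kl kl').
Qed.

Lemma new_exists x k : exists2 l, (l <= k)%N & new l x /\ nth_class l x = nth_class k x.
Proof.
have ex : exists l, `[< cS (g l x, g k x) >] by exists k; apply/asboolP; exact: (rel_refl hS).
have := find_ex_minn ex => -[l /asboolP lk minl]; exists l.
  by apply: minl; apply/asboolP; exact: (rel_refl hS).
split; last exact: rclass_eq.
move=> j jl jl'; have : (l <= j)%N; last by rewrite leqNgt jl.
by apply/minl/asboolP; exact: (rel_trans hS) jl' lk.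
Qed.

Definition class_list K x := [seq nth_class k x | k <- iota 0 K & `[< new k x >]].

Lemma class_list_uniq K x : uniq (class_list K x).
Proof.
rewrite map_inj_in_uniq ?filter_uniq ?iota_uniq// => k l.
by rewrite !mem_filter => /andP[/asboolP nk _] /andP[/asboolP nl _]; exact: new_inj.
Qed.

Lemma mem_class_listP K x c :
  reflect (exists k, [/\ (k < K)%N, new k x & c = nth_class k x]) (c \in class_list K x).
Proof.
apply: (iffP mapP) => [[k]|[k [kK nk ->]]].
  by rewrite mem_filter mem_iota => /andP[/asboolP nk kK] ->; exists k.
exists k => //; rewrite mem_filter mem_iota /= add0n kK andbT.
by apply/asboolP.
Qed.

Lemma class_list_sum K x (P : pred (set X)) (u : set X -> R) :
  \sum_(c <- class_list K x | P c) u c =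
  \sum_(k < K | `[< new k x >] && P (nth_class k x)) u (nth_class k x).
Proof.
rewrite -(big_mkord (fun k => `[< new k x >] && P (nth_class k x)) (fun k => u (nth_class k x))).
by rewrite /index_iota subn0 big_map big_filter_cond.
Qed.

Lemma class_list_quotient K x y c : cR (y, x) -> c \in class_list K x ->
  quotient_classes cS cR y c.
Proof. by move=> yx /mem_class_listP[k [_ _ ->]]; exact: quotient_nth_class. Qed.

Section mass.
Context (N : set X) (xi : X -> set X -> R[i]) (p : nat -> X -> R).
Hypothesis gP : forall x, ~ N x -> forall y, cR (x, y) -> exists j, y = g j x.
Hypothesis xi1 : forall x, ~ N x -> l2norm (quotient_classes cS cR x) (xi x) = 1%E.
Hypothesis pE : forall x, ~ N x -> forall k, p k x = sqC (xi x (nth_class k x)).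
Hypothesis p0 : forall k x, 0 <= p k x.

(** The squared norm of [xi x] on the first [K] classes, when [p] is a measurable
    version of its squared coefficients. *)
Definition mass K x := \sum_(k < K) p k x * \1_(new k) x.

Definition color_mass K f c x :=
  \sum_(k < K) p k x * \1_(new k `&` g k @^-1` color_class f c) x.

Lemma class_sum_le1 x (s : seq (set X)) : ~ N x -> uniq s ->
  (forall c, c \in s -> quotient_classes cS cR x c) -> \sum_(c <- s) sqC (xi x c) <= 1.
Proof.
move=> nN us sQ; rewrite -(expr1n _ 2); apply: l2norm_sum_le us sQ => //.
by rewrite xi1.
Qed.

Lemma mass_list K x : ~ N x -> mass K x = \sum_(c <- class_list K x) sqC (xi x c).
Proof.
move=> nN; rewrite class_list_sum [RHS]big_mkcond /=; apply: eq_bigr => k _.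
rewrite andbT; case: asboolP => nk; first by rewrite indic_in// mulr1 pE.
by rewrite indic_notin// mulr0.
Qed.

Lemma mass_le1 K x : ~ N x -> mass K x <= 1.
Proof.
move=> nN; rewrite mass_list//; apply: class_sum_le1 (class_list_uniq _ _) _ => //.
move=> c; exact: (class_list_quotient (rel_refl hR x)).
Qed.

Lemma mass_mono K x : mass K x <= mass K.+1 x.
Proof. by rewrite /mass big_ord_recr /= lerDl mulr_ge0. Qed.

(** Finitely many classes carry almost all of the norm, and the generators reach
    each of them. *)
Lemma mass_exhausts x e : ~ N x -> 0 < e -> exists K, 1 - e < mass K x.
Proof.
move=> nN e0; have [s [us sQ se]] := l2norm1_sum_gt (xi1 nN) e0.
have [K HK] : exists K, forall c, c \in s -> c \in class_list K x.
  elim: s sQ {us se} => [|c s IH] sQ; first by exists 0%N.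
  have [K HK] := IH (fun c' cs => sQ c' (mem_behead (s := c :: s) cs)).
  have [z xz cz] := quotient_rep (sQ c (mem_head _ _)).
  have [k zk] := gP nN xz; have [l lk [nl cl_l]] := new_exists x k.
  exists (maxn K l.+1) => c'; rewrite inE => /predU1P[->|/HK /mem_class_listP[k' [k'K nk' ->]]].
    apply/mem_class_listP; exists l; split => //; first by rewrite leq_max ltnSn orbT.
    by rewrite cl_l cz zk.
  by apply/mem_class_listP; exists k'; split => //; rewrite leq_max k'K.
exists K; apply: lt_le_trans se _; rewrite mass_list//.
rewrite [leRHS](bigID (fun c => c \in s))/= -[leLHS]addr0; apply: lerD.
  rewrite -[leRHS]big_filter le_eqVlt; apply/orP; left; apply/eqP.
  apply: perm_big; apply: uniq_perm => //.
    by rewrite filter_uniq// class_list_uniq.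
  move=> c; rewrite mem_filter; apply/idP/andP => [cs|[]//].
  by split => //; exact: HK.
by apply: sumr_ge0 => c _; exact: sqC_ge0.
Qed.

Lemma color_mass_ge0 K f c x : 0 <= color_mass K f c x.
Proof. by apply: sumr_ge0 => k _; rewrite mulr_ge0. Qed.

Lemma sum_color_mass K f n x : (forall x, (f x < n)%N) ->
  \sum_(c < n) color_mass K f c x = mass K x.
Proof.
move=> fn; rewrite exchange_big /=; apply: eq_bigr => k _.
rewrite -mulr_sumr; congr (_ * _).
have [nk|nnk] := pselect (new k x); last first.
  by rewrite indic_notin// big1// => c _; rewrite indic_notin// => -[].
rewrite indic_in// (bigD1 (Ordinal (fn (g k x))))//= indic_in//.
rewrite big1 ?addr0// => c /eqP nc; rewrite indic_notin// => -[_ fc]; apply: nc.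
exact/val_inj.
Qed.

Lemma color_mass_le1 K f n c x : (forall x, (f x < n)%N) -> ~ N x -> (c < n)%N ->
  color_mass K f c x <= 1.
Proof.
move=> fn nN cn; apply: le_trans (mass_le1 K nN); rewrite -(sum_color_mass K x fn).
rewrite (bigD1 (Ordinal cn))//= lerDl sumr_ge0// => j _; exact: color_mass_ge0.
Qed.

Lemma color_mass_list K f c x (col : set X -> nat) : ~ N x ->
  (forall k, new k x -> col (nth_class k x) = f (g k x)) ->
  color_mass K f c x = \sum_(a <- class_list K x | col a == c) sqC (xi x a).
Proof.
move=> nN Hcol; rewrite class_list_sum [RHS]big_mkcond /=; apply: eq_bigr => k _.
case: asboolP => nk /=; last by rewrite indic_notin ?mulr0// => -[].
rewrite Hcol//; case: eqP => fk; first by rewrite indic_in ?mulr1 ?pE//; split.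
by rewrite indic_notin ?mulr0// => -[].
Qed.

(** The classes listed at [x] and at [y] have the same colour in both lists, since
    [f] is constant on them as far as they are reached. The vectors are close on
    the classes listed at [x], which costs [3 e]; the classes not listed at [y]
    carry at most [e] of the norm of [xi y]. *)
Lemma color_mass_diff K f n x y e : ~ N x -> ~ N y -> cR (x, y) -> 0 < e ->
  1 - e <= mass K y ->
  \sum_(c <- class_list K x) sqC (xi x c - xi y c) <= e ^+ 2 ->
  (forall k l, (k < K)%N -> (l < K)%N -> cS (g k x, g l y) -> f (g k x) = f (g l y)) ->
  \sum_(c < n) Num.max 0 (color_mass K f c x - color_mass K f c y) <= 4%:R * e.
Proof.
move=> nx ny Rxy e0 my dxy match_f.
(* the colour of a class as seen from [z] is that of the first point of it which
   is reached *)
have colP z : exists col : set X -> nat, forall k, new k z -> col (nth_class k z) = f (g k z).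
  have /choice[col Hcol] : forall c : set X, exists i, forall k, new k z -> c = nth_class k z -> i = f (g k z).
    move=> c; have [[k [nk ck]]|nk] := pselect (exists k, new k z /\ c = nth_class k z).
      exists (f (g k z)) => l nl cl'; congr (f (g _ z)); apply: new_inj nk nl _.
      by rewrite -ck.
    by exists 0%N => k nk' ck; exfalso; apply: nk; exists k.
  by exists col => k nk; exact: Hcol.
have [colx Hx] := colP x; have [coly Hy] := colP y.
under eq_bigr do rewrite (color_mass_list _ _ nx Hx) (color_mass_list _ _ ny Hy).
apply: le_trans (overlap_estimate _ (class_list_uniq K x) (class_list_uniq K y) _ _ _) _.
- by move=> c; exact: sqC_ge0.
- by move=> c; exact: sqC_ge0.
- move=> c /mem_class_listP[k [kK nk ck]] /mem_class_listP[l [lK nl cl']].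
  rewrite {1}ck Hx// cl' Hy//; apply: match_f => //.
  by apply: rclass_eqP; rewrite -/(nth_class k x) -ck cl'.
have Ryx := rel_sym hR Rxy.
have hp : \sum_(c <- class_list K x) sqC (xi x c) <= 1.
  apply: class_sum_le1 (class_list_uniq _ _) _ => //.
  by move=> c; exact: (class_list_quotient (rel_refl hR x)).
have hq : \sum_(c <- class_list K x) sqC (xi y c) <= 1.
  apply: class_sum_le1 (class_list_uniq _ _) _ => //.
  by move=> c; exact: class_list_quotient.
have h1 : \sum_(c <- class_list K x) `|sqC (xi x c) - sqC (xi y c)| <= 3%:R * e.
  apply: (@le_trans _ _ (\sum_(c <- class_list K x)
    (sqC (xi x c - xi y c) / e + e * (sqC (xi x c) + sqC (xi y c))))).
    by apply: ler_sum => c _; exact: sqC_diff.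
  have -> (a b b' : set X -> R) : \sum_(c <- class_list K x) (a c / e + e * (b c + b' c)) =
      (\sum_(c <- class_list K x) a c) / e + e * (\sum_(c <- class_list K x) b c +
      \sum_(c <- class_list K x) b' c).
    by rewrite big_split /= -mulr_suml -mulr_sumr big_split.
  have : (\sum_(c <- class_list K x) sqC (xi x c - xi y c)) / e <= e.
    by rewrite ler_pdivrMr// -expr2.
  have : e * (\sum_(c <- class_list K x) sqC (xi x c) + \sum_(c <- class_list K x) sqC (xi y c))
    <= e * 2%:R by rewrite ler_pM2l//; lra.
  by lra.
have h2 : \sum_(c <- class_list K x | c \notin class_list K y) sqC (xi y c) <= e.
  have : \sum_(c <- [seq c <- class_list K x | c \notin class_list K y] ++ class_list K y)
      sqC (xi y c) <= 1.
    apply: class_sum_le1 => //.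
      rewrite cat_uniq filter_uniq ?class_list_uniq// andbT /=.
      apply/hasPn => c cy; rewrite mem_filter; by rewrite cy.
    move=> c; rewrite mem_cat mem_filter => /orP[/andP[_]|].
      exact: class_list_quotient.
    exact: (class_list_quotient (rel_refl hR y)).
  by rewrite big_cat /= big_filter -(mass_list K ny); lra.
lra.
Qed.

End mass.

End class_functions.

(** * Measurable versions of the families *)

Section versions.
Context d (X : measurableType d) (R : realType) (mu : probability X R).
Local Notation m := (pm mu).
Hypothesis hX : standard_borel R X.
Context (cS cR : set (X * X)).
Hypothesis hR : dmp_equivalence mu cR.
Context (g : nat -> X -> X).
Hypothesis gI : forall j, rel_involution cR (g j).
Local Notation nth_class := (nth_class cS g).

Lemma involution_comp_full h k : rel_involution cR h -> rel_involution cR k ->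
  full_group setT mu cR (h \o k).
Proof.
move=> [mh hh hRh] [mk kk kR]; split.
- split => // [x y _ _ /(congr1 h)|y _]; first by rewrite /= !hh => /(congr1 k); rewrite !kk.
  by exists (k (h y)) => //=; rewrite kk hh.
- exact: measurableT_comp.
- move=> B mB _; rewrite (_ : _ @` B = (k \o h) @^-1` B).
    by apply: measurable_preim => //; exact: measurableT_comp.
  apply/seteqP; split => y; first by move=> [x Bx <-] /=; rewrite hh kk.
  by move=> By; exists (k (h y)) => //=; rewrite kk hh.
- apply: aeW => x _; rewrite /rclass /=; exact: (rel_trans hR (kR x) (hRh (k x))).
Qed.

Lemma involution_full h : rel_involution cR h -> full_group setT mu cR h.
Proof.
move=> hI; have idI : rel_involution cR id by split => //; exact: (rel_refl hR).
by rewrite -[h]/(h \o id); exact: involution_comp_full.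
Qed.

Context (xi : X -> set X -> R[i]).
Hypothesis xiM : measurable_l2_family mu cS cR xi.

Lemma measurable_mass_version : exists (p : nat -> X -> R) N,
  [/\ forall k, measurable_fun setT (p k), forall k x, 0 <= p k x,
      measurable N, m N = 0 &
      forall x, ~ N x -> forall k, p k x = sqC (xi x (nth_class k x))].
Proof.
have H k : exists (pN : (X -> R) * set X), [/\ measurable_fun setT pN.1,
    forall x, 0 <= pN.1 x, measurable pN.2, m pN.2 = 0 &
    forall x, ~ pN.2 x -> pN.1 x = sqC (xi x (nth_class k x))].
  have [_ _ /(_ _ (involution_full (gI k)))] := xiM.
  move=> [[a ma /ae_null[N1 [mN1 N10 a1]]] [b mb /ae_null[N2 [mN2 N20 b1]]]].
  exists ((fun x => a x ^+ 2 + b x ^+ 2), N1 `|` N2) => /=; split.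
  - by apply: measurable_funD; exact: measurable_funX.
  - by move=> x; rewrite addr_ge0 ?sqr_ge0.
  - exact: measurableU.
  - exact: pm_U_null.
  - move=> x nN; rewrite -a1 -?b1// => ?; apply: nN; [by right|by left].
have /choice[F HF] := H.
exists (fun k => (F k).1), [set x | exists k, (F k).2 x]; split.
- by move=> k; case: (HF k).
- by move=> k; case: (HF k).
- by apply: measurable_cexists => k; case: (HF k).
- by apply: pm_cexists_null => k; case: (HF k).
- by move=> x nN k; have [_ _ _ _] := HF k; apply => Nx; apply: nN; exists k.
Qed.

(** The class of [g k x] is seen from [ga x] through the composite of [g k] and
    [ga], another element of the full group. *)
Lemma measurable_gap_version ga : rel_involution cR ga -> exists (p : nat -> X -> R) N,
  [/\ forall k, measurable_fun setT (p k), forall k x, 0 <= p k x,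
      measurable N, m N = 0 &
      forall x, ~ N x -> forall k, p k x = sqC (xi x (nth_class k x) - xi (ga x) (nth_class k x))].
Proof.
move=> gaI; have [mga gga gaR] := gaI.
have H k : exists (pN : (X -> R) * set X), [/\ measurable_fun setT pN.1,
    forall x, 0 <= pN.1 x, measurable pN.2, m pN.2 = 0 &
    forall x, ~ pN.2 x -> pN.1 x = sqC (xi x (nth_class k x) - xi (ga x) (nth_class k x))].
  have [_ _ xiM'] := xiM.
  have := xiM' _ (involution_full (gI k)).
  move=> [[a ma /ae_null[N1 [mN1 N10 a1]]] [b mb /ae_null[N2 [mN2 N20 b1]]]].
  have := xiM' _ (involution_comp_full (gI k) gaI).
  move=> [[a' ma' /ae_null[N1' [mN1' N10' a1']]] [b' mb' /ae_null[N2' [mN2' N20' b1']]]].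
  have mU : measurable (N1' `|` N2') by exact: measurableU.
  have mgU : measurable (ga @^-1` (N1' `|` N2')) by exact: measurable_preim.
  have mU2 : measurable (N1 `|` N2) by exact: measurableU.
  exists ((fun x => (a x - a' (ga x)) ^+ 2 + (b x - b' (ga x)) ^+ 2),
    (N1 `|` N2) `|` ga @^-1` (N1' `|` N2')) => /=; split.
  - by apply: measurable_funD; apply: measurable_funX; apply: measurable_funB => //;
      exact: measurableT_comp.
  - by move=> x; rewrite addr_ge0 ?sqr_ge0.
  - exact: measurableU.
  - apply: pm_U_null => //; first exact: pm_U_null.
    by rewrite (involution_pm hX hR gaI mU); exact: pm_U_null.
  - move=> x nN.
    have e1 : a x = complex.Re (xi x (nth_class k x)).
      by rewrite -a1// => ?; apply: nN; left; left.
    have e2 : b x = complex.Im (xi x (nth_class k x)).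
      by rewrite -b1// => ?; apply: nN; left; right.
    have e3 : a' (ga x) = complex.Re (xi (ga x) (nth_class k x)).
      rewrite -a1'; first by rewrite /= gga.
      by move=> ?; apply: nN; right; left.
    have e4 : b' (ga x) = complex.Im (xi (ga x) (nth_class k x)).
      rewrite -b1'; first by rewrite /= gga.
      by move=> ?; apply: nN; right; right.
    rewrite e1 e2 e3 e4 /sqC.
    by case: (xi x (nth_class k x)) => u v; case: (xi (ga x) (nth_class k x)) => u' v'.
have /choice[F HF] := H.
exists (fun k => (F k).1), [set x | exists k, (F k).2 x]; split.
- by move=> k; case: (HF k).
- by move=> k; case: (HF k).
- by apply: measurable_cexists => k; case: (HF k).
- by apply: pm_cexists_null => k; case: (HF k).
- by move=> x nN k; have [_ _ _ _] := HF k; apply => Nx; apply: nN; exists k.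
Qed.

Lemma measurable_ge_set (h : X -> R) c : measurable_fun setT h -> measurable [set x | c <= h x].
Proof.
move=> mh; rewrite (_ : mkset _ = h @^-1` [set` `[c, +oo[]).
  by apply: measurable_preim => //; exact: measurable_itv.
by apply/seteqP; split => x /=; rewrite in_itv /= andbT.
Qed.

Lemma measurable_gt_set (h : X -> R) c : measurable_fun setT h -> measurable [set x | c < h x].
Proof.
move=> mh; rewrite (_ : mkset _ = h @^-1` [set` `]c, +oo[]).
  by apply: measurable_preim => //; exact: measurable_itv.
by apply/seteqP; split => x /=; rewrite in_itv /= andbT.
Qed.

Lemma measurable_weighted_sum K (p : nat -> X -> R) (A : nat -> set X) :
  (forall k, measurable_fun setT (p k)) -> (forall k, measurable (A k)) ->
  measurable_fun setT (fun x => \sum_(k < K) p k x * \1_(A k) x).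
Proof.
by move=> mp mA; apply: measurable_sum => k; apply: measurable_funM => //;
  apply: measurable_indic.
Qed.

End versions.

(** * Families of vectors from coamenability *)

Section good_families.
Context d (X : measurableType d) (R : realType) (mu : probability X R).
Local Notation m := (pm mu).
Hypothesis hX : standard_borel R X.
Context (cS cR : set (X * X)).
Hypothesis hS : dmp_equivalence mu cS.
Hypothesis hR : dmp_equivalence mu cR.
Hypothesis hSR : cS `<=` cR.
Context (g : nat -> X -> X).
Hypothesis gI : forall j, rel_involution cR (g j).
Hypothesis gP : {ae mu, forall x, forall y, cR (x, y) -> exists j, y = g j x}.
Local Notation nth_class := (nth_class cS g).
Local Notation new := (new cS g).

Let mg j : measurable_fun setT (g j). Proof. by case: (gI j). Qed.

(** One measurable family of unit vectors, as seen from finitely many involutions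
    [ga]: off a set of mass [e], the first [K] classes carry almost all of the
    vectors at [x] and at its neighbours, and these vectors almost agree there. *)
Definition good_family L (ga : nat -> X -> X) (e : R) :=
  exists (xi : X -> set X -> R[i]) (p : nat -> X -> R) (N G : set X) (K : nat),
  [/\ [/\ forall k, measurable_fun setT (p k), forall k x, 0 <= p k x,
        measurable N, m N = 0 & measurable G],
      m (~` G) <= e,
      forall x, ~ N x -> l2norm (quotient_classes cS cR x) (xi x) = 1%E,
      forall x, ~ N x -> forall k, p k x = sqC (xi x (nth_class k x)) &
      forall x, G x -> [/\ ~ N x, 1 - e <= mass cS g p K x &
        forall i, (i < L)%N -> [/\ ~ N (ga i x), 1 - e <= mass cS g p K (ga i x) &
          \sum_(c <- class_list cS g K x) sqC (xi x c - xi (ga i x) c) <= e ^+ 2]]].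

(** Almost everywhere convergence becomes uniform off a set of small mass, which
    fixes the index of the family; then [K] is taken so large that the classes
    left out carry little, both at [x] and at its neighbours. *)
Lemma coamenable_good_family L ga (e : R) : coamenable mu cS cR ->
  (forall i, rel_involution cR (ga i)) -> 0 < e -> good_family L ga e.
Proof.
move=> [xi [xiM xi1 xiC]] gaI e0.
have mga i : measurable_fun setT (ga i) by case: (gaI i).
have gaR i x : cR (x, ga i x) by case: (gaI i).
have [N1 [mN1 N10 N1P]] := ae_null gP.
have /choice[N2 HN2] := fun n => ae_null (xi1 n).
have /choice[p /choice[N3 HN3]] := fun n => measurable_mass_version hR gI (xiM n).
have /choice[q /choice[N4 HN4]] : forall ni : nat * nat, exists p N, _ :=
  fun ni => measurable_gap_version hX hR gI (xiM ni.1) (gaI ni.2).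
have [N5 [mN5 N50 N5P]] := xiC.
pose B i := [set x | N5 (x, ga i x)].
have mB i : measurable (B i).
  by apply: (measurable_rel (f := id) (g := ga i) mN5).
have B0 i : m (B i) = 0.
  have : (mu (B i) <= mu_rel mu cR N5)%E.
    by apply: mu_rel_ge1 => // x Bx; exists (ga i x).
  rewrite N50 pmE// lee_fin => Ble; apply/eqP; rewrite eq_le Ble; exact: pm_ge0.
pose N0 := (N1 `|` [set x | exists n, N2 n x]) `|` ([set x | exists n, N3 n x] `|`
  ([set x | exists ni, N4 ni x] `|` [set x | exists i, B i x])).
have mN2 : measurable [set x | exists n, N2 n x].
  by apply: measurable_cexists => n; case: (HN2 n).
have mN3 : measurable [set x | exists n, N3 n x].
  by apply: measurable_cexists => n; case: (HN3 n).
have mN4 : measurable [set x | exists n, N4 n x].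
  by apply: measurable_cexists => n; case: (HN4 n).
have mBB : measurable [set x | exists i, B i x] by exact: measurable_cexists.
have mN0 : measurable N0 by repeat apply: measurableU => //.
have N00 : m N0 = 0.
  rewrite /N0; repeat (apply: pm_U_null; try by repeat apply: measurableU) => //;
  apply: pm_cexists_null => //.
  - by move=> n; case: (HN2 n).
  - by move=> n; case: (HN2 n).
  - by move=> n; case: (HN3 n).
  - by move=> n; case: (HN3 n).
  - by move=> n; case: (HN4 n).
  - by move=> n; case: (HN4 n).
pose N := N0 `|` [set x | exists i, N0 (ga i x)].
have mNga : measurable [set x | exists i, N0 (ga i x)].
  by apply: measurable_cexists => i; exact: (measurable_preim (mga i) mN0).
have mN : measurable N by exact: measurableU.
have Nz : m N = 0.
  apply: pm_U_null => //; apply: pm_cexists_null => i.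
    exact: (measurable_preim (mga i) mN0).
  by rewrite -N00 -(involution_pm hX hR (gaI i) mN0).
have f1 x : ~ N0 x -> forall y, cR (x, y) -> exists j, y = g j x.
  by move=> nN; apply: N1P => ?; apply: nN; left; left.
have f2 x : ~ N0 x -> forall n, l2norm (quotient_classes cS cR x) (xi n x) = 1%E.
  by move=> nN n; have [_ _] := HN2 n; apply => ?; apply: nN; left; right; exists n.
have f3 x : ~ N0 x -> forall n k, p n k x = sqC (xi n x (nth_class k x)).
  by move=> nN n; have [_ _ _ _] := HN3 n; apply => ?; apply: nN; right; left; exists n.
have f4 x : ~ N0 x -> forall n i k, q (n, i) k x = sqC (xi n x (nth_class k x) - xi n (ga i x) (nth_class k x)).
  move=> nN n i; have [_ _ _ _] := HN4 (n, i); apply => ?; apply: nN.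
  by right; right; left; exists (n, i).
have f5 x : ~ N0 x -> forall i, (fun n => l2norm (quotient_classes cS cR x)
     (fun c => xi n x c - xi n (ga i x) c)) @ \oo --> 0%E.
  move=> nN i; have nB : ~ N5 (x, ga i x).
    by move=> ?; apply: nN; right; right; right; exists i.
  by apply: contrapT => nc; apply: nB; apply: N5P => /= H; apply: nc; exact: H.
pose gap n i K x := \sum_(k < K) q (n, i) k x * \1_(new k) x.
have mnew k : measurable (new k) by exact: (measurable_new hS).
have mgap n i K : measurable_fun setT (gap n i K).
  by apply: measurable_weighted_sum => // k; case: (HN4 (n, i)).
have gapE n i K x : ~ N0 x ->
    gap n i K x = \sum_(c <- class_list cS g K x) sqC (xi n x c - xi n (ga i x) c).
  move=> nN; rewrite class_list_sum [RHS]big_mkcond /=; apply: eq_bigr => k _.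
  rewrite andbT; case: asboolP => nk; first by rewrite indic_in// mulr1 f4.
  by rewrite indic_notin// mulr0.
pose bad n := [set x | exists i, (i < L)%N /\ exists K, e ^+ 2 < gap n i K x].
have mbad n : measurable (bad n).
  apply: measurable_cexists => i; apply: measurable_andP => _.
  apply: measurable_cexists => K; exact: measurable_gt_set.
pose W n := [set x | exists n', (n <= n')%N /\ bad n' x].
have mW n : measurable (W n).
  by apply: measurable_cexists => n'; apply: measurable_andP.
have WS n : W n.+1 `<=` W n.
  by move=> x [n' [nn' bx]]; exists n'; split => //; exact: ltnW.
have e4 : 0 < e / 4%:R by rewrite divr_gt0.
have [n Hn] := pm_down mu mW WS e4.
have W0 : m (\bigcap_n W n) = 0.
  apply: pm_null_sub mN0 _ N00; first exact: bigcapT_measurable.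
  move=> x Wx; apply: contrapT => nN.
  have ev i : exists n0, forall n, (n0 <= n)%N -> forall K, gap n i K x <= e ^+ 2.
    have cv := f5 x nN i.
    have [[a _ fina] /cvgrPdist_lt/(_ e e0)[b _ Hb]] := (fine_cvgP _ _).1 cv.
    exists (maxn a b) => n'; rewrite geq_max => /andP[an bn] K; rewrite gapE//.
    have le : (l2norm (quotient_classes cS cR x)
        (fun c => (xi n' x c - xi n' (ga i x) c)%R) <= e%:E)%E.
      rewrite -(fineK (fina n' an)) lee_fin; have := Hb n' bn.
      by rewrite /= sub0r normrN => /ltW; apply: le_trans; exact: ler_norm.
    apply: l2norm_sum_le le (class_list_uniq hS _ K x) _; first exact: ltW.
    by move=> c; exact: (class_list_quotient hR hSR gI (rel_refl hR x)).
  have [n0 Hn0] := eventually_all_lt ev L.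
  have [n' [n0n' [i [iL [K]]]]] := Wx n0 I.
  by rewrite ltNge Hn0.
have bad4 : m (bad n) <= e / 4%:R.
  rewrite W0 add0r in Hn; apply: le_trans (ltW Hn); apply: pm_mono => // x bx.
  by exists n.
pose T K := [set x | ~ (1 - e <= mass cS g (p n) K x)].
have [mp p0 _ _ _] := HN3 n.
have mT K : measurable (T K).
  apply: measurableC; apply: measurable_ge_set.
  exact: measurable_weighted_sum.
have TS K : T K.+1 `<=` T K.
  by move=> x nT mT'; apply: nT; apply: le_trans mT' _; exact: mass_mono.
have L0 : 0 < 4%:R * L.+1%:R :> R by rewrite mulr_gt0.
have eL : 0 < e / (4%:R * L.+1%:R) by rewrite divr_gt0.
have [K HK] := pm_down mu mT TS eL.
have T0 : m (\bigcap_K T K) = 0.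
  apply: pm_null_sub mN0 _ N00; first exact: bigcapT_measurable.
  move=> x Tx; apply: contrapT => nN.
  have [K' HK'] := mass_exhausts hS f1 (fun x nN => f2 x nN n) (fun x nN => f3 x nN n) nN e0.
  by apply: (Tx K') => //; exact: ltW.
rewrite T0 add0r in HK.
pose T' := [set x | exists i, (i < L)%N /\ (ga i @^-1` T K) x].
have mpre i : measurable (ga i @^-1` T K) by exact: measurable_preim.
have mT' : measurable T'.
  by apply: measurable_cexists => i; apply: measurable_andP.
have T'le : m T' <= L%:R * m (T K).
  by apply: pm_exists_lt => // i _; rewrite (involution_pm hX hR (gaI i)).
have TLe : m (T K) + L%:R * m (T K) <= e / 4%:R.
  have -> : m (T K) + L%:R * m (T K) = m (T K) * L.+1%:R by rewrite -[L.+1%:R]natr1; ring.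
  rewrite -ler_pdivlMr ?ltr0n//; apply: le_trans (ltW HK) _.
  by rewrite invfM mulrA.
pose G := ~` ((bad n `|` N) `|` (T K `|` T')).
have mbN : measurable (bad n `|` N) by exact: measurableU.
have mTT : measurable (T K `|` T') by exact: measurableU.
have mG : measurable G by apply: measurableC; exact: measurableU.
exists (xi n), (p n), N0, G, K; split => //.
- rewrite /G setCK; apply: le_trans (pm_U _ _ _) _ => //.
  have := pm_U mu (mbad n) mN; have := pm_U mu (mT K) mT'; rewrite Nz.
  by lra.
- by move=> x nN; exact: f2.
- by move=> x nN; exact: f3.
move=> x Gx.
have nN0 : ~ N0 x by move=> ?; apply: Gx; left; right; left.
split => //.
  by apply: contrapT => ?; apply: Gx; right; left.
move=> i iL; split.
- by move=> ?; apply: Gx; left; right; right; exists i.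
- by apply: contrapT => ?; apply: Gx; right; right; exists i.
rewrite -gapE// leNgt; apply/negP => lt; apply: Gx; left; left.
by exists i; split => //; exists K.
Qed.

End good_families.

(** * Excluding the colorings with small classes *)

Section contradiction.
Context d (X : measurableType d) (R : realType) (mu : probability X R).
Local Notation m := (pm mu).
Local Notation bd := (escape_mass mu).
Hypothesis hX : standard_borel R X.
Context (cS cR : set (X * X)).
Hypothesis hS : dmp_equivalence mu cS.
Hypothesis hR : dmp_equivalence mu cR.
Hypothesis hSR : cS `<=` cR.
Context (g s : nat -> X -> X).
Hypothesis gI : forall j, rel_involution cR (g j).
Hypothesis sI : forall j, rel_involution cS (s j).
Hypothesis sP : {ae mu, forall x, forall y, cS (x, y) -> exists j, y = s j x}.
Local Notation nth_class := (nth_class cS g).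
Local Notation new := (new cS g).

Let mg j : measurable_fun setT (g j). Proof. by case: (gI j). Qed.
Let ms j : measurable_fun setT (s j). Proof. by case: (sI j). Qed.

(** Off this set, a class that is reached from [x] and from a neighbour of [x]
    has the same colour from both, as [color_mass_diff] requires. *)
Definition mismatch L (ga : nat -> X -> X) K (f : X -> nat) :=
  [set x | exists i, (i < L)%N /\ exists k, (k < K)%N /\ exists l, (l < K)%N /\
     (cS (g k x, g l (ga i x)) /\ f (g k x) <> f (g l (ga i x)))].

Lemma measurable_mismatch L ga K f : (forall i, rel_involution cR (ga i)) ->
  (forall i, measurable (color_class f i)) -> measurable (mismatch L ga K f).
Proof.
move=> gaI mf.
have mga i : measurable_fun setT (ga i) by case: (gaI i).
apply: measurable_cexists => i; apply: measurable_andP => _.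
apply: measurable_cexists => k; apply: measurable_andP => _.
apply: measurable_cexists => l; apply: measurable_andP => _.
have mgl : measurable_fun setT (g l \o ga i) by exact: measurableT_comp.
apply: (@measurableI _ _ [set x | cS (g k x, (g l \o ga i) x)]).
  by apply: (measurable_rel (rel_measurable hS)).
rewrite (_ : (fun x => _) = ~` [set x | exists c,
    (g k @^-1` color_class f c `&` (g l \o ga i) @^-1` color_class f c) x]).
  apply: measurableC; apply: measurable_cexists => c.
  by apply: measurableI; exact: measurable_preim.
apply/seteqP; split => x /= H.
  by case=> c [fk fl]; apply: H; rewrite fk fl.
by move=> fkl; apply: H; exists (f (g k x)); split.
Qed.

(** Two [cS]-related points among the finitely many reached ones are exchanged by
    one of the first [J] generators of [cS], off a set of small mass, and [f] is
    almost invariant under these generators. *)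
Lemma small_mismatch L ga K (e : R) : (forall i, rel_involution cR (ga i)) -> 0 < e ->
  exists k0, forall n f, coloring mu s k0 n f -> m (mismatch L ga K f) <= e.
Proof.
move=> gaI e0.
have mga i : measurable_fun setT (ga i) by case: (gaI i).
have [U [mU sU]] := standard_borel_separating hX.
have [N [mN N0 NP]] := ae_null sP.
pose late J := [set x | exists i, (i < L)%N /\ exists k, (k < K)%N /\ exists l, (l < K)%N /\
     (cS (g k x, (g l \o ga i) x) /\ forall j, (j < J)%N -> (g l \o ga i) x <> s j (g k x))].
have mlate J : measurable (late J).
  apply: measurable_cexists => i; apply: measurable_andP => _.
  apply: measurable_cexists => k; apply: measurable_andP => _.
  apply: measurable_cexists => l; apply: measurable_andP => _.
  have mgl : measurable_fun setT (g l \o ga i) by exact: measurableT_comp.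
  apply: (@measurableI _ _ [set x | cS (g k x, (g l \o ga i) x)]).
    by apply: (measurable_rel (rel_measurable hS)).
  apply: measurable_cforall => j; apply: measurable_imp => _.
  rewrite (_ : (fun x => _) = ~` [set x | (g l \o ga i) x = (s j \o g k) x]) //.
  by apply: measurableC; apply: (measurable_eq mU sU) => //; exact: measurableT_comp.
have lateS J : late J.+1 `<=` late J.
  move=> x [i [iL [k [kK [l [lK [Sx H]]]]]]].
  exists i; split => //; exists k; split => //; exists l; split => //; split => //.
  by move=> j jJ; apply: H; exact: ltnW.
have e2 : 0 < e / 2%:R by rewrite divr_gt0.
have [J HJ] := pm_down mu mlate lateS e2.
have late0 : m (\bigcap_J late J) = 0.
  apply: (@pm_null_sub _ _ _ _ _ [set x | exists k, N (g k x)]).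
  - exact: bigcapT_measurable.
  - by apply: measurable_cexists => k; exact: (measurable_preim (mg k) mN).
  - move=> x lx; apply: contrapT => nN.
    have ev i : exists n0, forall n, (n0 <= n)%N -> forall k, (k < K)%N -> forall l, (l < K)%N ->
       cS (g k x, g l (ga i x)) -> exists2 j, (j < n)%N & g l (ga i x) = s j (g k x).
      apply: eventually_all_lt => k.
      have ev' l : exists n0, forall n, (n0 <= n)%N ->
         cS (g k x, g l (ga i x)) -> exists2 j, (j < n)%N & g l (ga i x) = s j (g k x).
        have [H|nH] := pselect (cS (g k x, g l (ga i x))); last by exists 0%N.
        have [|j Hj] := NP (g k x) _ _ H; first by move=> Nx; apply: nN; exists k.
        by exists j.+1 => n jn _; exists j.
      have [n0 Hn0] := eventually_all_lt ev' K.
      by exists n0 => n n0n l lK; exact: Hn0.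
    have [n0 Hn0] := eventually_all_lt ev L.
    have [i [iL [k [kK [l [lK [Sx H]]]]]]] := lx n0 I.
    have [j jn0] := Hn0 n0 (leqnn _) i iL k kK l lK Sx.
    exact: H.
  - apply: pm_cexists_null => k; first exact: (measurable_preim (mg k) mN).
    by rewrite -N0 -(involution_pm hX hR (gI k) mN).
rewrite late0 add0r in HJ.
have KJ0 : 0 < (K * J).+1%:R :> R by rewrite ltr0n.
have e3 : 0 < e / 2%:R / (K * J).+1%:R by rewrite divr_gt0.
have [k1 Hk1] := inv_natS_lt e3.
exists (k1 + J)%N => n f [mf fn cf].
pose ch := [set x | exists k, (k < K)%N /\ [set x | exists j, (j < J)%N /\
  (g k @^-1` color_change (s j) f) x] x].
have mcc j : measurable (color_change (s j) f) by exact: measurable_color_change.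
have mpre k j : measurable (g k @^-1` color_change (s j) f) by exact: measurable_preim.
have mch' k : measurable [set x | exists j, (j < J)%N /\ (g k @^-1` color_change (s j) f) x].
  by apply: measurable_cexists => j; apply: measurable_andP.
have mch : measurable ch.
  by apply: measurable_cexists => k; apply: measurable_andP.
have inv_le : ((k1 + J).+1%:R^-1 : R) <= k1.+1%:R^-1 by apply: inv_natS_le; exact: leq_addr.
have chle : m ch <= K%:R * (J%:R * (k1 + J).+1%:R^-1).
  apply: pm_exists_lt => // k _; apply: pm_exists_lt => // j jJ.
  rewrite (involution_pm hX hR (gI k))//; apply: cf.
  by apply: leq_trans (ltnW jJ) _; exact: leq_addl.
have : m (mismatch L ga K f) <= m (late J) + m ch.
  apply: pm_subU => //; first exact: measurable_mismatch.
  move=> x [i [iL [k [kK [l [lK [Sx fx]]]]]]].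
  have [[j jJ Hj]|nj] := pselect (exists2 j, (j < J)%N & g l (ga i x) = s j (g k x)).
    right; exists k; split => //; exists j; split => //=.
    by rewrite /color_change /= -Hj => fe; apply: fx; rewrite fe.
  left; exists i; split => //; exists k; split => //; exists l; split => //; split => //.
  by move=> j jJ Hj; apply: nj; exists j.
have : K%:R * (J%:R * (k1 + J).+1%:R^-1) <= e / 2%:R.
  apply: (@le_trans _ _ ((K * J).+1%:R * (e / 2%:R / (K * J).+1%:R))); last first.
    by rewrite mulrC divfK// gt_eqF.
  rewrite mulrA -natrM; apply: ler_pM => //.
    by rewrite ler_nat.
  exact: le_trans inv_le (ltW Hk1).
move: chle HJ; move: (K%:R * (J%:R * _)) => t h1 h2 h3 h4; lra.
Qed.

(** The sum over all colours [c] and levels [q] of the expansion inequalities for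
    the sets where [Q * F c x] reaches the level [q + 1]. Their masses sum up to
    almost [Q], and each of them is small; their boundaries sum up to a small
    multiple of [Q]. The constants are chosen in the order [e] (from the expansion),
    [K] (from the family), the coloring with [n] colours, and finally [Q] so large
    that the rounding error 1 per colour is negligible. *)
Lemma coloring_contradiction L (ga : nat -> X -> X) (C : R) :
  (forall i, rel_involution cR (ga i)) -> 0 < C ->
  (forall A, measurable A -> m A * (1 - m A) <= C * bdsum mu L ga A) ->
  (forall e, 0 < e -> good_family mu cS cR g L ga e) ->
  (forall k e, 0 < e -> exists n f, coloring mu s k n f /\
     forall i, m (color_class f i) <= e) -> False.
Proof.
move=> gaI C0 cheeger good col.
have mga i : measurable_fun setT (ga i) by case: (gaI i).
have gaR i x : cR (x, ga i x) by case: (gaI i).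
have CL0 : 0 <= C * L%:R by rewrite mulr_ge0// ltW.
(* with [e = 1 / D], the inequality to be contradicted at the end reads
   [(1 - e) * (1 - 2 e) ^+ 2 <= 7 * C * L * e]: the left side is at least 1/2,
   the right side is less *)
pose D := 16%:R + 24%:R * (C * L%:R).
have D0 : 0 < D by rewrite /D; lra.
pose e : R := D^-1; have e0 : 0 < e by rewrite invr_gt0.
have De : D * e = 1 by rewrite mulfV// gt_eqF.
have e16 : 16%:R * e <= 1.
  have : 0 <= 24%:R * (C * L%:R) * e by rewrite mulr_ge0 ?mulr_ge0// ltW.
  by move: De; rewrite /D mulrDl; lra.
have eCL : 24%:R * (C * L%:R) * e < 1 by move: De; rewrite /D mulrDl; lra.
have [xi [p [N [G [K [[mp p0 mN N0 mG] Gle xi1 pE HG]]]]]] := good e e0.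
have [k0 Hk0] := small_mismatch L K gaI e0.
have K0 : 0 < K.+1%:R :> R by rewrite ltr0n.
have [n [f [colf fle]]] := col k0 (e / K.+1%:R) (divr_gt0 e0 K0).
have mism := Hk0 _ _ colf.
have [mf fn cf] := colf.
have mmis := measurable_mismatch L K gaI mf.
pose F c x := color_mass cS g p K f c x.
have mF c : measurable_fun setT (F c).
  apply: (measurable_weighted_sum K (p := p)
    (A := fun k => new k `&` g k @^-1` color_class f c)) => // k.
  apply: measurableI; first exact: (measurable_new hS).
  exact: (measurable_preim (mg k) (mf c)).
have F0 c x : 0 <= F c x by exact: color_mass_ge0.
pose Q := Num.bound (n%:R / e).
have nQ : n%:R <= Q%:R * e.
  rewrite -ler_pdivrMr//; apply: ltW; apply: archi_boundP.
  by rewrite divr_ge0// ltW.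
have Q0' : 0 <= Q%:R :> R by [].
have Q0 : 0 < Q%:R :> R.
  have : 0 <= n%:R / e by rewrite divr_ge0// ltW.
  by move/archi_boundP; apply: le_lt_trans; rewrite divr_ge0// ltW.
pose E (cq : 'I_n * 'I_Q) := [set x | cq.2.+1%:R <= Q%:R * F cq.1 x].
have mE cq : measurable (E cq).
  by apply: measurable_ge_set; apply: measurable_funM => //; exact: measurable_cst.
pose G' := G `\` mismatch L ga K f.
have mG' : measurable G' by exact: measurableD.
have G'le : m (~` G') <= 2%:R * e.
  apply: le_trans (_ : m (~` G) + m (mismatch L ga K f) <= _); last by lra.
  apply: pm_subU => //; [exact: measurableC|exact: measurableC|].
  by move=> x nG; apply: contrapT => H; apply: nG; split;
    [apply: contrapT => ?; apply: H; left|move=> ?; apply: H; right].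
have F1 c x : ~ N x -> (c < n)%N -> F c x <= 1.
  by move=> nN cn; exact: (color_mass_le1 hS hR hSR gI xi1 pE p0 K fn nN cn).
have QF1 c x : ~ N x -> (c < n)%N -> Q%:R * F c x <= Q%:R.
  by move=> nN cn; rewrite -[leRHS]mulr1 ler_pM2l//; exact: F1.
have QF0 c x : 0 <= Q%:R * F c x by rewrite mulr_ge0.
have sumF x : \sum_(c < n) F c x = mass cS g p K x by exact: sum_color_mass.
have mass1 x : ~ N x -> mass cS g p K x <= 1.
  by move=> nN; exact: (mass_le1 hS hR hSR gI xi1 pE K nN).
have indE (cq : 'I_n * 'I_Q) x : \1_(E cq) x = (cq.2.+1%:R <= Q%:R * F cq.1 x :> R)%:R :> R.
  by case: (boolP (_ <= _)) => H; [rewrite indic_in|rewrite indic_notin//; apply/negP].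
have sumE x : \sum_cq \1_(E cq) x = \sum_(c < n) levels Q (Q%:R * F c x).
  rewrite /levels pair_big /=; apply: eq_bigr => cq _; exact: indE.
(* [F c] vanishes unless one of the first [K] moves reaches the colour [c] *)
have Esmall cq : m (E cq) <= e.
  apply: (@le_trans _ _ (m [set x | exists k, (k < K)%N /\ (g k @^-1` color_class f cq.1) x])).
    apply: pm_mono => //.
      apply: measurable_cexists => k; apply: measurable_andP => _.
      exact: (measurable_preim (mg k) (mf _)).
    move=> x Ex; apply: contrapT => nk.
    have F00 : F cq.1 x = 0.
      rewrite /F /color_mass big1// => k _; rewrite indic_notin ?mulr0// => -[_ fk].
      by apply: nk; exists k.
    by move: Ex; rewrite /E /= F00 mulr0 leNgt ltr0n.
  apply: (@le_trans _ _ (K%:R * (e / K.+1%:R))).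
    apply: pm_exists_lt => [k|k _]; first exact: (measurable_preim (mg k) (mf _)).
    rewrite (involution_pm hX hR (gI k))//; exact: fle.
  rewrite mulrCA -[leRHS]mulr1 ler_pM2l// ler_pdivrMr// mul1r ler_nat.
  exact: leqnSn.
have total : (Q%:R * (1 - e) - n%:R) * m G' <= \sum_cq m (E cq).
  apply: sum_pm_ge => //.
    have : Q%:R * (16%:R * e) <= Q%:R * 1 by rewrite ler_pM2l.
    by rewrite mulrBr; lra.
  move=> x [Gx _]; have [nN mx _] := HG x Gx; rewrite sumE.
  apply: (@le_trans _ _ (\sum_(c < n) (Q%:R * F c x - 1))).
    rewrite sumrB -mulr_sumr sumF sumr_const card_ord lerD2r.
    by rewrite ler_pM2l.
  by apply: ler_sum => c _; apply: levels_ge; exact: QF1.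
have boundary i : (i < L)%N -> \sum_cq bd (ga i) (E cq) <= Q%:R * (4%:R * e) + n%:R +
    Q%:R * m (~` G').
  move=> iL; apply: (sum_pm_le (N := N)) => //.
  - by rewrite addr_ge0// mulr_ge0// mulr_ge0// ltW.
  - by move=> cq; exact: measurable_escape.
  - move=> x nN [Gx nmis]; have [_ _ /(_ i iL)[nNy my dxy]] := HG x Gx.
    have match_f k l : (k < K)%N -> (l < K)%N -> cS (g k x, g l (ga i x)) ->
        f (g k x) = f (g l (ga i x)).
      move=> kK lK Skl; apply: contrapT => fkl; apply: nmis.
      by exists i; split => //; exists k; split => //; exists l; split.
    have diff := color_mass_diff hS hR hSR gI xi1 pE n nN nNy (gaR i x) e0 my dxy match_f.
    have -> : \sum_cq \1_(escape (ga i) (E cq)) x = \sum_(c < n) \sum_(q < Q)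
        ((q.+1%:R <= Q%:R * F c x :> R) && ~~ (q.+1%:R <= Q%:R * F c (ga i x) :> R))%:R :> R.
      rewrite pair_big /=; apply: eq_bigr => cq _.
      case: (boolP (_ && _)) => [/andP[h1 /negP h2]|/negP H].
        by rewrite indic_in.
      rewrite indic_notin// => -[h1 h2]; apply: H; apply/andP; split => //.
      exact/negP.
    apply: (@le_trans _ _ (\sum_(c < n) (Q%:R * Num.max 0 (F c x - F c (ga i x)) + 1))).
      apply: ler_sum => c _.
      rewrite maxr_pMr// mulr0 mulrBr; apply: levels_diff; [exact: QF0|exact: QF1|exact: QF1].
    by rewrite big_split /= -mulr_sumr sumr_const card_ord lerD2r ler_pM2l.
  - move=> x nN; apply: (@le_trans _ _ (\sum_cq \1_(E cq) x)).
      apply: ler_sum => cq _; rewrite !indicE ler_nat.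
      case: (boolP (x \in escape _ _)) => // /set_mem[h1 _].
      by rewrite mem_set.
    rewrite sumE; apply: (@le_trans _ _ (\sum_(c < n) Q%:R * F c x)).
      by apply: ler_sum => c _; exact: levels_le.
    by rewrite -mulr_sumr sumF -[leRHS]mulr1 ler_pM2l//; exact: mass1.
have lower : (1 - e) * \sum_cq m (E cq) <= \sum_cq m (E cq) * (1 - m (E cq)).
  rewrite mulr_sumr; apply: ler_sum => cq _; rewrite mulrC ler_wpM2l ?pm_ge0//.
  by have := Esmall cq; lra.
have upper : \sum_cq m (E cq) * (1 - m (E cq)) <=
    C * (L%:R * (Q%:R * (4%:R * e) + n%:R + Q%:R * m (~` G'))).
  apply: (@le_trans _ _ (\sum_cq C * bdsum mu L ga (E cq))).
    by apply: ler_sum => cq _; exact: cheeger.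
  rewrite -mulr_sumr ler_pM2l// /bdsum exchange_big /=.
  apply: (@le_trans _ _ (\sum_(i < L) (Q%:R * (4%:R * e) + n%:R + Q%:R * m (~` G')))).
    by apply: ler_sum => i _; exact: boundary.
  by rewrite sumr_const card_ord -[leLHS]mulr_natl.
have u1 : Q%:R * (4%:R * e) + n%:R + Q%:R * m (~` G') <= Q%:R * (7%:R * e).
  have : Q%:R * m (~` G') <= Q%:R * (2%:R * e) by rewrite ler_pM2l.
  by have := nQ; lra.
have u2 : C * (L%:R * (Q%:R * (4%:R * e) + n%:R + Q%:R * m (~` G'))) <=
    Q%:R * (C * L%:R * (7%:R * e)).
  have -> : Q%:R * (C * L%:R * (7%:R * e)) = C * (L%:R * (Q%:R * (7%:R * e))) by ring.
  by rewrite ler_pM2l// ler_wpM2l.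
have u3 : Q%:R * (C * L%:R * (7%:R * e)) < Q%:R * 2%:R^-1.
  by rewrite ltr_pM2l//; lra.
have mGp : 1 - 2%:R * e <= m G' by rewrite -[G']setCK pm_C ?lerD2l ?lerN2//; exact: measurableC.
have l1 : Q%:R * (1 - 2%:R * e) <= Q%:R * (1 - e) - n%:R by have := nQ; lra.
have l2 : Q%:R * ((1 - 2%:R * e) * (1 - 2%:R * e)) <= \sum_cq m (E cq).
  apply: le_trans total; rewrite mulrA; apply: ler_pM => //.
    by rewrite mulr_ge0//; lra.
  by lra.
have l3 : Q%:R * ((1 - e) * ((1 - 2%:R * e) * (1 - 2%:R * e))) <= (1 - e) * \sum_cq m (E cq).
  by rewrite mulrCA ler_pM2l//; lra.
have l4 : Q%:R * 2%:R^-1 <= Q%:R * ((1 - e) * ((1 - 2%:R * e) * (1 - 2%:R * e))).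
  by rewrite ler_pM2l//; nra.
have : Q%:R * 2%:R^-1 < Q%:R * 2%:R^-1 :> R.
  apply: le_lt_trans u3; apply: le_trans u2; apply: le_trans upper.
  by apply: le_trans lower; exact: le_trans l3.
by rewrite ltxx.
Qed.

End contradiction.

Local Open Scope ereal_scope.

Theorem theorem1p2 (R : realType) (d : measure_display) (X : measurableType d)
    (mu : probability X R) (cS cR : set (X * X))
    (hX : standard_borel R X)
    (hS : dmp_equivalence mu cS) (hR : dmp_equivalence mu cR)
    (hSR : cS `<=` cR)
    (hco : coamenable mu cS cR)
    (herg : strongly_ergodic setT mu cR) :
  exists E : set X,
    [/\ measurable E,
        invariant_set setT mu cS E,
        0 < mu E &
        strongly_ergodic E (cond_measure mu E) (restrict_rel cS E)].
Proof.
have [g [gI gP]] := generating_involutions hX hR.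
have [s [sI sP]] := generating_involutions hX hS.
have [//|col] := component_or_coloring hX hS sI sP.
have [L [ga [C [gaI C0 cheeger]]]] := strongly_ergodic_expansion hX hR gI gP herg.
exfalso; apply: (coloring_contradiction hX hS hR hSR gI sI sP gaI C0 cheeger _ col).
by move=> e e0; exact: coamenable_good_family.
Qed.
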